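(* Let $\bar A\in\{0,1\}^{n\times n}$. A triple $(\bar B,\bar K,\bar C)$ of matrices in $\{0,1\}^{n\times n}$ is a solution to problem $\mathcal P_2$, i.e. it minimizes $\|\bar B\|_0+\|\bar C\|_0+\|\bar K\|_0$ among all triples in $\{0,1\}^{n\times n}$ for which $(\bar A,\bar B,\bar K,\bar C)$ has no structurally fixed modes, if and only if the pair $(\bar B,\bar C)$ is a minimal solution to $\mathcal P_1$ and $\bar K$ is a mix-pairing of $\mathcal D(\bar A,\bar B,\bar C)$.
   Context: $\|M\|_0$ is the number of non-zero entries of $M$. Structural controllability/observability: $(\bar A,\bar B)$ is structurally controllable if there is a controllable real pair $(A_0,B_0)$ (system $\dot x=A_0x+B_0u$) having the same locations of zero and non-zero entries as $(\bar A,\bar B)$; $(\bar A,\bar C)$ is structurally observable if $(\bar A^T,\bar C^T)$ is structurally controllable. Structurally fixed modes: for a binary matrix $\bar M$, let $[\bar M]$ be the set of real matrices $M$ of the same size with $M_{ij}=0$ whenever $\bar M_{ij}=0$; $\sigma(X)$ is the set of eigenvalues of $X$. $(\bar A,\bar B,\bar K,\bar C)$ has structurally fixed modes if $\bigcap_{K\in[\bar K]}\sigma(A+BKC)\neq\emptyset$ for all $A\in[\bar A],B\in[\bar B],C\in[\bar C]$; otherwise it has no structurally fixed modes. Problem $\mathcal P_1$: a solution is a pair $(\bar B,\bar C)$ with $\bar B,\bar C\in\{0,1\}^{n\times n}$ such that $\bar B$ minimizes $\|\bar B\|_0$ subject to $(\bar A,\bar B)$ structurally controllable, and $\bar C$ minimizes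 $\|\bar C\|_0$ subject to $(\bar A,\bar C)$ structurally observable. It is a minimal solution if moreover $\bar B$ has the smallest number of non-zero columns among all minimizers of the first problem and $\bar C$ has the smallest number of non-zero rows among all minimizers of the second problem. Digraphs: $\mathcal X=\{x_1,\dots,x_n\}$, $\mathcal U=\{u_1,\dots,u_n\}$, $\mathcal Y=\{y_1,\dots,y_n\}$. $\mathcal D(\bar A,\bar B,\bar C)$ has vertex set $\mathcal X\cup\mathcal U\cup\mathcal Y$ and edges $(x_i,x_j)$ when $\bar A_{ji}=1$, $(u_j,x_i)$ when $\bar B_{ij}=1$, $(x_i,y_j)$ when $\bar C_{ji}=1$. $\mathcal D(\bar A,\bar B,\bar K,\bar C)$ has in addition the feedback edges $\mathcal E_{\mathcal Y,\mathcal U}=\{(y_j,u_i):\bar K_{ij}=1\}$. An input $u_j$ is effective if column $j$ of $\bar B$ is non-zero; an output $y_j$ is effective if row $j$ of $\bar C$ is non-zero. Mix-pairing: the IO-reachability bipartite graph $\mathcal B^{u,y}=\mathcal B(\mathcal V_u,\mathcal V_y,\mathcal E_{u,y})$ has as left vertices the set $\mathcal V_u$ of effective inputs, as right vertices the set $\mathcal V_y$ of effective outputs, and $(u,y)\in\mathcal E_{u,y}$ iff there is a directed path from $u$ to $y$ in $\mathcal D(\bar A,\bar B,\bar C)$. Let $M^{u,y}$ be a maximum matching of $\mathcal B^{u,y}$, and let $\mathcal S_1,\dots,\mathcal S_{|M^{u,y}|}$ be pairwise disjoint (possibly empty) subsets of $M^{u,y}$ with union $M^{u,y}$. Let $\mathcal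 F(M^{u,y},\mathcal S_i)$ be the collection of all sets $\{f_1,\dots,f_{|\mathcal S_i|}\}$ of edges from $\mathcal V_y$ to $\mathcal V_u$ such that, for some enumeration $e_1,\dots,e_{|\mathcal S_i|}$ of $\mathcal S_i$, the sequence $e_1f_1e_2f_2\cdots e_{|\mathcal S_i|}f_{|\mathcal S_i|}$ is a directed cycle (elements of $\mathcal S_i$ directed from inputs to outputs); $\mathcal F(M^{u,y},\emptyset)=\{\emptyset\}$. Let $\mathcal K(M^{u,y},\mathcal S_1,\dots,\mathcal S_{|M^{u,y}|})$ be the set of $\bar K\in\{0,1\}^{n\times n}$ whose feedback edge set is $\bigcup_i\mathcal E_i$ for some choice $\mathcal E_i\in\mathcal F(M^{u,y},\mathcal S_i)$. A mix-pairing of $\mathcal D(\bar A,\bar B,\bar C)$ is a $\bar K$ belonging to $\mathcal K(M^{u,y},\mathcal S_1,\dots,\mathcal S_{|M^{u,y}|})$ for some such $M^{u,y}$ and $\mathcal S_1,\dots,\mathcal S_{|M^{u,y}|}$ and such that, in $\mathcal D(\bar A,\bar B,\bar K,\bar C)$, each state vertex lies in a strongly connected component that contains an edge of $\mathcal E_{\mathcal Y,\mathcal U}$. *)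

(* Defs.v *)
From mathcomp Require Import all_boot all_order all_algebra complex.
From mathcomp Require Import all_classical all_reals all_analysis.

Set Implicit Arguments.
Unset Strict Implicit.
Unset Printing Implicit Defensive.

Import Order.TTheory GRing.Theory Num.Theory.
Import numFieldNormedType.Exports.
Local Open Scope ring_scope.

(* Binary matrices are boolean matrices: the entry 1 is true. *)

Definition nnz m n (M : 'M[bool]_(m, n)) : nat :=
  #|[set p : 'I_m * 'I_n | M p.1 p.2]%SET|.

Definition nonzero_rows m n (M : 'M[bool]_(m, n)) : {set 'I_m} :=
  [set i | [exists j, M i j]]%SET.

Definition nonzero_cols m n (M : 'M[bool]_(m, n)) : {set 'I_n} :=
  [set j | [exists i, M i j]]%SET.

Section Structural.
Variable R : realType.

(* The pair (A, B) is controllable if the state of x' = A x + B u can be driven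
   from any x0 to any x1 in some finite time by a continuous input. *)
Definition controllable n m (A : 'M[R]_n) (B : 'M[R]_(n, m)) : Prop :=
  forall x0 x1 : 'cV[R]_n, exists (T : R) (u : R -> 'cV[R]_m) (x : R -> 'cV[R]_n),
    [/\ 0 < T, continuous u,
        forall t : R, is_derive t (1 : R) x (A *m x t + B *m u t),
        x 0 = x0 & x T = x1].

Definition same_zeros m n (Mb : 'M[bool]_(m, n)) (M : 'M[R]_(m, n)) : Prop :=
  forall i j, (M i j != 0) = Mb i j.

Definition struct_controllable n m (Ab : 'M[bool]_n) (Bb : 'M[bool]_(n, m)) :=
  exists (A0 : 'M[R]_n) (B0 : 'M[R]_(n, m)),
    [/\ same_zeros Ab A0, same_zeros Bb B0 & controllable A0 B0].

Definition struct_observable n p (Ab : 'M[bool]_n) (Cb : 'M[bool]_(p, n)) :=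
  struct_controllable Ab^T Cb^T.

(* Entries allowed to be non-zero by the pattern may still vanish. *)
Definition pattern m n (Mb : 'M[bool]_(m, n)) : set 'M[R]_(m, n) :=
  [set M | forall i j, ~~ Mb i j -> M i j = 0]%classic.

Definition spectrum n (M : 'M[R]_n) : set R[i] :=
  [set z | eigenvalue (map_mx (real_complex R) M) z]%classic.

Definition has_SFM n m p (Ab : 'M[bool]_n) (Bb : 'M[bool]_(n, m))
    (Kb : 'M[bool]_(m, p)) (Cb : 'M[bool]_(p, n)) : Prop :=
  forall A B C, pattern Ab A -> pattern Bb B -> pattern Cb C ->
    (\bigcap_(K in pattern Kb) spectrum (A + B *m K *m C) !=set0)%classic.

Definition min_input n (Ab Bb : 'M[bool]_n) : Prop :=
  struct_controllable Ab Bb /\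
  (forall Bb' : 'M[bool]_n, struct_controllable Ab Bb' -> (nnz Bb <= nnz Bb')%N).

Definition min_output n (Ab Cb : 'M[bool]_n) : Prop :=
  struct_observable Ab Cb /\
  (forall Cb' : 'M[bool]_n, struct_observable Ab Cb' -> (nnz Cb <= nnz Cb')%N).

Definition P1_solution n (Ab Bb Cb : 'M[bool]_n) : Prop :=
  min_input Ab Bb /\ min_output Ab Cb.

Definition P1_minimal_solution n (Ab Bb Cb : 'M[bool]_n) : Prop :=
  [/\ P1_solution Ab Bb Cb,
      forall Bb', min_input Ab Bb' ->
        (#|nonzero_cols Bb| <= #|nonzero_cols Bb'|)%N
    & forall Cb', min_output Ab Cb' ->
        (#|nonzero_rows Cb| <= #|nonzero_rows Cb'|)%N].

Definition P2_solution n (Ab Bb Kb Cb : 'M[bool]_n) : Prop :=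
  ~ has_SFM Ab Bb Kb Cb /\
  (forall Bb' Kb' Cb' : 'M[bool]_n, ~ has_SFM Ab Bb' Kb' Cb' ->
    (nnz Bb + nnz Cb + nnz Kb <= nnz Bb' + nnz Cb' + nnz Kb')%N).

End Structural.

Section Digraph.
Variable n : nat.

(* States, inputs and outputs, in this order. *)
Definition vertex : finType := ('I_n + 'I_n + 'I_n)%type.
Definition stateV (i : 'I_n) : vertex := inl (inl i).
Definition inputV (i : 'I_n) : vertex := inl (inr i).
Definition outputV (i : 'I_n) : vertex := inr i.

Definition sys_digraph (Ab Bb Cb : 'M[bool]_n) : rel vertex := fun v w =>
  match v, w with
  | inl (inl i), inl (inl j) => Ab j i
  | inl (inr j), inl (inl i) => Bb i j
  | inl (inl i), inr j => Cb j i
  | _, _ => false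
  end.

Definition fb_digraph (Kb : 'M[bool]_n) : rel vertex := fun v w =>
  match v, w with
  | inr j, inl (inr i) => Kb i j
  | _, _ => false
  end.

Definition closed_digraph (Ab Bb Kb Cb : 'M[bool]_n) : rel vertex :=
  relU (sys_digraph Ab Bb Cb) (fb_digraph Kb).

(* The pair (i, j) stands for the edge from input i to output j. *)
Definition io_edges (Ab Bb Cb : 'M[bool]_n) : {set 'I_n * 'I_n} :=
  [set e | [&& e.1 \in nonzero_cols Bb, e.2 \in nonzero_rows Cb
             & connect (sys_digraph Ab Bb Cb) (inputV e.1) (outputV e.2)]]%SET.

Definition is_matching (E M : {set 'I_n * 'I_n}) : Prop :=
  [/\ M \subset E, {in M &, injective fst} & {in M &, injective snd}].

Definition is_max_matching (E M : {set 'I_n * 'I_n}) : Prop :=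
  is_matching E M /\ (forall M', is_matching E M' -> (#|M'| <= #|M|)%N).

Definition is_dicycle (c : seq (vertex * vertex)) : bool :=
  [&& c != [::], cycle (fun e f => e.2 == f.1) c & uniq (map fst c)].

Definition io_edge (e : 'I_n * 'I_n) : vertex * vertex :=
  (inputV e.1, outputV e.2).

(* A feedback edge is a pair (j, i): it goes from output j to input i. *)
Definition fb_edge (f : 'I_n * 'I_n) : vertex * vertex :=
  (outputV f.1, inputV f.2).

(* F is a member of the collection F(M, S): S = {e_1, ..., e_k},
   F = {f_1, ..., f_k} and e_1 f_1 ... e_k f_k is a directed cycle.  When the
   edges in S join effective inputs to effective outputs, the cycle condition
   forces those in F to join effective outputs to effective inputs. *)
Definition fb_family (S F : {set 'I_n * 'I_n}) : Prop :=
  (S = finset.set0 /\ F = finset.set0) \/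
  exists es fs : seq ('I_n * 'I_n),
    [/\ uniq es, size fs = size es, S = [set e in es]%SET, F = [set f in fs]%SET
      & is_dicycle (flatten [seq [:: io_edge p.1; fb_edge p.2] | p <- zip es fs])].

Definition fb_edges (Kb : 'M[bool]_n) : {set 'I_n * 'I_n} :=
  [set f | Kb f.2 f.1]%SET.

(* Kb belongs to K(M, S_1, ..., S_|M|). *)
Definition fb_configuration (M : {set 'I_n * 'I_n})
    (S : 'I_#|M| -> {set 'I_n * 'I_n}) (Kb : 'M[bool]_n) : Prop :=
  exists E : 'I_#|M| -> {set 'I_n * 'I_n},
    (forall i, fb_family (S i) (E i)) /\
    fb_edges Kb = (\bigcup_(i < #|M|) E i)%SET.

Definition same_scc (g : rel vertex) (v w : vertex) : bool :=
  connect g v w && connect g w v.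

Definition states_in_fb_scc (Ab Bb Kb Cb : 'M[bool]_n) : Prop :=
  forall k : 'I_n, exists i j : 'I_n,
    let g := closed_digraph Ab Bb Kb Cb in
    [/\ Kb i j, same_scc g (stateV k) (outputV j)
      & same_scc g (stateV k) (inputV i)].

Definition mix_pairing (Ab Bb Cb Kb : 'M[bool]_n) : Prop :=
  (exists (M : {set 'I_n * 'I_n}) (S : 'I_#|M| -> {set 'I_n * 'I_n}),
    [/\ is_max_matching (io_edges Ab Bb Cb) M,
        forall i j, i != j -> [disjoint S i & S j],
        (\bigcup_(i < #|M|) S i)%SET = M
      & fb_configuration S Kb]) /\
  states_in_fb_scc Ab Bb Kb Cb.

End Digraph.

(* Main.v *)
Require Import Defs.
From mathcomp Require Import all_boot all_order all_algebra all_fingroup complex.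
From mathcomp Require Import all_classical all_reals all_analysis.
From mathcomp Require Import ring lra zify.

(** Everything reduces to combinatorics of the closed-loop digraph.  Let m be
    the number of states minus the size of a largest matching formed by
    state-to-state edges (its term rank), and let m' be m, raised to 1 when m
    is 0 and there is at least one state.

    Two graph criteria carry the algebra.  A pair of patterns is structurally
    controllable iff every state is reachable from an input and a single
    matching of the edges enters every state (struct_controllable_necessary,
    struct_controllable_sufficient).  There are no structurally fixed modes iff
    every state shares a strong component with a feedback edge and the states
    are covered by disjoint cycles (no_SFM_sufficient, no_SFM_cover,
    no_SFM_fb_scc).  Both sufficiency proofs rest on one construction: give the
    edges of a cycle cover weights that force eigenvalues of a different modulus
    on each cycle, and hook the cycles together by a forest of unit edges rooted
    at the inputs.  An eigenvector that vanishes at the inputs then vanishes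
    (weights_controllable).  Controllability and observability of a single real
    closed loop follow from two such weightings because both conditions are the
    non-vanishing of a Gram determinant, which is polynomial along the segment
    joining them; a fixed mode is finally destroyed by changing the gain of one
    chosen feedback edge in each strong component
    (resonance_shift_not_eigenvalue).  The link with trajectories is made by
    polynomial inputs on one side (gram_controllable) and by uniqueness for
    linear differential equations on the other (controllable_no_invariant).

    A system without fixed modes is structurally controllable and observable,
    so it pays at least the two optimal values of the first problem; and a
    cycle cover contains at least m feedback edges, so it pays at least m' for
    the feedback pattern (min_ports_le_nnz_fb).  These bounds are attained
    together (feasible_bound): an optimal input pattern can be rearranged to use
    only m' columns (reduce_cols), the optimal outputs only m' rows, and
    connecting the resulting ports in one big loop leaves no fixed mode
    (cyclic_fb).  Optimality of a triple therefore means equality in all three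
    bounds.  Equality leaves no idle port and no spare feedback edge, so
    feedback is a perfect matching from outputs to inputs; combined with a
    perfect matching of the input-output reachability graph it decomposes into
    alternating cycles, which is a mix-pairing (perfect_configuration).
    Conversely a mix-pairing is such a perfect matching
    (configuration_perfect), and the theorem of Mendelsohn and Dulmage supplies
    a matching of the system edges that together with the feedback edges is a
    cycle cover (cover_of_perfect_fb). *)

Set Implicit Arguments.
Unset Strict Implicit.
Unset Printing Implicit Defensive.

Import Order.TTheory GRing.Theory Num.Theory.
Import numFieldNormedType.Exports.
Local Open Scope ring_scope.

(** * Gram matrices and the Hautus test *)

(** Applying to v the factors A - r of an annihilating polynomial one after
    the other, the last non-zero vector is an eigenvector.  The counter in Q
    lets a property degrade at each step, as happens for the vanishing of
    v A^k B for k below a bound. *)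
Lemma eigenvector_of_annihilator (F : fieldType) (n : nat) (A : 'M[F]_n.+1)
    (Q : nat -> 'rV[F]_n.+1 -> Prop)
    (hQ : forall s v r, Q s.+1 v -> Q s (v *m A - r *: v)) rs v :
  v != 0 -> Q (size rs) v ->
  v *m horner_mx A (\prod_(r <- rs) ('X - r%:P)) = 0 ->
  exists w r s, [/\ w != 0, Q s.+1 w & w *m A = r *: w].
Proof.
elim: rs v => [|r rs IH] v v0 Qv.
  by rewrite big_nil rmorph1 mulmx1 => /eqP; rewrite (negbTE v0).
rewrite big_cons rmorphM /= mulmxA rmorphB /= horner_mx_X horner_mx_C.
rewrite mulmxBr mul_mx_scalar => h.
have [/eqP|nz] := eqVneq (v *m A - r *: v) 0.
  by rewrite subr_eq0 => /eqP vA; exists v, r, (size rs); split.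
by apply: (IH _ nz) => //; apply: hQ.
Qed.

Lemma stable_eigenvector (F : closedFieldType) (n : nat) (A : 'M[F]_n)
    (Q : nat -> 'rV[F]_n -> Prop)
    (hQ : forall s v r, Q s.+1 v -> Q s (v *m A - r *: v)) v :
  v != 0 -> Q n v ->
  exists w r s, [/\ w != 0, Q s.+1 w & w *m A = r *: w].
Proof.
case: n A Q hQ v => [|n] A Q hQ v; first by rewrite thinmx0 eqxx.
have [rs Ers] := closed_field_poly_normal (char_poly A).
have m : char_poly A \is monic by exact: char_poly_monic.
rewrite (monicP m) scale1r in Ers.
move=> v0 Qv; apply: (eigenvector_of_annihilator hQ (rs := rs) v0).
  suff -> : size rs = n.+1 by [].
  by apply/eqP; rewrite -eqSS -(size_prod_XsubC rs id) -Ers size_char_poly.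
by rewrite -Ers Cayley_Hamilton mulmx0.
Qed.

(** The discrete controllability Gramian.  Being square, it turns the rank
    condition of Kalman into one determinant, hence into one polynomial in the
    entries of A and B. *)
Definition gram (S : comNzRingType) n m (A : 'M[S]_n) (B : 'M[S]_(n, m)) :=
  \sum_(k < n) (A ^+ k *m B) *m (A ^+ k *m B)^T.

Lemma map_mxX (S T : pzRingType) (f : {rmorphism S -> T}) n (A : 'M[S]_n) k :
  map_mx f (A ^+ k) = map_mx f A ^+ k.
Proof.
by elim: k => [|k IH]; rewrite ?expr0 ?map_mx1 // !exprS -!mulmxE map_mxM IH.
Qed.

Lemma map_gram (S T : comNzRingType) (f : {rmorphism S -> T}) n m
    (A : 'M[S]_n) (B : 'M[S]_(n, m)) :
  map_mx f (gram A B) = gram (map_mx f A) (map_mx f B).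
Proof.
rewrite /gram raddf_sum; apply: eq_bigr => k _ /=.
by rewrite !map_mxM -map_trmx !map_mxM map_mxX.
Qed.

(** The test of Popov, Belevitch and Hautus: no left eigenvector of A is
    annihilated by B. *)
Definition pbh (F : fieldType) n m (A : 'M[F]_n) (B : 'M[F]_(n, m)) : Prop :=
  forall (r : F) (v : 'rV[F]_n), v *m A = r *: v -> v *m B = 0 -> v = 0.

Lemma gram_pbh (F : fieldType) n m (A : 'M[F]_n) (B : 'M[F]_(n, m)) :
  \det (gram A B) != 0 -> pbh A B.
Proof.
move=> dG r v vA vB.
have vAk k : v *m A ^+ k = r ^+ k *: v.
  elim: k => [|k IH]; first by rewrite !expr0 scale1r mulmx1.
  by rewrite exprS -mulmxE mulmxA vA -scalemxAl IH scalerA -exprS.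
have vG : v *m gram A B = 0.
  rewrite /gram mulmx_sumr big1 // => k _.
  by rewrite mulmxA (mulmxA v) vAk -scalemxAl vB scaler0 mul0mx.
have uG : gram A B \in unitmx by rewrite unitmxE unitfE.
by rewrite -[v](mulmxK uG) vG mul0mx.
Qed.

Lemma rV_sqnorm_ge0 (F : realDomainType) m (x : 'rV[F]_m) :
  0 <= (x *m x^T) 0 0.
Proof. by rewrite mxE sumr_ge0 // => j _; rewrite mxE -expr2 sqr_ge0. Qed.

Lemma rV_sqnorm_eq0 (F : realDomainType) m (x : 'rV[F]_m) :
  x *m x^T = 0 -> x = 0.
Proof.
move=> /matrixP/(_ 0 0); rewrite !mxE => /eqP.
rewrite psumr_eq0 => [/allP h|i _]; last by rewrite mxE -expr2 sqr_ge0.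
apply/rowP => i; have := h i (mem_index_enum i).
by rewrite !mxE mulf_eq0 orbb => /eqP.
Qed.

(** A real left null vector v of the Gramian satisfies v A^k B = 0 for all
    k < n, a sum of squares being zero; over the complex numbers the factors of
    the characteristic polynomial then lead from v to an eigenvector killed by B. *)
Lemma pbh_gram (R : realType) n m (A : 'M[R]_n) (B : 'M[R]_(n, m)) :
  pbh (map_mx (real_complex R) A) (map_mx (real_complex R) B) ->
  \det (gram A B) != 0.
Proof.
move=> h; apply/negP => /det0P [v v0 vG].
have vk (k : 'I_n) : v *m A ^+ k *m B = 0.
  have : v *m gram A B *m v^T = 0 by rewrite vG mul0mx.
  rewrite /gram mulmx_sumr mulmx_suml.
  have E (k' : 'I_n) : v *m ((A ^+ k' *m B) *m (A ^+ k' *m B)^T) *m v^T =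
     (v *m A ^+ k' *m B) *m (v *m A ^+ k' *m B)^T.
    by rewrite -[v *m A ^+ k' *m B]mulmxA [in RHS]trmx_mul !mulmxA.
  rewrite (eq_bigr _ (fun k' _ => E k')) => /matrixP/(_ 0 0).
  rewrite summxE mxE => /eqP; rewrite psumr_eq0; last by move=> i _; exact: rV_sqnorm_ge0.
  move=> /allP/(_ k (mem_index_enum k))/eqP h0; apply: rV_sqnorm_eq0.
  by apply/matrixP => i j; rewrite !ord1 h0 mxE.
pose f := real_complex R.
pose Q s (w : 'rV[R[i]]_n) := forall k, (k < s)%N -> w *m map_mx f A ^+ k *m map_mx f B = 0.
have hQ s w r : Q s.+1 w -> Q s (w *m map_mx f A - r *: w).
  move=> hw k ks; rewrite !mulmxBl -!scalemxAl hw 1?ltnW // scaler0 subr0.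
  by rewrite -(mulmxA w) mulmxE -exprS hw.
have [||w [r [s [w0 Qw wA]]]] := stable_eigenvector hQ (v := map_mx f v).
- by rewrite map_mx_eq0.
- by move=> k kn; rewrite -map_mxX -!map_mxM (vk (Ordinal kn)) map_mx0.
by move/eqP: w0; apply; apply: (h r) => //; have := Qw 0%N isT; rewrite expr0 mulmx1.
Qed.

Lemma exists_nonroot (F : numFieldType) (p : {poly F}) :
  p != 0 -> exists t, p.[t] != 0.
Proof.
move=> p0; pose rs := [seq (i%:R : F) | i <- iota 0 (size p)].
case: (boolP (all (root p) rs)) => [h|/allPn[t _ ht]]; last by exists t.
suff : (size rs < size p)%N by rewrite size_map size_iota ltnn.
apply: max_poly_roots => //; rewrite map_inj_uniq ?iota_uniq //.
by move=> i j /eqP; rewrite eqr_nat => /eqP.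
Qed.

(** * Edge weights for which no mode escapes the inputs *)

Section CycleForest.
Variables (V : finType) (g : rel V) (s : {perm V}) (U0 : pred V).

Definition reached v := [exists u, U0 u && connect g u v].

Lemma reached_edge v w : reached v -> g v w -> reached w.
Proof.
case/existsP => u /andP[uu uv] vw; apply/existsP; exists u.
by rewrite uu (connect_trans uv) ?connect1.
Qed.

(** Vertices joined to a root by a walk of length k; unlike spheres, levels
    may overlap. *)
Fixpoint level k : {set V} :=
  if k is k'.+1 then [set w | [exists v in level k', g v w]]%SET
  else [set u | U0 u]%SET.

Definition depth (c : {set V}) : nat :=
  if pselect (exists k, [exists v in c, v \in level k]) is left h
  then ex_minn h else 0.

(** The unit edge by which a cycle at positive depth is hooked to a cycle
    of smaller depth. *)
Definition entry (c : {set V}) : option (V * V) :=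
  if depth c is k.+1 then
    [pick e | [&& e.2 \in c, e.1 \in level k & g e.1 e.2]]
  else None.

Lemma level_reached k v : v \in level k -> reached v.
Proof.
elim: k v => [|k IH] v /=; rewrite inE.
  by move=> uv; apply/existsP; exists v; rewrite uv connect0.
by case/existsP => w /andP[/IH rw]; exact: reached_edge.
Qed.

Lemma reached_level v : reached v -> exists k, v \in level k.
Proof.
case/existsP => u /andP[uu /connectP[p]].
elim/last_ind: p v => [|p w IH] v /=.
  by move=> _ ->; exists 0; rewrite inE.
rewrite rcons_path last_rcons => /andP[/IH h gw] ->.
have [k hk] := h _ erefl; exists k.+1; rewrite inE.
by apply/existsP; exists (last u p); rewrite hk.
Qed.

Lemma depth_le (c : {set V}) v k : v \in c -> v \in level k -> (depth c <= k)%N.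
Proof.
move=> vc vk; rewrite /depth; case: pselect => // h.
by case: ex_minnP => m _; apply; apply/existsP; exists v; rewrite vc.
Qed.

Lemma depthP (c : {set V}) v : v \in c -> reached v -> exists2 w, w \in c & w \in level (depth c).
Proof.
move=> vc /reached_level[k vk]; rewrite /depth; case: pselect => [h|[]].
  by case: ex_minnP => m /existsP[w /andP[wc wm]] _; exists w.
by exists k; apply/existsP; exists v; rewrite vc.
Qed.

Lemma entryP (c : {set V}) p q : entry c = Some (p, q) ->
  [/\ q \in c, reached p, g p q & forall c' : {set V}, p \in c' -> (depth c' < depth c)%N].
Proof.
rewrite /entry; case E : (depth c) => [//|k]; case: pickP => // -[p' q'] /=.
case/and3P => qc pk gpq [<- <-]; split => //; first exact: level_reached pk.
by move=> c' pc'; rewrite ltnS; apply: depth_le pc' pk.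
Qed.

Lemma entry_None (c : {set V}) v : v \in c -> reached v -> entry c = None ->
  exists2 u, u \in c & U0 u.
Proof.
move=> vc rv; have [w wc] := depthP vc rv.
rewrite /entry; case: (depth c) => [|k]; first by rewrite inE; exists w.
rewrite inE => /existsP[p /andP[pk gpw]]; case: pickP => // /(_ (p, w)) /=.
by rewrite wc pk gpw.
Qed.

Section Weights.
Variables (R : realType) (st : pred V).
Hypothesis s_edge : forall v, g v (s v) || (s v == v) && ~~ st v.
Hypothesis s_state : forall v, g v (s v) -> exists2 w, w \in porbit s v & st w.

(** All that matters is that distinct cycles get distinct positive values. *)
Definition modulus (c : {set V}) : R := (enum_rank c).+1%:R.

(** Only edges leaving a state carry the modulus: a cycle through k states
    then has weight modulus^k, and its eigenvalues, which satisfy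
    l^k = modulus^k, all have the modulus of the cycle as absolute value. *)
Definition cycle_weight v : R :=
  if g v (s v) then (if st v then modulus (porbit s v) else 1) else 0.

Definition weight v w : R :=
  (if w == s v then cycle_weight v else 0) +
  (if entry (porbit s w) == Some (v, w) then 1 else 0).

Lemma weight_supp v w : weight v w != 0 -> g v w.
Proof.
rewrite /weight; case: (entry _ =P _) => [h _|_]; first by have [] := entryP h.
rewrite addr0 /cycle_weight; case: (w =P s v) => [->|_]; last by rewrite eqxx.
by case: ifP => //; rewrite eqxx.
Qed.

Local Notation f := (real_complex R).

Variables (l : R[i]) (x : V -> R[i]).
Let dl v : R[i] := if st v then l else 1.
Hypothesis x_eq : forall v, dl v * x v = \sum_w f (weight v w) * x w.
Hypothesis x_U0 : forall u, U0 u -> x u = 0.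

(** The eigenvector equation splits into the transport along the cycle and
    the loads coming from the cycles hooked at v. *)
Lemma loaded_cycle_eq v : dl v * x v = f (cycle_weight v) * x (s v) +
   \sum_(w | entry (porbit s w) == Some (v, w)) x w.
Proof.
rewrite x_eq (eq_bigr (fun w => f (if w == s v then cycle_weight v else 0) * x w +
   (if entry (porbit s w) == Some (v, w) then x w else 0))).
  rewrite big_split /= -big_mkcond /=; congr (_ + _).
  rewrite (bigD1 (s v)) //= eqxx big1 ?addr0 // => w /negbTE ->.
  by rewrite rmorph0 mul0r.
move=> w _; rewrite /weight rmorphD mulrDl; congr (_ + _).
by case: ifP => _; rewrite ?rmorph1 ?rmorph0 ?mul1r ?mul0r.
Qed.

Lemma cycle_weight_neq0 v : s v != v -> cycle_weight v != 0.
Proof.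
rewrite /cycle_weight; case/orP: (s_edge v) => [->|/andP[/eqP ->]]; last by rewrite eqxx.
by case: ifP; rewrite ?oner_eq0 // /modulus pnatr_eq0.
Qed.

Lemma porbit_s v w : (s w \in porbit s v) = (w \in porbit s v).
Proof. by rewrite -!eq_porbit_mem -[s w]/(aperm w s) -[s]expg1 porbit_perm. Qed.

(** Going backwards along the cycle from v reaches every vertex of it. *)
Lemma porbit_backward v (P : pred V) : P v ->
  (forall w, w \in porbit s v -> s w != w -> w != v -> P (s w) -> P w) ->
  forall w, w \in porbit s v -> P w.
Proof.
move=> Pv h w wv; have : v \in porbit s w by rewrite porbit_sym.
case/porbitP => k; elim: k w wv => [|k IH] w wv; first by rewrite expg0 perm1 => <-.
rewrite expgS permM => E; have [<- //|nwv] := eqVneq v w.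
have Psw : P (s w) by apply: IH => //; rewrite porbit_s.
by have [<- //|nsw] := eqVneq (s w) w; apply: h => //; rewrite eq_sym.
Qed.

Lemma real_complex_neq0 a : a != 0 -> f a != 0.
Proof. by rewrite fmorph_eq0. Qed.

(** Without loads the equations around a cycle multiply to an identity
    between the product of the factors and the product of the weights, which
    fixes the absolute value of l. *)
Lemma pure_cycle v : x v != 0 ->
  (forall w, w \in porbit s v -> dl w * x w = f (cycle_weight w) * x (s w)) ->
  [/\ `|l| = f (modulus (porbit s v)), l != 0 &
      forall w, w \in porbit s v -> x w != 0].
Proof.
move=> xv h.
have nz w : w \in porbit s v -> x w != 0.
  move: w; apply: (@porbit_backward _ (fun w => x w != 0)) => // w wv sw _ xsw.
  apply: contraTneq (xsw) => xw; have /esym/eqP := h _ wv.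
  by rewrite xw mulr0 mulf_eq0 (negbTE (real_complex_neq0 (cycle_weight_neq0 sw))) /= => ->.
have gs w : w \in porbit s v -> g w (s w).
  move=> wv; case/orP: (s_edge w) => // /andP[/eqP sw stw].
  have := h _ wv; rewrite sw /dl (negbTE stw) mul1r.
  rewrite /cycle_weight sw; case: ifP => // _; rewrite rmorph0 mul0r => xw.
  by have := nz _ wv; rewrite xw eqxx.
have [u uv su] := s_state (gs _ (porbit_id s v)).
have E : \prod_(w in porbit s v) dl w = \prod_(w in porbit s v) f (cycle_weight w).
  have xn : \prod_(w in porbit s v) x w != 0 by apply/prodf_neq0 => w /nz.
  apply: (mulIf xn); rewrite -big_split /= (eq_bigr _ (fun w wv => h w wv)).
  rewrite big_split /=; congr (_ * _).
  rewrite [RHS](reindex_inj (@perm_inj _ s)) /=.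
  by apply: eq_bigl => w; rewrite porbit_s.
pose a := f (modulus (porbit s v)).
have a0 : 0 < a by rewrite /a ltcR ltr0n.
pose k := #|[pred w in porbit s v | st w]|.
have k0 : (0 < k)%N by apply/card_gt0P; exists u; rewrite inE uv.
have E1 : l ^+ k = a ^+ k.
  have P (b : R[i]) : \prod_(w in porbit s v) (if st w then b else 1) = b ^+ k.
    by rewrite -big_mkcondr /= prodr_const.
  rewrite -P -[RHS]P E; apply: eq_bigr => w wv.
  have E2 : porbit s w = porbit s v by apply/eqP; rewrite eq_porbit_mem.
  by rewrite /cycle_weight gs // E2 /dl; case: ifP; rewrite ?rmorph1.
have nl : `|l| = a.
  apply/eqP; rewrite -(eqrXn2 k0) ?normr_ge0 ?ltW // -normrX E1.
  by rewrite normrX (gtr0_norm a0).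
by split => //; rewrite -normr_gt0 nl.
Qed.

Lemma modulus_inj : injective (fun c => f (modulus c)).
Proof.
move=> c d /fmorph_inj /eqP; rewrite eqr_nat eqSS => /eqP h.
exact/enum_rank_inj/val_inj.
Qed.

Definition parent v := if entry (porbit s v) is Some (p, _) then p else v.

Section Chain.
Variable v0 : V.
Hypothesis r0 : reached v0.
Hypothesis x0 : x v0 != 0.
Hypothesis deepest : forall v, reached v -> x v != 0 ->
  (depth (porbit s v) <= depth (porbit s v0))%N.

Let z i := iter i parent v0.
Let dz i := depth (porbit s (z i)).

Lemma porbitE v w : v \in porbit s w -> porbit s v = porbit s w.
Proof. by rewrite -eq_porbit_mem => /eqP. Qed.

Lemma childless_critical v : reached v -> x v != 0 ->
  (forall v' w, v' \in porbit s v -> entry (porbit s w) = Some (v', w) -> x w = 0) ->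
  [/\ `|l| = f (modulus (porbit s v)), l != 0 &
      forall w, w \in porbit s v -> x w != 0].
Proof.
move=> rv xv h; apply: pure_cycle => // w wv.
by rewrite loaded_cycle_eq big1 ?addr0 // => w' /eqP; apply: h.
Qed.

(** Cycles hooked to the deepest cycle of the support lie deeper still, so
    they put no load on it. *)
Lemma deepest_critical : [/\ `|l| = f (modulus (porbit s v0)), l != 0 &
      forall w, w \in porbit s v0 -> x w != 0].
Proof.
apply: childless_critical => // v' w v'0 e; apply/eqP/negPn/negP => xw.
have [_ rv' gv'w lt] := entryP e.
have rw : reached w := reached_edge rv' gv'w.
by have := leq_trans (lt _ v'0) (deepest rw xw); rewrite ltnn.
Qed.

(** Only one cycle can resonate with l, since moduli are distinct.  Any
    other cycle of the support must be loaded by a deeper cycle of the support,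
    so all of them are found by climbing from the deepest one. *)
Lemma support_in_chain v : reached v -> x v != 0 ->
  exists i, porbit s v = porbit s (z i).
Proof.
have [ml _ _] := deepest_critical.
have [k] := ubnP (depth (porbit s v0) - depth (porbit s v)).
elim: k v => // k IH v lek rv xv.
have [E|ne] := eqVneq (porbit s v) (porbit s v0); first by exists 0.
have [/existsP[v' /existsP[w /and3P[v'v /eqP e xw]]]|/existsPn h] :=
  boolP [exists v', exists w, [&& v' \in porbit s v,
     entry (porbit s w) == Some (v', w) & x w != 0]].
  have [_ rv' gv'w lt] := entryP e.
  have rw : reached w := reached_edge rv' gv'w.
  have lt' := lt _ v'v; have le' := deepest rw xw.
  (* The loading cycle is deeper, so it is in the chain, and its parent is the
     present cycle. *)
  have [|i Ei] := IH w _ rw xw.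
    apply: leq_trans (lek : (_ <= k)%N).
    by apply: ltn_sub2l => //; apply: leq_trans lt' le'.
  exists i.+1; rewrite -(porbitE v'v) /z iterS -/(z i).
  by rewrite /parent -Ei e.
case: (childless_critical rv xv) => [v' w v'v e|ml' _ _].
  have /existsPn/(_ w) := h v'; rewrite v'v e eqxx /= => /negPn/eqP //.
by case/eqP: ne; apply: modulus_inj; rewrite -ml -ml'.
Qed.

Lemma reached_chain i : reached (z i).
Proof.
elim: i => // i IH; rewrite /z iterS -/(z i) /parent.
by case e : (entry _) => [[p q]|//]; have [] := entryP e.
Qed.

Lemma chain_step i p q : entry (porbit s (z i)) = Some (p, q) ->
  z i.+1 = p /\ (dz i.+1 < dz i)%N.
Proof.
move=> e; have E : z i.+1 = p by rewrite /z iterS -/(z i) /parent e.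
by split => //; have [_ _ _ lt] := entryP e; apply: lt; rewrite E porbit_id.
Qed.

Lemma chain_depth i j : (i <= j)%N -> (dz j <= dz i)%N.
Proof.
move=> /subnK <-; elim: (j - i)%N => // k IH; rewrite addSn.
apply: leq_trans IH; case e : (entry (porbit s (z (k + i)))) => [[p q]|].
  by have [_ /ltnW] := chain_step e.
by rewrite /dz {1}/z iterS -/(z _) /parent e.
Qed.

(** Depth strictly decreases at each hook, so two different members of the
    chain are never hooked to the same cycle. *)
Lemma chain_entries_distinct i j p q p' q' : (i < j)%N ->
  entry (porbit s (z i)) = Some (p, q) -> entry (porbit s (z j)) = Some (p', q') ->
  porbit s p = porbit s p' -> False.
Proof.
move=> ij ei ej E; have [Ei lti] := chain_step ei; have [Ej ltj] := chain_step ej.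
have := chain_depth ij; rewrite {2}/dz Ei E -Ej -/(dz j.+1) => le.
by have := leq_trans ltj le; rewrite ltnn.
Qed.

(** Climbing one hook: the cycle above receives exactly one load, because
    the support is a chain.  If the vector vanished where the hook is attached,
    it would vanish all around that cycle and the load would be zero. *)
Lemma chain_nonzero i w : w \in porbit s (z i) -> x w != 0.
Proof.
have [_ l0 nz0] := deepest_critical.
have dl0 v : dl v != 0 by rewrite /dl; case: ifP; rewrite ?oner_eq0.
elim: i w => [|i IH] w; first exact: nz0.
case e : (entry (porbit s (z i))) => [[p q]|]; last first.
  have -> : z i.+1 = z i by rewrite /z iterS -/(z i) /parent e.
  exact: IH.
have [-> _] := chain_step e; have [qz rp _ _] := entryP e.
have xq := IH _ qz.
(* The only load on the cycle of p is x q, and it acts at p. *)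
have eqn v : v \in porbit s p ->
    dl v * x v = f (cycle_weight v) * x (s v) + (if v == p then x q else 0).
  move=> vp; rewrite loaded_cycle_eq; congr (_ + _).
  have only u : entry (porbit s u) = Some (v, u) -> x u != 0 -> u = q /\ v = p.
    move=> eu xu; have [_ rv gvu _] := entryP eu.
    have ru : reached u := reached_edge rv gvu.
    have [j Ej] := support_in_chain ru xu; have eu' := eu; rewrite Ej in eu'.
    case: (ltngtP i j) => ij.
    - by case: (chain_entries_distinct ij e eu'); rewrite (porbitE vp).
    - by case: (chain_entries_distinct ij eu' e); rewrite (porbitE vp).
    - by move: eu'; rewrite -ij e => -[-> ->].
  case: (v =P p) => [Ev|nev].
    rewrite (bigD1 q) /=; last first.
      have /eqP <- : porbit s (z i) == porbit s q by rewrite eq_porbit_mem porbit_sym.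
      by rewrite e Ev.
    rewrite big1 ?addr0 // => u /andP[/eqP eu nq]; apply/eqP/negPn/negP => xu.
    by have [E _] := only _ eu xu; rewrite E eqxx in nq.
  rewrite big1 // => u /eqP eu; apply/eqP/negPn/negP => xu.
  by have [_] := only _ eu xu.
have xp : x p != 0.
  apply/negP => /eqP xp0.
  have all0 v : v \in porbit s p -> x v == 0.
    move: v; apply: (@porbit_backward _ (fun v => x v == 0)); first by rewrite xp0.
    move=> v vp _ vnp /eqP xs; have := eqn _ vp.
    rewrite (negbTE vnp) xs mulr0 addr0 => /eqP; rewrite mulf_eq0.
    by rewrite (negbTE (dl0 v)).
  have := eqn _ (porbit_id s p); rewrite eqxx xp0 mulr0.
  have /eqP -> : x (s p) == 0 by apply: all0; rewrite porbit_s porbit_id.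
  by rewrite mulr0 add0r => /esym/eqP; rewrite (negbTE xq).
move: w; apply: (@porbit_backward _ (fun w => x w != 0)) => // w wp sw wnp xsw.
have := eqn _ wp; rewrite (negbTE wnp) addr0 => E.
apply: contraNneq xsw => xw; move/esym/eqP: E; rewrite xw mulr0 mulf_eq0.
by rewrite (negbTE (real_complex_neq0 (cycle_weight_neq0 sw))).
Qed.

(** The chain ends at a cycle through a root, where the vector is both zero
    and non-zero. *)
Lemma chain_absurd : False.
Proof.
have [k] := ubnP (dz 0); have : forall i, (dz i < k)%N -> False.
  elim: k => // k IH i le; case e : (entry (porbit s (z i))) => [[p q]|].
    by have [_ lt] := chain_step e; apply: (IH i.+1); apply: leq_trans lt le.
  have [u uz /x_U0 xu] := entry_None (porbit_id s (z i)) (reached_chain i) e.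
  by have := chain_nonzero uz; rewrite xu eqxx.
by move=> h /h.
Qed.

End Chain.

Lemma weights_controllable v : reached v -> x v = 0.
Proof.
move=> rv; apply/eqP/negPn/negP => xv.
pose P w := reached w && (x w != 0).
have Pv : P v by rewrite /P rv.
case: (@arg_maxnP _ v P (fun w => depth (porbit s w)) Pv) => w /andP[rw xw] mx.
by apply: (chain_absurd rw xw) => u ru xu; apply: mx; rewrite /P ru.
Qed.

End Weights.
End CycleForest.

(** * Steering with polynomial inputs *)

Section Steering.
Variables (R : realType).

Definition deriv_mx m n (X : 'M[{poly R}]_(m, n)) := map_mx (@deriv R) X.
Definition eval_mx m n (t : R) (X : 'M[{poly R}]_(m, n)) : 'M[R]_(m, n) :=
  map_mx (horner_eval t) X.
Definition polyC_mx m n (A : 'M[R]_(m, n)) : 'M[{poly R}]_(m, n) := map_mx polyC A.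

Lemma deriv_mxD m n (X Y : 'M[{poly R}]_(m, n)) : deriv_mx (X + Y) = deriv_mx X + deriv_mx Y.
Proof. by apply/matrixP => i j; rewrite !mxE derivD. Qed.

Lemma deriv_mx_sum m n I r (P : pred I) (X : I -> 'M[{poly R}]_(m, n)) :
  deriv_mx (\sum_(i <- r | P i) X i) = \sum_(i <- r | P i) deriv_mx (X i).
Proof.
by apply: big_morph => [? ?|]; [rewrite deriv_mxD | apply/matrixP => i j; rewrite !mxE deriv0].
Qed.

Lemma deriv_mxZ m n p (X : 'M[{poly R}]_(m, n)) :
  deriv_mx (p *: X) = deriv p *: X + p *: deriv_mx X.
Proof. by apply/matrixP => i j; rewrite !mxE derivM. Qed.

Lemma deriv_mxN m n (X : 'M[{poly R}]_(m, n)) : deriv_mx (- X) = - deriv_mx X.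
Proof. by apply/matrixP => i j; rewrite !mxE derivN. Qed.

Lemma deriv_polyC_mx m n (A : 'M[R]_(m, n)) : deriv_mx (polyC_mx A) = 0.
Proof. by apply/matrixP => i j; rewrite !mxE derivC. Qed.

Lemma deriv_mx_mulC m n p (A : 'M[R]_(m, n)) (X : 'M[{poly R}]_(n, p)) :
  deriv_mx (polyC_mx A *m X) = polyC_mx A *m deriv_mx X.
Proof.
apply/matrixP => i j; rewrite !mxE raddf_sum; apply: eq_bigr => k _ /=.
by rewrite !mxE derivM derivC mul0r add0r.
Qed.

Lemma eval_polyC_mx m n t (A : 'M[R]_(m, n)) : eval_mx t (polyC_mx A) = A.
Proof. by apply/matrixP => i j; rewrite !mxE /horner_eval hornerC. Qed.

Lemma eval_mxZ m n t p (X : 'M[{poly R}]_(m, n)) : eval_mx t (p *: X) = p.[t] *: eval_mx t X.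
Proof. by apply/matrixP => i j; rewrite !mxE /horner_eval hornerM. Qed.

Lemma eval_mxD m n t (X Y : 'M[{poly R}]_(m, n)) : eval_mx t (X + Y) = eval_mx t X + eval_mx t Y.
Proof. exact: map_mxD. Qed.

Lemma eval_mxN m n t (X : 'M[{poly R}]_(m, n)) : eval_mx t (- X) = - eval_mx t X.
Proof. exact: map_mxN. Qed.

Lemma eval_mxM m n p t (X : 'M[{poly R}]_(m, n)) (Y : 'M[{poly R}]_(n, p)) :
  eval_mx t (X *m Y) = eval_mx t X *m eval_mx t Y.
Proof. exact: map_mxM. Qed.

Lemma polyC_mxZ m n c (X : 'M[R]_(m, n)) : polyC_mx (c *: X) = c%:P *: polyC_mx X.
Proof. exact: map_mxZ. Qed.

Lemma polyC_mxM m n p (X : 'M[R]_(m, n)) (Y : 'M[R]_(n, p)) :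
  polyC_mx (X *m Y) = polyC_mx X *m polyC_mx Y.
Proof. exact: map_mxM. Qed.

Lemma is_derive_eval_mx m n (X : 'M[{poly R}]_(m, n)) (t : R) :
  is_derive t (1 : R) (fun t => eval_mx t X) (eval_mx t (deriv_mx X)).
Proof.
have d : derivable (fun t => eval_mx t X) t 1.
  apply/derivable_mxP => i j; rewrite (_ : (fun _ => _) = horner (X i j)).
    exact: derivable_horner.
  by apply/funext => y; rewrite mxE.
apply: DeriveDef => //; rewrite derive_mx //; apply/matrixP => i j; rewrite !mxE.
rewrite (_ : (fun _ => _) = horner (X i j)); last by apply/funext => y; rewrite mxE.
by rewrite derive_val.
Qed.

Lemma continuous_eval_mx m n (X : 'M[{poly R}]_(m, n)) :
  continuous (fun t => eval_mx t X).
Proof.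
move=> t; apply: differentiable_continuous; apply/derivable1_diffP.
by have [] := is_derive_eval_mx X t.
Qed.

Variables (n m : nat) (A : 'M[R]_n) (B : 'M[R]_(n, m)).

(** The Taylor polynomial of exp (A (t - a)) x0 solves x' = A x up to high
    order at a; it is built one term at a time. *)
Lemma taylor_arc (a : R) (x0 : 'cV[R]_n) k : exists E w,
  [/\ eval_mx a E = x0 & deriv_mx E = polyC_mx A *m E + ('X - a%:P) ^+ k *: polyC_mx w].
Proof.
elim: k => [|k [E [w [Ea dE]]]].
  exists (polyC_mx x0), (- (A *m x0)); rewrite eval_polyC_mx deriv_polyC_mx expr0 scale1r; split => //.
  by rewrite /polyC_mx map_mxN map_mxM subrr.
(* Integrating the error term once cancels it and multiplies the remainder
   by A / (k + 1). *)
exists (E - ('X - a%:P) ^+ k.+1 *: polyC_mx (k.+1%:R^-1 *: w)), (k.+1%:R^-1 *: (A *m w)).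
split.
  by rewrite eval_mxD eval_mxN eval_mxZ Ea horner_exp hornerXsubC subrr expr0n scale0r subr0.
rewrite deriv_mxD dE deriv_mxN deriv_mxZ deriv_polyC_mx scaler0 addr0 mulmxBr -!addrA; congr (_ + _).
rewrite deriv_exp derivXsubC mul1r /= !polyC_mxZ polyC_mxM -!scalemxAr addNr.
apply/eqP; rewrite subr_eq0; apply/eqP.
rewrite scalerA -mulr_natr -mulrA -polyC_natr -polyCM divff ?mulr1 ?pnatr_eq0 //.
Qed.

Let D : {poly R} := 'X * ('X - 1%:P).

(** A forcing term A^k B c can be absorbed by the input: subtracting
    A^(k-1) B c from the state trades it for A^(k-1) B c', one power lower.
    Each step costs one derivative, whence the power of D that c must contain for
    the correction to vanish at both ends. *)
Lemma krylov_correction k (c : 'cV[{poly R}]_m) : exists d u,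
  deriv_mx (D *: d) = polyC_mx A *m (D *: d) + polyC_mx (A ^+ k *m B) *m (D ^+ k.+1 *: c) + polyC_mx B *m u.
Proof.
elim: k c => [|k IH] c.
  exists 0, (- (D *: c)); rewrite scaler0 mulmx0 add0r expr1 expr0 mul1mx mulmxN subrr.
  by apply/matrixP => i j; rewrite !mxE deriv0.
have [d [u E]] := IH ((deriv D *+ k.+2) *: c + D *: deriv_mx c).
(* The subtracted term is - A^k B (D^(k+2) c); its derivative leaves the new
   forcing term A^k B (D^(k+2) c)', divisible by D^(k+1). *)
exists (d - D ^+ k.+1 *: (polyC_mx (A ^+ k *m B) *m c)), u.
have Edc : D *: (D ^+ k.+1 *: (polyC_mx (A ^+ k *m B) *m c)) =
   polyC_mx (A ^+ k *m B) *m (D ^+ k.+2 *: c) by rewrite scalerA -exprS scalemxAr.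
rewrite scalerBr Edc deriv_mxD E deriv_mxN deriv_mx_mulC deriv_mxZ deriv_exp /=.
rewrite mulmxBr -!addrA; congr (_ + _).
rewrite mulmxA -polyC_mxM mulmxA mulmxE -exprS.
rewrite [RHS]addKr addrCA -mulmxBr -[RHS]addr0; congr (_ + _).
rewrite scalerDr !scalerA -exprSr.
by rewrite mulrnAr mulrC subrr mulmx0.
Qed.

(** An invertible Gramian writes any forcing term as a combination of
    terms A^k B c with k < n. *)
Lemma gram_correction (e : 'cV[{poly R}]_n) : \det (gram A B) != 0 -> exists d u,
  deriv_mx (D *: d) = polyC_mx A *m (D *: d) + D ^+ n *: e + polyC_mx B *m u.
Proof.
move=> dG; have uG : gram A B \in unitmx by rewrite unitmxE unitfE.
pose c (k : 'I_n) := D ^+ (n - k.+1) *: (polyC_mx ((A ^+ k *m B)^T *m invmx (gram A B)) *m e).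
have /choice[d /choice[u E]] : forall k : 'I_n, exists d u, _ := fun k => krylov_correction k (c k).
exists (\sum_k d k), (\sum_k u k).
rewrite scaler_sumr deriv_mx_sum (eq_bigr _ (fun k _ => E k)) !big_split /=.
rewrite -!mulmx_sumr; congr (_ + _ + _).
rewrite -[e in RHS]mul1mx -[1%:M](map_mx1 polyC) -(mulmxV uG) -/(polyC_mx _).
rewrite [X in polyC_mx (X *m _)]/gram mulmx_suml /polyC_mx raddf_sum /= mulmx_suml scaler_sumr.
apply: eq_bigr => k _; rewrite /c scalerA -exprD subnKC // -scalemxAr.
by rewrite mulmxA -map_mxM !mulmxA.
Qed.

(** A polynomial switch, flat to order n at both ends, obtained from a
    Bezout relation between powers of X and X - 1. *)
Lemma hermite_step : exists h q, [/\ h.[0] = 0, h.[1] = 1,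
  deriv h = D ^+ n * q, exists r, h * ('X - 1%:P) ^+ n = D ^+ n * r &
  exists r, (1 - h) * 'X ^+ n = D ^+ n * r].
Proof.
have cop k l : coprimep (('X : {poly R}) ^+ k) (('X - 1%:P) ^+ l).
  apply/coprimep_expl/coprimep_expr; rewrite coprimep_XsubC.
  by rewrite rootE hornerX oner_eq0.
have /Bezout_eq1_coprimepP[[a b] /= E] := cop n.+1 n.+1.
pose h := a * 'X ^+ n.+1.
have h1 : 1 - h = b * ('X - 1%:P) ^+ n.+1 by rewrite -E addrC addKr.
have h1' : h = 1 - b * ('X - 1%:P) ^+ n.+1 by rewrite -h1 subKr.
have : D ^+ n %| deriv h.
  rewrite exprMn Gauss_dvdp ?cop //; apply/andP; split.
    rewrite /h derivM derivXn dvdp_add ?dvdp_mull ?exprS ?dvdp_mull //.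
    by rewrite -mulr_natr mulrC dvdp_mull.
  rewrite h1' derivB derivC sub0r dvdpNr derivM deriv_exp derivXsubC mul1r.
  rewrite dvdp_add ?dvdp_mull ?exprS ?dvdp_mull //.
  by rewrite -mulr_natr mulrC dvdp_mull.
case/dvdpP => q Eq; exists h, q; split.
- by rewrite /h hornerM hornerXn expr0n mulr0.
- by rewrite h1' !hornerE subrr expr0n mulr0 subr0.
- by rewrite Eq mulrC.
- by exists (a * 'X); rewrite /h exprMn exprS; ring.
- by exists (b * ('X - 1%:P)); rewrite h1 exprMn exprS; ring.
Qed.

(** The trajectory follows the free motion from x0 near time 0 and the free
    motion into x1 near time 1; the switch between them leaves an error divisible
    by D^n, which the input can correct without touching the end points. *)
Lemma gram_controllable : \det (gram A B) != 0 -> controllable A B.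
Proof.
move=> dG x0 x1.
have [h [q [h0 h1 dh [r Er] [r' Er']]]] := hermite_step.
have [E0 [w0 [E00 dE0]]] := taylor_arc 0 x0 n.
have [E1 [w1 [E11 dE1]]] := taylor_arc 1 x1 n.
(* The error of the blend xi is h' (E1 - E0) plus the errors of the two arcs,
   each multiplied by the switch that vanishes at the other end. *)
pose xi := (1 - h) *: E0 + h *: E1.
have [d [u Ed]] := gram_correction (- (q *: (E1 - E0) + r *: polyC_mx w1 + r' *: polyC_mx w0)) dG.
have dxi : deriv_mx xi = polyC_mx A *m xi + D ^+ n *: (q *: (E1 - E0) + r *: polyC_mx w1 + r' *: polyC_mx w0).
  rewrite deriv_mxD !deriv_mxZ derivB derivC sub0r dE0 dE1 dh subr0.
  rewrite !scalerDr !scalerA -Er -Er' mulmxDr -!scalemxAr.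
  move: (polyC_mx A *m E0) (polyC_mx A *m E1) (polyC_mx w0) (polyC_mx w1) => a0 a1 v0 v1.
  by apply/matrixP => i j; rewrite !mxE; ring.
have D0 : D.[0] = 0 by rewrite /D hornerM hornerX mul0r.
have D1 : D.[1] = 0 by rewrite /D hornerM hornerXsubC subrr mulr0.
exists 1, (fun t => eval_mx t u), (fun t => eval_mx t (xi + D *: d)); split => //.
- exact: continuous_eval_mx.
- move=> t; have := is_derive_eval_mx (xi + D *: d) t; rewrite deriv_mxD dxi Ed.
  rewrite (_ : polyC_mx A *m xi + _ + _ = polyC_mx A *m (xi + D *: d) + polyC_mx B *m u).
    by rewrite eval_mxD !eval_mxM !eval_polyC_mx.
  rewrite [polyC_mx A *m (xi + _)]mulmxDr scalerN; move: (polyC_mx A *m xi) (polyC_mx A *m (D *: d)) (polyC_mx B *m u).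
  move: (D ^+ n *: _) => a0 a1 a2 a3.
  by rewrite addrA -(addrA a1) (addrC a0) subrK.
- by rewrite eval_mxD eval_mxZ D0 scale0r addr0 eval_mxD !eval_mxZ h0 hornerD hornerN h0 hornerC subr0 scale1r scale0r addr0.
- by rewrite eval_mxD eval_mxZ D1 scale0r addr0 eval_mxD !eval_mxZ h1 hornerD hornerN h1 hornerC subrr scale1r scale0r add0r.
Qed.
End Steering.

(** * Obstructions to controllability *)

Lemma gronwall_zero (R : realType) (e de : R -> R) (c T : R) : 0 < T ->
  (forall t, is_derive t (1 : R) e (de t)) -> (forall t, de t <= c * e t) ->
  (forall t, 0 <= e t) -> e 0 = 0 -> e T = 0.
Proof.
move=> T0 he hle e_ge0 e0.
(* The integrating factor makes g non-increasing. *)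
pose g := e * (expR \o ( *%R (- c))).
pose dg t := (de t - c * e t) * expR (- c * t).
have dg_ t : is_derive t (1 : R) g (dg t).
  have h1 : is_derive t (1 : R) ( *%R (- c)) (- c).
    have -> : *%R (- c) = (- c) \*: (@id R) by apply/funext => y.
    by apply: is_derive_eq; rewrite /GRing.scale /= mulr1.
  apply: is_derive_eq; rewrite /dg /GRing.scale /=; ring.
have [|xi _] := MVT T0 (fun t _ => dg_ t).
  apply: continuous_subspaceT => t; apply: differentiable_continuous.
  by apply/derivable1_diffP; have [] := dg_ t.
rewrite /g /= !fctE /= e0 mul0r !subr0 => E.
have : e T * expR (- c * T) <= 0.
  by rewrite E pmulr_lle0 // /dg pmulr_lle0 ?expR_gt0 // subr_le0.
rewrite pmulr_lle0 ?expR_gt0 // => h.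
by apply/eqP; rewrite eq_le h e_ge0.
Qed.

Lemma linear_ode_zero (R : realType) k (A : 'M[R]_k) (y : R -> 'cV[R]_k) (T : R) :
  0 < T -> (forall t, is_derive t (1 : R) y (A *m y t)) -> y 0 = 0 -> y T = 0.
Proof.
move=> T0 dy y0.
have dyi i t : is_derive t (1 : R) (fun t => y t i 0) ((A *m y t) i 0).
  have [d v] := dy t; apply: DeriveDef; first by move/derivable_mxP : d.
  by rewrite -v derive_mx // mxE.
pose e t := \sum_i (y t i 0) ^+ 2.
pose de t := \sum_i 2 * (y t i 0 * (A *m y t) i 0).
have he t : is_derive t (1 : R) e (de t).
  have -> : e = \sum_(i < k) (fun t => y t i 0) ^+ 2.
    by apply/funext => s; rewrite fct_sumE.
  apply: is_derive_sum => i; apply: is_derive_eq.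
  by rewrite /GRing.scale /= expr1 mulrA.
(* Each product of two coordinates is at most the squared norm e. *)
pose c := \sum_i \sum_j 2 * `|A i j|.
have e_ge0 t : 0 <= e t by apply: sumr_ge0 => i _; rewrite sqr_ge0.
have yle t i : (y t i 0) ^+ 2 <= e t.
  by rewrite /e (bigD1 i) //= lerDl sumr_ge0 // => j _; rewrite sqr_ge0.
have hle t : de t <= c * e t.
  rewrite /de /c mulr_suml; apply: ler_sum => i _.
  rewrite mxE mulr_suml mulr_sumr mulr_sumr; apply: ler_sum => j _.
  apply: le_trans (ler_norm _) _; rewrite !normrM ger0_norm ?ler0n //.
  have := yle t i; have := yle t j; rewrite -!(real_normK (num_real (y t _ 0))).
  move: (normr_ge0 (y t i 0)) (normr_ge0 (y t j 0)) (normr_ge0 (A i j)).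
  move: `|y t i 0| `|y t j 0| `|A i j| (e t) => a b d E a0 b0 d0 h1 h2.
  have : a * b <= E by nra.
  move=> h; have := ler_wpM2l d0 h; lra.
have e0 : e 0 = 0 by rewrite /e big1 // => i _; rewrite y0 mxE expr0n.
have eT := gronwall_zero T0 he hle e_ge0 e0.
apply/colP => i; rewrite mxE; apply/eqP; rewrite -sqrf_eq0 eq_le sqr_ge0 andbT.
by rewrite -eT.
Qed.

(** The functional V x obeys an autonomous linear equation, so it stays
    zero once it starts at zero, whatever the input does. *)
Lemma controllable_no_invariant (R : realType) n m k (A : 'M[R]_n)
    (B : 'M[R]_(n, m)) (V : 'M[R]_(k, n)) (A' : 'M[R]_k) :
  controllable A B -> V *m A = A' *m V -> V *m B = 0 -> V = 0.
Proof.
move=> ctr VA VB; suff h (x1 : 'cV[R]_n) : V *m x1 = 0.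
  by apply/matrixP => i j; have := h (delta_mx j 0); rewrite -colE => /colP/(_ i); rewrite !mxE.
have [T [u [x [T0 _ dx x0 <-]]]] := ctr 0 x1.
apply: (@linear_ode_zero _ _ A' (fun t => V *m x t) T) => // [t|]; last first.
  by rewrite x0 mulmx0.
have [d v] := dx t.
have dj i j : is_derive t (1 : R) (V i j \*: (fun t => x t j 0)) (V i j * (A *m x t + B *m u t) j 0).
  apply: is_deriveZ; apply: DeriveDef; first by move/derivable_mxP : d.
  by rewrite -v derive_mx // mxE.
have E i : (fun t => (V *m x t) i 0) = \sum_(j < n) (V i j \*: (fun t => x t j 0)).
  by apply/funext => s; rewrite fct_sumE mxE.
have di i : is_derive t (1 : R) (fun t => (V *m x t) i 0) ((A' *m (V *m x t)) i 0).
  rewrite E mulmxA -VA -mulmxA -[V *m _]addr0 -(mul0mx _ (u t)) -VB -mulmxA -mulmxDr mxE.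
  exact: is_derive_sum.
have dd : derivable (fun t => V *m x t) t 1.
  by apply/derivable_mxP => i j; rewrite ord1; have [] := di i.
apply: DeriveDef => //; rewrite derive_mx //.
by apply/colP => i; rewrite mxE; have [_ ->] := di i.
Qed.

Definition no_mx n : 'M[bool]_n := const_mx false.

Definition input_reachable n (Ab Bb : 'M[bool]_n) : Prop :=
  forall i, exists j, connect (sys_digraph Ab Bb (no_mx n)) (inputV j) (stateV i).

(** The states that no input reaches evolve on their own. *)
Lemma controllable_reachable (R : realType) n (Ab Bb : 'M[bool]_n)
   (A B : 'M[R]_n) : same_zeros Ab A -> same_zeros Bb B -> controllable A B ->
  input_reachable Ab Bb.
Proof.
move=> hA hB ctr i0.
set g := sys_digraph Ab Bb _.
pose Z i := ~~ [exists j, connect g (inputV j) (stateV i)].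
pose P := diag_mx (\row_i ((Z i)%:R : R)).
have PE k (X : 'M[R]_(n, k)) i j : (P *m X) i j = (Z i)%:R * X i j.
  by rewrite mul_diag_mx !mxE.
have EP k (X : 'M[R]_(k, n)) i j : (X *m P) i j = X i j * (Z j)%:R.
  by rewrite mul_mx_diag !mxE.
have stepA i j : Z i -> A i j != 0 -> Z j.
  rewrite hA => zi Aij; apply: contra zi => /existsP[u uj]; apply/existsP; exists u.
  by apply: connect_trans uj (connect1 _).
have stepB i j : Z i -> B i j = 0.
  move=> zi; apply/eqP/negPn; rewrite hB; apply: contra zi => Bij.
  by apply/existsP; exists j; apply: connect1.
have P0 : P = 0.
  (* Only unreachable states influence unreachable states: P A = P A P. *)
  apply: (controllable_no_invariant ctr (A' := P *m A)).
    apply/matrixP => i j; rewrite EP !PE.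
    case: (boolP (Z i)) => zi; last by rewrite !mul0r.
    rewrite !mul1r; have [->|Aij] := eqVneq (A i j) 0; first by rewrite mul0r.
    by rewrite (stepA _ _ zi Aij) mulr1.
  apply/matrixP => i j; rewrite PE mxE.
  by case: (boolP (Z i)) => zi; rewrite ?mul0r // mul1r stepB.
have /eqP : P i0 i0 = 0 by rewrite P0 mxE.
rewrite !mxE eqxx mulr1n; case: (boolP (Z i0)); first by rewrite oner_eq0.
by move=> /negPn/existsP.
Qed.

Lemma controllable_row_free (R : realType) n m (A : 'M[R]_n) (B : 'M[R]_(n, m)) :
  controllable A B -> row_free (row_mx A B).
Proof.
move=> ctr; rewrite -kermx_eq0; apply/eqP/row_matrixP => i; rewrite row0.
have /sub_kermxP := row_sub i (kermx (row_mx A B)).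
rewrite mul_mx_row => /eqP; rewrite row_mx_eq0 => /andP[/eqP vA /eqP vB].
by apply: (controllable_no_invariant ctr (A' := 0)); rewrite ?vA ?mul0mx.
Qed.

Lemma det_neq0_perm (F : comNzRingType) n (M : 'M[F]_n) : \det M != 0 ->
  exists s : 'S_n, forall i, M i (s i) != 0.
Proof.
move=> d0; apply/not_existsP => h; case/eqP: d0; rewrite /determinant big1 // => s _.
have /existsNP[i /negP/negPn/eqP Mi] := h s.
by rewrite (bigD1 i) //= Mi mul0r mulr0.
Qed.

Lemma row_free_injection (F : fieldType) n p (M : 'M[F]_(n, p)) : row_free M ->
  exists2 f : 'I_n -> 'I_p, injective f & forall i, M i (f i) != 0.
Proof.
move=> rf; have rk : row_full M^T by rewrite /row_full mxrank_tr.
have := fullrowsub_unit rk.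
rewrite unitmxE unitfE => /det_neq0_perm[s hs].
exists (fun i => fullrankfun rk (s^-1%g i)) => [i j|i].
  by move/fullrankfun_inj/perm_inj.
by have := hs (s^-1%g i); rewrite !mxE permKV.
Qed.

(** * Structural controllability of a pair of patterns *)

Lemma horner_det_gram (R : realType) n m (A : 'M[{poly R}]_n) (B : 'M[{poly R}]_(n, m)) t :
  (\det (gram A B)).[t] = \det (gram (eval_mx t A) (eval_mx t B)).
Proof. by rewrite -[LHS]/(horner_eval t _) -det_map_mx map_gram. Qed.

(** Replacing each allowed entry a by a + t, almost every t keeps the Gram
    determinant non-zero and makes all allowed entries non-zero. *)
Lemma generic_pattern (R : realType) n m (Ab : 'M[bool]_n) (Bb : 'M[bool]_(n, m))
    (A : 'M[R]_n) (B : 'M[R]_(n, m)) :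
  pattern Ab A -> pattern Bb B -> \det (gram A B) != 0 ->
  struct_controllable R Ab Bb.
Proof.
move=> pA pB dG.
pose line k l (Mb : 'M[bool]_(k, l)) (M : 'M[R]_(k, l)) : 'M[{poly R}]_(k, l) :=
  \matrix_(i, j) (if Mb i j then 'X + (M i j)%:P else 0).
have line0 k l (Mb : 'M[bool]_(k, l)) (M : 'M[R]_(k, l)) :
    pattern Mb M -> eval_mx 0 (line k l Mb M) = M.
  move=> pM; apply/matrixP => i j; rewrite !mxE /horner_eval.
  by case: ifP => [_|/negbT/pM ->]; rewrite !hornerE.
pose nz k l (Mb : 'M[bool]_(k, l)) (M : 'M[R]_(k, l)) : {poly R} :=
  \prod_(e : 'I_k * 'I_l | Mb e.1 e.2) ('X + (M e.1 e.2)%:P).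
have nz0 k l Mb M : nz k l Mb M != 0.
  by apply/prodf_neq0 => e _; rewrite -size_poly_eq0 size_XaddC.
pose p := \det (gram (line _ _ Ab A) (line _ _ Bb B)) * (nz _ _ Ab A * nz _ _ Bb B).
have p0 : p != 0.
  rewrite !mulf_neq0 //; apply: contraNneq dG => d0.
  by rewrite -(line0 _ _ _ _ pA) -(line0 _ _ _ _ pB) -horner_det_gram d0 horner0.
have [t] := exists_nonroot p0.
rewrite !hornerM !mulf_eq0 !negb_or horner_det_gram => /and3P[dt At Bt].
have zeros k l Mb M : (nz k l Mb M).[t] != 0 -> same_zeros Mb (eval_mx t (line k l Mb M)).
  rewrite /nz horner_prod => /prodf_neq0 h i j; rewrite !mxE /horner_eval.
  by case: ifP => Mij; [apply: (h (i, j)) | rewrite horner0 eqxx].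
exists (eval_mx t (line _ _ Ab A)), (eval_mx t (line _ _ Bb B)); split; [exact: zeros..|].
exact: gram_controllable.
Qed.

Lemma extend_perm (V : finType) (D : {set V}) (h : V -> V) :
  {in D &, injective h} -> exists s : {perm V}, {in D, s =1 h}.
Proof.
move=> hinj; pose D' := [set h x | x in D]%SET.
have cD : #|~: D| = #|~: D'|%SET.
  by apply/eqP; rewrite -(eqn_add2l #|D|) cardsC -{1}(card_in_imset hinj) cardsC.
(* Off D, match the complements of the domain and of the image
   by rank in their enumerations. *)
pose k v := nth v (enum (~: D')%SET) (index v (enum (~: D)%SET)).
pose s v := if v \in D then h v else k v.
have szk v : v \notin D -> (index v (enum (~: D)%SET) < size (enum (~: D')%SET))%N.
  by move=> vD; rewrite -cardE -cD cardE index_mem mem_enum inE.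
have kD' v : v \notin D -> k v \in (~: D')%SET.
  by move=> vD; rewrite -mem_enum mem_nth // szk.
have sinj : injective s.
  move=> v w; rewrite /s; case: (boolP (v \in D)) => vD; case: (boolP (w \in D)) => wD.
  - exact: hinj.
  - by move=> E; have := kD' _ wD; rewrite -E inE imset_f.
  - by move=> E; have := kD' _ vD; rewrite E inE imset_f.
  - move=> /eqP; rewrite /k (set_nth_default v w) ?szk //.
    rewrite nth_uniq ?enum_uniq ?szk // => /eqP E.
    have vE : v \in enum (~: D)%SET by rewrite mem_enum inE.
    by rewrite -(nth_index v vE) E nth_index // mem_enum inE.
by exists (perm sinj) => v vD; rewrite permE /s vD.
Qed.

Lemma hom_connect (V W : finType) (e : rel V) (e' : rel W) (h : V -> W) :
  (forall a b, e a b -> e' (h a) (h b)) ->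
  forall a b, connect e a b -> connect e' (h a) (h b).
Proof.
move=> H a b /connectP[p]; elim: p a => [|c p IH] a /=; first by move=> _ ->; exact: connect0.
by case/andP => /H ac /IH cb /cb; apply: connect_trans; apply: connect1.
Qed.

(** The map f sends each state to the tail, a state (inl) or an input (inr),
    of the edge that enters it in the matching. *)
Definition state_matched n (Ab Bb : 'M[bool]_n) : Prop :=
  exists2 f : 'I_n -> 'I_n + 'I_n, injective f &
    forall i, match f i with inl j => Ab i j | inr j => Bb i j end.

Lemma struct_controllable_necessary (R : realType) n (Ab Bb : 'M[bool]_n) :
  struct_controllable R Ab Bb -> input_reachable Ab Bb /\ state_matched Ab Bb.
Proof.
case=> A [B [hA hB ctr]]; split; first exact: controllable_reachable hA hB ctr.
have [f finj hf] := row_free_injection (controllable_row_free ctr).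
exists (fun i => fintype.split (f i)) => [i j E|i].
  by apply: finj; rewrite -[LHS]fintype.splitK E fintype.splitK.
by have := hf i; rewrite mxE; case: (fintype.split (f i)) => j; rewrite ?hA ?hB.
Qed.

(** The inputs are added as extra states with arbitrary feedback into them.
    The matching then extends to a permutation, that is, to a cycle cover, and an
    uncontrollable mode of the pair would be one of the extended system. *)
Lemma struct_controllable_sufficient (R : realType) n (Ab Bb : 'M[bool]_n) :
  input_reachable Ab Bb -> state_matched Ab Bb -> struct_controllable R Ab Bb.
Proof.
move=> hr [f finj hf].
pose V : finType := ('I_n + 'I_n)%type.
(* Every edge into an input is allowed, which is arbitrary feedback. *)
pose g : rel V := fun v w => match w, v with
  | inl i, inl j => Ab i j | inl i, inr j => Bb i j | inr _, _ => true end.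
pose D : {set V} := [set inl i | i in 'I_n]%SET.
pose h (v : V) : V := if v is inl i then f i else v.
have hinj : {in D &, injective h}.
  by move=> _ _ /imsetP[i _ ->] /imsetP[j _ ->] /= /finj ->.
(* The inverse is taken because f goes from heads to tails. *)
have [t ht] := extend_perm hinj.
pose s := (t^-1)%g.
have gs v : g v (s v).
  rewrite /s; have : t (t^-1 v)%g = v by rewrite permKV.
  case: (t^-1 v)%g => [i|//]; rewrite ht ?imset_f //= => <-.
  by have := hf i; case: (f i).
have s_edge v : g v (s v) || (s v == v) && ~~ xpredT v by rewrite gs.
have s_state v : g v (s v) -> exists2 w, w \in porbit s v & xpredT w.
  by exists v; rewrite ?porbit_id.
pose U0 : pred V := fun v => if v is inr _ then true else false.
pose W : V -> V -> R := weight g s U0 R xpredT.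
have Wg v w : W v w != 0 -> g v w by exact: weight_supp.
pose A : 'M[R]_n := \matrix_(i, j) W (inl j) (inl i).
pose B : 'M[R]_n := \matrix_(i, j) W (inr j) (inl i).
have pA : pattern Ab A.
  by move=> i j; rewrite mxE; apply: contraNeq => /Wg.
have pB : pattern Bb B.
  by move=> i j; rewrite mxE; apply: contraNeq => /Wg.
apply: (generic_pattern pA pB); apply: pbh_gram => l v vA vB.
pose x (w : V) : R[i] := if w is inl i then v 0 i else 0.
have x0 u : U0 u -> x u = 0 by case: u.
have xe w : (if xpredT w then l else 1) * x w = \sum_w' real_complex R (W w w') * x w'.
  rewrite /= big_sumType /= [X in _ = _ + X]big1 ?addr0; last by move=> i _; rewrite mulr0.
  case: w => j /=.
    have /matrixP/(_ 0 j) := vA; rewrite !mxE => <-.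
    rewrite (eq_bigr (fun i => real_complex R (W (inl j) (inl i)) * v 0 i)) //.
    by move=> i _; rewrite !mxE mulrC.
  have /matrixP/(_ 0 j) := vB; rewrite !mxE mulr0 => E; symmetry; apply: etrans E.
  rewrite [RHS](eq_bigr (fun i => real_complex R (W (inr j) (inl i)) * v 0 i)) //.
  by move=> i _; rewrite !mxE mulrC.
apply/rowP => i; rewrite mxE -[LHS]/(x (inl i)).
apply: (weights_controllable s_edge s_state xe x0).
have [j ji] := hr i; apply/existsP; exists (inr j) => /=.
pose k (a : vertex n) : V := if a is inl b then b else inr j.
by apply: (hom_connect (h := k) _ ji) => -[[a|a]|a] [[b|b]|b] //=; rewrite mxE.
Qed.

(** * Weighted closed-loop digraphs *)

Section Shape.
Variable n : nat.

Definition is_state (v : vertex n) := if v is inl (inl _) then true else false.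

(** The edges that a closed-loop digraph may contain, whatever the
    patterns. *)
Definition typed_edge : rel (vertex n) := fun v w => match v, w with
  | inl (inl _), inl (inl _) | inl (inl _), inr _
  | inr _, inl (inr _) | inl (inr _), inl (inl _) => true
  | _, _ => false end.

(** Transposing the system reverses the edges and swaps inputs with outputs. *)
Definition dualV (v : vertex n) : vertex n := match v with
  | inl (inl i) => stateV i | inl (inr i) => outputV i | inr i => inputV i end.

Lemma dualVK : involutive dualV.
Proof. by case=> [[i|i]|i]. Qed.

Section Blocks.
Variable S : nzRingType.
Variable W : vertex n -> vertex n -> S.
Definition state_block : 'M[S]_n := \matrix_(i, j) W (stateV j) (stateV i).
Definition input_block : 'M[S]_n := \matrix_(i, j) W (inputV j) (stateV i).
Definition feedback_block : 'M[S]_n := \matrix_(i, j) W (outputV j) (inputV i).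
Definition output_block : 'M[S]_n := \matrix_(i, j) W (stateV j) (outputV i).
Definition closed_loop : 'M[S]_n := state_block + input_block *m feedback_block *m output_block.
End Blocks.

Definition selector (S : nzRingType) (U : pred 'I_n) : 'M[S]_n :=
  diag_mx (\row_i (U i)%:R).

Lemma vertex_sum (S : nmodType) (F : vertex n -> S) :
  \sum_w F w = \sum_i F (stateV i) + \sum_i F (inputV i) + \sum_i F (outputV i).
Proof. by rewrite big_sumType /= big_sumType. Qed.

Lemma map_closed_loop (S T : nzRingType) (f : {rmorphism S -> T})
    (W : vertex n -> vertex n -> S) :
  map_mx f (closed_loop W) = closed_loop (fun v w => f (W v w)).
Proof.
rewrite /closed_loop map_mxD !map_mxM.
by congr (_ + _); [|congr (_ *m _); first congr (_ *m _)];
  apply/matrixP => i j; rewrite !mxE.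
Qed.

Lemma closed_loop_dual (S : comNzRingType) (W : vertex n -> vertex n -> S) :
  closed_loop (fun v w => W (dualV w) (dualV v)) = (closed_loop W)^T.
Proof.
rewrite /closed_loop linearD /= !trmx_mul mulmxA.
by congr (_ + _); [|congr (_ *m _); first congr (_ *m _)];
  apply/matrixP => i j; rewrite !mxE.
Qed.

Variable R : realType.

(** A left eigenvector of A + B K C extends to inputs by v B and to outputs
    by v B K; the extension satisfies the eigenvector equation on the weighted
    digraph, with factor l at states and 1 elsewhere. *)
Lemma closed_loop_pbh (W : vertex n -> vertex n -> R) (U0 : pred (vertex n)) :
  (forall v w, W v w != 0 -> typed_edge v w) ->
  (forall (l : R[i]) (x : vertex n -> R[i]),
    (forall v, (if is_state v then l else 1) * x v =
       \sum_w real_complex R (W v w) * x w) ->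
    (forall u, U0 u -> x u = 0) -> forall i, x (stateV i) = 0) ->
  (forall u, U0 u -> exists i, u = inputV i) ->
  pbh (map_mx (real_complex R) (closed_loop W))
      (map_mx (real_complex R) (input_block W *m selector R (fun i => U0 (inputV i)))).
Proof.
move=> Wt ctr Uin l v.
have W0 a b : ~~ typed_edge a b -> W a b = 0.
  by move=> h; apply/eqP; apply: contraNT h => /Wt.
rewrite map_mxD !map_mxM mulmxDr !mulmxA.
set f := real_complex R; set vB := v *m _ (input_block W); set vBK := vB *m _ (feedback_block W).
move=> vA vU.
pose x (a : vertex n) : R[i] := match a with
  | inl (inl i) => v 0 i | inl (inr i) => vB 0 i | inr i => vBK 0 i end.
apply/rowP => i; rewrite mxE -[LHS]/(x (stateV i)); apply: (ctr l).
  move=> a; rewrite vertex_sum.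
  case: a => [[j|j]|j] /=.
  - rewrite [X in _ + X + _]big1 ?addr0; last by move=> k _; rewrite W0 // rmorph0 mul0r.
    have /matrixP/(_ 0 j) := vA; rewrite mxE [in RHS]mxE => <-.
    rewrite !mxE; congr (_ + _).
      rewrite (eq_bigr (fun i => f (W (stateV j) (stateV i)) * v 0 i)) //.
      by move=> k _; rewrite !mxE mulrC.
    rewrite (eq_bigr (fun i => f (W (stateV j) (outputV i)) * vBK 0 i)) //.
    by move=> k _; rewrite !mxE mulrC.
  - rewrite [X in _ + X + _]big1 ?addr0; last by move=> k _; rewrite W0 // rmorph0 mul0r.
    rewrite [X in _ + X]big1 ?addr0; last by move=> k _; rewrite W0 // rmorph0 mul0r.
    rewrite mul1r [LHS]mxE (eq_bigr (fun i => f (W (inputV j) (stateV i)) * v 0 i)) //.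
    by move=> k _; rewrite !mxE mulrC.
  - rewrite [X in X + _ + _]big1 ?add0r; last by move=> k _; rewrite W0 // rmorph0 mul0r.
    rewrite [X in _ + X]big1 ?addr0; last by move=> k _; rewrite W0 // rmorph0 mul0r.
    rewrite mul1r [LHS]mxE (eq_bigr (fun i => f (W (outputV j) (inputV i)) * vB 0 i)) //.
    by move=> k _; rewrite !mxE mulrC.
move=> u u0; have [j ju] := Uin _ u0; have /matrixP/(_ 0 j) := vU.
rewrite /selector map_diag_mx mul_mx_diag !mxE -ju u0 rmorph1 mulr1 ju /=.
by rewrite !mxE.
Qed.

End Shape.

(** * Moving the eigenvalues of a closed loop by one gain per component *)

Section Scc.
Variables (n : nat) (g : rel (vertex n)).
Local Notation scc := (same_scc g).

Lemma scc_refl v : scc v v. Proof. by rewrite /same_scc connect0. Qed.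
Lemma scc_sym v w : scc v w = scc w v. Proof. by rewrite /same_scc andbC. Qed.
Lemma scc_trans v w u : scc v w -> scc w u -> scc v u.
Proof.
case/andP => vw wv /andP[wu uw].
by rewrite /same_scc (connect_trans vw wu) (connect_trans uw wv).
Qed.
Lemma scc_eql v w : scc v w -> scc v =1 scc w.
Proof.
move=> vw u; apply/idP/idP; last exact: scc_trans.
by apply: scc_trans; rewrite scc_sym.
Qed.

Definition scc_edge : rel (vertex n) := fun v w => g v w && scc v w.

Lemma scc_connect v w : scc v w -> connect scc_edge v w.
Proof.
case/andP => /connectP[p]; elim: p v => [|a p IH] v /=; first by move=> _ -> _; exact: connect0.
case/andP => va pp lw wv.
have aw : connect g a w by apply/connectP; exists p.
apply: (connect_trans (connect1 _)) (IH _ pp lw _).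
  by rewrite /scc_edge va /same_scc connect1 // (connect_trans aw wv).
exact: connect_trans wv (connect1 va).
Qed.
End Scc.

Lemma sum_neq0 (V : nmodType) (I : finType) (F : I -> V) :
  \sum_i F i != 0 -> exists i, F i != 0.
Proof.
move=> h; apply/existsP; apply: contraNT h => /existsPn h.
by rewrite big1 // => i _; apply/eqP/negPn; exact: h.
Qed.

(** A non-zero entry of a product comes from a path of two non-zero entries. *)
Lemma mulmx_neq0 (F : nzRingType) m n p (X : 'M[F]_(m, n)) (Y : 'M[F]_(n, p)) i j :
  (X *m Y) i j != 0 -> exists k, X i k != 0 /\ Y k j != 0.
Proof.
rewrite mxE => /sum_neq0[k Xk]; exists k.
by split; apply: contraNneq Xk => ->; rewrite ?mulr0 ?mul0r.
Qed.

Lemma mul_selector (F : comNzRingType) n (U : pred 'I_n) k (X : 'M[F]_(k, n)) i j :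
  (X *m selector F U) i j = X i j * (U j)%:R.
Proof. by rewrite mul_mx_diag !mxE. Qed.

Lemma selector_mul (F : comNzRingType) n (U : pred 'I_n) k (X : 'M[F]_(n, k)) i j :
  (selector F U *m X) i j = (U i)%:R * X i j.
Proof. by rewrite mul_diag_mx !mxE. Qed.

(** A block diagonal matrix commutes with the projection on a union of
    blocks. *)
Lemma selector_comm (F : comNzRingType) n (U : pred 'I_n) (X : 'M[F]_n) :
  (forall i j, X i j != 0 -> U i = U j) ->
  selector F U *m X = X *m selector F U.
Proof.
move=> h; apply/matrixP => i j; rewrite mul_selector selector_mul.
by have [->|/h ->] := eqVneq (X i j) 0; rewrite ?mulr0 ?mul0r // mulrC.
Qed.

Lemma selector_idem (F : comNzRingType) n (U : pred 'I_n) :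
  selector F U *m selector F U = selector F U.
Proof.
apply/matrixP => i j; rewrite mul_selector !mxE.
by case: eqP => [->|_]; rewrite ?mulr1n ?mulr0n ?mul0r //; case: (U j); rewrite ?mulr1 ?mulr0.
Qed.

(** Within one diagonal block, being a left or a right eigenvalue is the
    same. *)
Lemma block_right_eigenvector (F : fieldType) n (U : pred 'I_n) (M : 'M[F]_n) (l : F)
    (v : 'rV[F]_n) :
  selector F U *m M = M *m selector F U ->
  v != 0 -> v *m selector F U = v -> v *m M = l *: v ->
  exists2 z : 'cV[F]_n, z != 0 & selector F U *m z = z /\ M *m z = l *: z.
Proof.
set P := selector F U => PM v0 vP vM.
have PP : P *m P = P by exact: selector_idem.
(* H agrees with M - l on the block and with the identity elsewhere. *)
pose H := P *m (M - l%:M) + (1%:M - P).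
have PN : P *m (M - l%:M) = (M - l%:M) *m P.
  by rewrite mulmxBr mulmxBl PM mul_scalar_mx mul_mx_scalar.
have vH : v *m H = 0.
  rewrite /H mulmxDr mulmxA vP mulmxBr vM mul_mx_scalar subrr add0r.
  by rewrite mulmxBr mulmx1 vP subrr.
have dH : \det H = 0.
  apply/eqP; apply: contraNT v0 => dH.
  have uH : H \in unitmx by rewrite unitmxE unitfE.
  by rewrite -[v](mulmxK uH) vH mul0mx.
have /eqP/det0P[u u0 uH] : \det H^T = 0 by rewrite det_tr.
have Hz : H *m u^T = 0 by rewrite -[H]trmxK -trmx_mul uH trmx0.
have Pz : P *m u^T = u^T.
  have : (1%:M - P) *m H *m u^T = 0 by rewrite -mulmxA Hz mulmx0.
  rewrite /H mulmxDr mulmxA mulmxBl mul1mx PP subrr mul0mx add0r.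
  rewrite mulmxBl mul1mx mulmxBr mulmx1 PP subrr subr0 mulmxBl mul1mx => /eqP.
  by rewrite subr_eq0 => /eqP <-.
exists u^T; first by rewrite -trmx0 (inj_eq trmx_inj).
split => //; move: Hz; rewrite /H mulmxDl mulmxBl mul1mx Pz subrr addr0.
by rewrite PN -mulmxA Pz mulmxBl mul_scalar_mx => /eqP; rewrite subr_eq0 => /eqP.
Qed.

Section Sufficiency.
Variables (R : realType) (n : nat) (Ab Bb Kb Cb : 'M[bool]_n).
Let g := closed_digraph Ab Bb Kb Cb.
Local Notation scc := (same_scc g).
Local Notation f := (real_complex R).
Local Notation F := (R[i] : fieldType).

Lemma closed_typed v w : g v w -> typed_edge v w.
Proof. by case: v => [[i|i]|i]; case: w => [[j|j]|j]. Qed.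

(** One feedback edge chosen in the component of v; it depends on the
    component only. *)
Definition fb_pick (v : vertex n) : option ('I_n * 'I_n) :=
  [pick e | [&& Kb e.1 e.2, scc v (inputV e.1) & scc v (outputV e.2)]].

Lemma fb_pick_scc v w : scc v w -> fb_pick v = fb_pick w.
Proof.
by move=> vw; apply: eq_pick => e; rewrite !(scc_eql vw).
Qed.

Lemma fb_pickP v e : fb_pick v = Some e ->
  [/\ Kb e.1 e.2, scc v (inputV e.1) & scc v (outputV e.2)].
Proof. by rewrite /fb_pick; case: pickP => // e' /and3P[? ? ?] [<-]. Qed.

Definition picked_in : pred 'I_n := fun i =>
  [exists k, omap fst (fb_pick (stateV k)) == Some i].
Definition picked_out : pred 'I_n := fun j =>
  [exists k, omap snd (fb_pick (stateV k)) == Some j].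

Hypothesis fb : states_in_fb_scc Ab Bb Kb Cb.

Lemma fb_pick_some k : exists e, fb_pick (stateV k) = Some e.
Proof.
have [i [j /= [Kij kj ki]]] := fb k; rewrite /fb_pick; case: pickP => [e _|/(_ (i, j))].
  by exists e.
by rewrite /= Kij kj ki.
Qed.

Section Selection.
Variable W : vertex n -> vertex n -> R.
Hypothesis Wg : forall v w, W v w != 0 -> scc_edge g v w.
Let A := state_block W.  Let B := input_block W.  Let K := feedback_block W.  Let C := output_block W.
Hypothesis ctr : pbh (map_mx f (closed_loop W)) (map_mx f (B *m selector R picked_in)).
Hypothesis obs : pbh (map_mx f (closed_loop W))^T (map_mx f (C^T *m selector R picked_out)).

Variable l : R[i].
Let M : 'M[F]_n := map_mx f (closed_loop W).

(** The number l is an eigenvalue of the diagonal block of the component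
    of k. *)
Definition resonant (k : 'I_n) : Prop := exists2 z : 'cV[F]_n, z != 0 &
  selector F (fun i => scc (stateV k) (stateV i)) *m z = z /\ M *m z = l *: z.

(** Unit change of gain on the chosen edge of exactly those components
    that resonate at l. *)
Definition resonance_shift : 'M[R]_n := \matrix_(i, j)
  ([exists k, (fb_pick (stateV k) == Some (i, j)) && `[< resonant k >]] : nat)%:R.

Let blk (r c : 'I_n -> vertex n) (X : 'M[F]_n) :=
  forall i j, X i j != 0 -> scc (c j) (r i).

Let blkM r s c X Y : blk r s X -> blk s c Y -> blk r c (X *m Y).
Proof.
move=> hX hY i j /mulmx_neq0[k [/hX sr /hY cs]]; exact: scc_trans cs sr.
Qed.

Let blkD r c X Y : blk r c X -> blk r c Y -> blk r c (X + Y).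
Proof.
move=> hX hY i j; rewrite mxE; have [->|/hX //] := eqVneq (X i j) 0.
by rewrite add0r => /hY.
Qed.

Let blkW r c (X : 'M[R]_n) : (forall i j, X i j = W (c j) (r i)) ->
  blk r c (map_mx f X).
Proof. by move=> E i j; rewrite mxE fmorph_eq0 E => /Wg/andP[]. Qed.

Let blkA : blk (@stateV n) (@stateV n) (map_mx f A).
Proof. by apply: blkW => i j; rewrite mxE. Qed.
Let blkB : blk (@stateV n) (@inputV n) (map_mx f B).
Proof. by apply: blkW => i j; rewrite mxE. Qed.
Let blkK : blk (@inputV n) (@outputV n) (map_mx f K).
Proof. by apply: blkW => i j; rewrite mxE. Qed.
Let blkC : blk (@outputV n) (@stateV n) (map_mx f C).
Proof. by apply: blkW => i j; rewrite mxE. Qed.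
Let blkS : blk (@inputV n) (@outputV n) (map_mx f resonance_shift).
Proof.
move=> i j; rewrite !mxE fmorph_eq0 pnatr_eq0; case: existsP => // -[k].
case/andP => /eqP/fb_pickP[_ ki kj] _ _; apply: scc_trans ki; by rewrite scc_sym.
Qed.
Let blkMl : blk (@stateV n) (@stateV n) M.
Proof.
rewrite /M /closed_loop map_mxD !map_mxM.
by apply: blkD => //; apply: blkM blkC; apply: blkM blkB blkK.
Qed.

Lemma resonance_shift_pattern : pattern Kb (K + resonance_shift).
Proof.
move=> i j Kij; rewrite !mxE.
have -> : W (outputV j) (inputV i) = 0.
  by apply/eqP; apply: contraNT Kij => /Wg/andP[].
rewrite add0r; case: existsP => // -[k /andP[/eqP/fb_pickP[/= h]]].
by rewrite h in Kij.
Qed.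

Lemma resonant_scc k k' : scc (stateV k) (stateV k') -> resonant k -> resonant k'.
Proof.
move=> kk' [z z0 [Pz Mz]]; exists z => //; split => //; rewrite -[RHS]Pz.
by congr (selector _ _ *m _); apply/funext => i; rewrite (scc_eql kk').
Qed.

(** Take an eigenvector of the shifted loop, restricted to one component.
    If the component does not resonate, nothing was changed there.  If it does,
    pairing with a right eigenvector z of the original block shows that v B
    vanishes at the chosen input, since C z does not vanish at the chosen output
    by observability; then v is an eigenvector of the original loop killed by B,
    against controllability. *)
Lemma resonance_shift_not_eigenvalue : ~ eigenvalue (map_mx f (A + B *m (K + resonance_shift) *m C)) l.
Proof.
case/eigenvalueP => v0 v0E v0n.
have [k vk] : exists k, v0 0 k != 0.
  by apply/existsP; apply: contraNT v0n => /existsPn h; apply/eqP/rowP => i;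
     rewrite mxE; apply/eqP/negPn; exact: h.
pose U : pred 'I_n := fun i => scc (stateV k) (stateV i).
pose P := selector F U.
have blkP X : blk (@stateV n) (@stateV n) X -> P *m X = X *m P.
  move=> bX; apply: selector_comm => i j /bX ji; rewrite /U.
  by rewrite scc_sym -(scc_eql ji) scc_sym.
pose BS := map_mx f B *m map_mx f resonance_shift.
have bBSC : blk (@stateV n) (@stateV n) (BS *m map_mx f C).
  by apply: blkM blkC; apply: blkM blkB blkS.
pose v := v0 *m P.
have vP : v *m P = v by rewrite /v -mulmxA selector_idem.
have vne : v != 0.
  apply: contraNneq vk => v00; have /rowP/(_ k) := v00.
  by rewrite mul_selector /U scc_refl mulr1 mxE => ->.
have E : v *m M + v *m BS *m map_mx f C = l *: v.
  have EM : map_mx f (A + B *m (K + resonance_shift) *m C) = M + BS *m map_mx f C.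
    by rewrite mulmxDr mulmxDl addrA map_mxD [map_mx f (B *m resonance_shift *m C)]map_mxM map_mxM.
  rewrite -mulmxA /v -(mulmxA v0 P M) (blkP _ blkMl) -(mulmxA v0 P (BS *m _)) (blkP _ bBSC).
  by rewrite (mulmxA v0 M) (mulmxA v0 _ P) -mulmxDl -mulmxDr -EM v0E scalemxAl.
(* The component of k contains the single chosen edge from j0 to i0. *)
have [[i0 j0] pk] := fb_pick_some k; have [_ /= ki kj] := fb_pickP pk.
pose d : F := (`[< resonant k >] : nat)%:R.
have vB i : (v *m map_mx f B) 0 i != 0 -> scc (stateV k) (inputV i).
  case/mulmx_neq0 => a [va /blkB Ba].
  have ka : U a by apply: contraNT va => /negbTE Ua; rewrite -vP mul_selector Ua mulr0.
  by apply: scc_trans ka _; rewrite scc_sym.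
have vBS j : (v *m BS) 0 j = (j == j0)%:R * ((v *m map_mx f B) 0 i0 * d).
  rewrite mulmxA mxE (bigD1 i0) //= big1 ?addr0 => [|i ni].
    rewrite !mxE; have [->|nj] := eqVneq j j0; last first.
      rewrite mul0r; case: existsP => [[k' /andP[/eqP pk' _]]|_]; last by rewrite rmorph0 mulr0.
      have [_ /= k'i _] := fb_pickP pk'.
      have := fb_pick_scc (scc_trans ki _); rewrite scc_sym in k'i.
      by move=> /(_ _ k'i); rewrite pk pk' => -[/esym/eqP]; rewrite (negbTE nj).
    rewrite mul1r; congr (_ * _); rewrite /d; case: existsP => [[k' /andP[/eqP pk' /asboolP rk']]|h].
      have [_ /= k'i _] := fb_pickP pk'.
      have kk' : scc (stateV k') (stateV k) by apply: scc_trans k'i _; rewrite scc_sym.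
      by rewrite (asboolT (resonant_scc kk' rk')) rmorph1.
    rewrite asboolF ?rmorph0 // => rk; apply: h; exists k.
    by rewrite pk eqxx; apply/asboolP.
  have [->|/vB ski] := eqVneq ((v *m map_mx f B) 0 i) 0; first by rewrite mul0r.
  rewrite !mxE; case: existsP => [[k' /andP[/eqP pk' _]]|_]; last by rewrite rmorph0 mulr0.
  have [_ /= k'i _] := fb_pickP pk'; rewrite scc_sym in k'i.
  have := fb_pick_scc (scc_trans ski k'i); rewrite pk pk' => -[/esym/eqP].
  by rewrite (negbTE ni).
have vM0 : (v *m map_mx f B) 0 i0 * d = 0 -> v *m M = l *: v.
  move=> h; rewrite -E [v *m BS](_ : _ = 0) ?mul0mx ?addr0 //.
  by apply/rowP => j; rewrite vBS h mulr0 mxE.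
have [/asboolP res|/asboolP nres] := boolP `[< resonant k >]; last first.
  apply: (nres); apply: block_right_eigenvector vne vP (vM0 _); first exact: blkP.
  by rewrite /d asboolF // mulr0n mulr0.
have d1 : d = 1 by rewrite /d asboolT.
have [z z0 [Pz Mz]] := res.
have Cz j : (map_mx f C *m z) j 0 != 0 -> scc (stateV k) (outputV j).
  case/mulmx_neq0 => a [/blkC Ca za].
  have ka : U a by apply: contraNT za => /negbTE Ua; rewrite -Pz selector_mul -/(U a) Ua mul0r.
  exact: scc_trans ka Ca.
have Cz0 : (map_mx f C *m z) j0 0 != 0.
  apply: contraNneq z0 => Cj0; rewrite -trmx_eq0; apply/eqP; apply: (obs (r := l)).
    by rewrite -trmx_mul Mz linearZ.
  rewrite map_mxM -map_trmx mulmxA -trmx_mul.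
  apply/rowP => j; rewrite /selector map_diag_mx mul_mx_diag !mxE.
  case: (boolP (picked_out j)) => [/existsP[k' /eqP pk']|_]; last by rewrite rmorph0 mulr0.
  have [E0|/Cz kj'] := eqVneq ((map_mx f C *m z) j 0) 0.
    by move: E0; rewrite mxE => ->; rewrite mul0r.
  case pk'' : (fb_pick _) pk' => [[i' j']|//] /= [E1]; rewrite {}E1 in pk''.
  have [_ _ /= k'j] := fb_pickP pk''; rewrite scc_sym in k'j.
  have := fb_pick_scc (scc_trans kj' k'j); rewrite pk pk'' => -[_ Ej].
  by move: Cj0; rewrite -Ej mxE => ->; rewrite mul0r.
have vB0 : (v *m map_mx f B) 0 i0 = 0.
  have := congr1 (fun x => x *m z) E; rewrite mulmxDl -scalemxAl -(mulmxA v M) Mz -scalemxAr.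
  move/eqP; rewrite -[X in _ == X]addr0 (inj_eq (addrI _)) => /eqP/matrixP/(_ 0 0).
  rewrite -(mulmxA (v *m BS)) mxE (bigD1 j0) //= big1 ?addr0 => [|j nj]; last first.
    by rewrite vBS (negbTE nj) !mul0r.
  rewrite vBS eqxx mul1r d1 mulr1 [RHS]mxE => /eqP.
  by rewrite mulf_eq0 (negbTE Cz0) orbF => /eqP.
case/eqP: vne; apply: (ctr (r := l)); first by apply: vM0; rewrite vB0 mul0r.
apply/rowP => i; rewrite map_mxM mulmxA /selector map_diag_mx mul_mx_diag !mxE.
case: (boolP (picked_in i)) => [/existsP[k' /eqP pk']|_]; last by rewrite rmorph0 mulr0.
have [E0|/vB ki'] := eqVneq ((v *m map_mx f B) 0 i) 0.
  by move: E0; rewrite mxE => ->; rewrite mul0r.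
case pk'' : (fb_pick _) pk' => [[i' j']|//] /= [E1]; rewrite {}E1 in pk''.
have [_ /= k'i _] := fb_pickP pk''; rewrite scc_sym in k'i.
have := fb_pick_scc (scc_trans ki' k'i); rewrite pk pk'' => -[Ei _].
by move: vB0; rewrite -Ei mxE => ->; rewrite mul0r.
Qed.

End Selection.
End Sufficiency.

(** * Graph conditions that exclude fixed modes *)

(** Inputs and outputs that the cycles avoid appear as fixed points of the
    permutation. *)
Definition cycle_cover n (g : rel (vertex n)) (s : {perm vertex n}) : Prop :=
  forall v, g v (s v) || (s v == v) && ~~ is_state v.

Lemma cover_connect n (g : rel (vertex n)) s v k : cycle_cover g s -> connect g v ((s ^+ k)%g v).
Proof.
move=> hs; elim: k => [|k IH]; first by rewrite expg0 perm1.
rewrite expgSr permM; apply: connect_trans IH _.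
by case/orP: (hs ((s ^+ k)%g v)) => [/connect1 //|/andP[/eqP -> _]]; exact: connect0.
Qed.

Lemma cover_scc n (g : rel (vertex n)) s v : cycle_cover g s -> same_scc g v (s v).
Proof.
move=> hs; apply/andP; split; first by rewrite -[s]expg1; exact: cover_connect.
have : v \in porbit s (s v) by rewrite porbit_sym -{1}[s]expg1 mem_porbit.
by case/porbitP => k {2}->; exact: cover_connect.
Qed.

Lemma cover_inv n (g : rel (vertex n)) (g' : rel (vertex n)) s :
  cycle_cover g s -> (forall v w, g v w -> g' w v) -> cycle_cover g' s^-1.
Proof.
move=> hs gg' v; have := hs ((s^-1)%g v); rewrite permKV => /orP[/gg' ->//|].
by case/andP => /eqP <-; rewrite eqxx => ->; rewrite orbT.
Qed.

(** Edges run from outputs to inputs and from inputs to states, so a cycle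
    cannot avoid the states. *)
Lemma cover_state n (g : rel (vertex n)) s v : (forall v w, g v w -> typed_edge v w) ->
  cycle_cover g s -> g v (s v) -> exists2 w, w \in porbit s v & is_state w.
Proof.
move=> gt hs gv; have ps k : (s ^+ k)%g v \in porbit s v by rewrite mem_porbit.
case: v gv ps => [[i|i]|i] gv ps; first by exists (stateV i); rewrite ?porbit_id.
  exists (s (inputV i)); first by have := ps 1; rewrite expg1.
  by have := gt _ _ gv; rewrite /inputV; case: (s _) => [[]|].
exists (s (s (outputV i))); first by have := ps 2; rewrite expgS expg1 permM.
have := gt _ _ gv; case E : (s (inr i)) => [[j|j]|j] // _.
case/orP: (hs (inputV j)) => [/gt|/andP[/eqP E' _]].
  by rewrite /inputV; case: (s _) => [[]|].
by have := perm_inj (etrans E (esym E')).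
Qed.

Lemma pbh_of_gram (R : realType) n m (A : 'M[R]_n) (B : 'M[R]_(n, m)) :
  \det (gram A B) != 0 -> pbh (map_mx (real_complex R) A) (map_mx (real_complex R) B).
Proof.
by move=> h; apply: gram_pbh; rewrite -map_gram det_map_mx fmorph_eq0.
Qed.

Section NoFixedMode.
Variables (R : realType) (n : nat) (Ab Bb Kb Cb : 'M[bool]_n).
Let g := closed_digraph Ab Bb Kb Cb.
Local Notation gs := (scc_edge g).
Local Notation f := (real_complex R).
Hypothesis fb : states_in_fb_scc Ab Bb Kb Cb.
Variable s : {perm vertex n}.
Hypothesis cov : cycle_cover g s.

Let Uin : pred (vertex n) := fun u =>
  if u is inl (inr i) then picked_in Ab Bb Kb Cb i else false.
Let Yout : pred (vertex n) := fun u =>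
  if u is inr i then picked_out Ab Bb Kb Cb i else false.

Let gsd : rel (vertex n) := fun v w => gs w v.

Let covs : cycle_cover gs s.
Proof.
move=> v; case/orP: (cov v) => [gv|->]; last by rewrite orbT.
by rewrite /scc_edge gv (cover_scc v cov).
Qed.

Let covd : cycle_cover gsd s^-1. Proof. exact: cover_inv covs _. Qed.

Let gs_typed v w : gs v w -> typed_edge v w.
Proof. by case/andP => /closed_typed. Qed.

Let W1 := weight gs s Uin R (@is_state n).
Let W2 := weight gsd s^-1 Yout R (@is_state n).

Let W1g v w : W1 v w != 0 -> gs v w. Proof. exact: weight_supp. Qed.
Let W2g v w : W2 v w != 0 -> gs w v. Proof. exact: weight_supp. Qed.

(** The weights are grown from the chosen inputs along edges inside
    components. *)
Lemma forward_pbh :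
  pbh (map_mx f (closed_loop W1)) (map_mx f (input_block W1 *m selector R (picked_in Ab Bb Kb Cb))).
Proof.
apply: (@closed_loop_pbh n R W1 Uin) => [v w /W1g/gs_typed //|l x xe x0 i|u]; last first.
  by case: u => [[i|i]|i] // _; exists i.
have h1 v : gs v (s v) -> exists2 w, w \in porbit s v & is_state w.
  exact: cover_state gs_typed covs.
apply: (weights_controllable covs h1 xe x0).
have [[a b] e] := fb_pick_some fb i; have [_ /= ia _] := fb_pickP e.
apply/existsP; exists (inputV a); apply/andP; split.
  by apply/existsP; exists i; rewrite e.
by apply: scc_connect; rewrite scc_sym.
Qed.

(** The same on reversed edges, grown from the chosen outputs, gives
    observability. *)
Lemma backward_pbh : pbh (map_mx f (closed_loop (fun v w => W2 w v)))^T
   (map_mx f ((output_block (fun v w => W2 w v))^T *m selector R (picked_out Ab Bb Kb Cb))).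
Proof.
pose W v w := W2 (dualV v) (dualV w).
have EW : closed_loop W = (closed_loop (fun v w => W2 w v))^T.
  exact: (@closed_loop_dual n R (fun v w => W2 w v)).
have EB : input_block W = (output_block (fun v w => W2 w v))^T by apply/matrixP => i j; rewrite !mxE.
rewrite map_trmx -EW -EB.
apply: (@closed_loop_pbh n R W (Yout \o @dualV n)) => [v w|l x xe x0 i|u]; last first.
- by case: u => [[i|i]|i] // _; exists i.
- pose x' v := x (dualV v).
  have xe' v : (if is_state v then l else 1) * x' v = \sum_w f (W2 v w) * x' w.
    have := xe (dualV v); rewrite (_ : is_state (dualV v) = is_state v); last by case: v => [[]|].
    rewrite /x' => ->; rewrite (reindex_inj (can_inj (@dualVK n))) /=.
    by apply: eq_bigr => w _; rewrite /W !dualVK.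
  have x0' u : Yout u -> x' u = 0 by move=> yu; apply: x0; rewrite /= dualVK.
  rewrite -[LHS]/(x' (stateV i)).
  have gsdt v w : gsd v w -> typed_edge w v by exact: gs_typed.
  have h1 v : gsd v (s^-1 v)%g -> exists2 w, w \in porbit s^-1 v & is_state w.
    move=> gv; have [|w] := cover_state gs_typed covs (v := (s^-1 v)%g).
      by rewrite permKV.
    move=> wv sw; exists w => //; rewrite porbitV.
    by rewrite -[in X in _ \in X](permKV s v) -[s]expg1 porbit_perm expg1.
  apply: (weights_controllable covd h1 xe' x0').
  have [[a b] e] := fb_pick_some fb i; have [_ _ /= ib] := fb_pickP e.
  apply/existsP; exists (outputV b); apply/andP; split.
    by apply/existsP; exists i; rewrite e.
  by rewrite /gsd connect_rev; apply: scc_connect.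
- by rewrite /W => /W2g/gs_typed; case: v => [[]|]; case: w => [[]|].
Qed.

(** On the segment between the two weightings both Gram determinants are
    non-zero polynomials, so some real weighting is controllable and observable
    through the chosen ports.  Edges between components carry no weight, hence the
    loop is block diagonal and its eigenvalues can be moved block by block. *)
Lemma no_SFM_sufficient : ~ has_SFM R Ab Bb Kb Cb.
Proof.
pose ui := selector R (picked_in Ab Bb Kb Cb).
pose yi := selector R (picked_out Ab Bb Kb Cb).
(* The forward weighting at 0, the backward one, transposed, at 1. *)
pose Wp v w : {poly R} := (W1 v w)%:P + 'X * (W2 w v - W1 v w)%:P.
pose LW : 'M[{poly R}]_n := closed_loop Wp.
pose BW : 'M[{poly R}]_n := input_block Wp.
pose CW : 'M[{poly R}]_n := output_block Wp.
have evL t : eval_mx t LW = closed_loop (fun v w => (Wp v w).[t]).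
  exact: map_closed_loop (horner_eval t) _.
have evB t : eval_mx t BW = input_block (fun v w => (Wp v w).[t]) by apply/matrixP => i j; rewrite !mxE.
have evC t : eval_mx t CW = output_block (fun v w => (Wp v w).[t]) by apply/matrixP => i j; rewrite !mxE.
clearbody LW BW CW.
have Wp0 : (fun v w => (Wp v w).[0]) = W1.
  by apply/funext => v; apply/funext => w; rewrite /Wp hornerD hornerM !hornerC hornerX mul0r addr0.
have Wp1 : (fun v w => (Wp v w).[1]) = (fun v w => W2 w v).
  by apply/funext => v; apply/funext => w; rewrite /Wp hornerD hornerM !hornerC hornerX mul1r addrC subrK.
pose p1 := \det (gram LW (BW *m polyC_mx ui)).
pose p2 := \det (gram LW^T (CW^T *m polyC_mx yi)).
have p1t t : p1.[t] = \det (gram (closed_loop (fun v w => (Wp v w).[t]))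
      (input_block (fun v w => (Wp v w).[t]) *m ui)).
  by rewrite /p1 horner_det_gram eval_mxM eval_polyC_mx evL evB.
have p2t t : p2.[t] = \det (gram (closed_loop (fun v w => (Wp v w).[t]))^T
      ((output_block (fun v w => (Wp v w).[t]))^T *m yi)).
  by rewrite /p2 horner_det_gram eval_mxM eval_polyC_mx -evL -evC /eval_mx !map_trmx.
have p1n : p1.[0] != 0 by rewrite p1t Wp0; apply: pbh_gram; exact: forward_pbh.
have p2n : p2.[1] != 0.
  by rewrite p2t Wp1; apply: pbh_gram; rewrite -map_trmx; exact: backward_pbh.
have [|t] := @exists_nonroot _ (p1 * p2).
  by rewrite mulf_neq0 //; [apply: contraNneq p1n|apply: contraNneq p2n] => ->; rewrite horner0.
rewrite hornerM mulf_eq0 negb_or p1t p2t => /andP[d1 d2].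
pose W v w := (Wp v w).[t].
have Wg v w : W v w != 0 -> gs v w.
  apply: contraNT => h; rewrite /W /Wp.
  have -> : W1 v w = 0 by apply/eqP; apply: contraNT h => /W1g.
  have -> : W2 w v = 0 by apply/eqP; apply: contraNT h => /W2g.
  by rewrite subrr mulr0 addr0 horner0.
move=> /(_ (state_block W) (input_block W) (output_block W)) [|||z hz].
- by move=> i j; rewrite mxE; apply: contraNeq => /Wg/andP[/orP[]].
- by move=> i j; rewrite mxE; apply: contraNeq => /Wg/andP[/orP[]].
- by move=> i j; rewrite mxE; apply: contraNeq => /Wg/andP[/orP[]].
have obs := pbh_of_gram d2; rewrite -map_trmx in obs.
apply: (resonance_shift_not_eigenvalue fb Wg (pbh_of_gram d1) obs (l := z)).
by apply: (hz (_ + _)); exact: resonance_shift_pattern Wg z.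
Qed.

End NoFixedMode.

(** * Necessity of the graph conditions *)

Section Necessity.
Variables (R : realType) (n : nat) (Ab Bb Kb Cb : 'M[bool]_n).
Local Notation g := (closed_digraph Ab Bb Kb Cb).
Local Notation f := (real_complex R).

Lemma no_SFM_witness : ~ has_SFM R Ab Bb Kb Cb -> exists A B C : 'M[R]_n,
  [/\ pattern Ab A, pattern Bb B, pattern Cb C &
   forall l, exists2 K, pattern Kb K & ~ eigenvalue (map_mx f (A + B *m K *m C)) l].
Proof.
move=> h; apply/not_existsP => nh; apply: h => A B C pA pB pC.
apply/not_existsP => h; apply: (nh A); exists B, C; split => // l.
apply: contrapT => nK; apply: (h l) => K pK; apply: contrapT => nl.
by apply: nK; exists K.
Qed.

(** Feedback does not move an uncontrollable mode, so the pair taken from a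
    system without fixed modes passes the Hautus test. *)
Lemma no_SFM_struct_controllable :
  ~ has_SFM R Ab Bb Kb Cb -> struct_controllable R Ab Bb.
Proof.
case/no_SFM_witness => A [B [C [pA pB pC h]]].
apply: (generic_pattern pA pB); apply: pbh_gram => l v vA vB.
apply/eqP/negPn/negP => v0; have [K _ []] := h l.
apply/eigenvalueP; exists v => //.
by rewrite map_mxD !map_mxM mulmxDr vA !mulmxA vB !mul0mx addr0.
Qed.

Definition vertex_of_index (i : 'I_(n + n + n)) : vertex n :=
  match fintype.split i with inl a => inl (fintype.split a) | inr a => inr a end.
Definition index_of_vertex (v : vertex n) : 'I_(n + n + n) :=
  match v with inl a => lshift n (unsplit a) | inr a => rshift (n + n) a end.

Lemma vertex_of_indexK : cancel vertex_of_index index_of_vertex.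
Proof.
move=> i; rewrite /vertex_of_index /index_of_vertex -[RHS]fintype.splitK.
by case: (fintype.split i) => a //=; rewrite fintype.splitK.
Qed.

Lemma index_of_vertexK : cancel index_of_vertex vertex_of_index.
Proof.
rewrite /vertex_of_index /index_of_vertex; case=> a.
  by rewrite -[lshift n _]/(unsplit (inl _)) !unsplitK.
by rewrite -[rshift _ _]/(unsplit (inr _)) !unsplitK.
Qed.

(** If 0 is not fixed, some A + B K C is invertible.  It is a Schur
    complement of a matrix indexed by all vertices, whose determinant is non-zero;
    a non-zero term of the Leibniz formula is a permutation along edges. *)
Lemma no_SFM_cover : ~ has_SFM R Ab Bb Kb Cb -> exists s, cycle_cover g s.
Proof.
case/no_SFM_witness => A [B [C [pA pB pC h]]]; have [K pK n0] := h 0.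
(* The system x' = A x + B u, u = K y, y = C x before elimination of u and y. *)
pose N : 'M[R]_(n + n + n) :=
  block_mx (block_mx A B 0 (- 1%:M)) (col_mx 0 K) (row_mx C 0) (- 1%:M).
have dN : \det N != 0.
  apply/negP => /det0P[v v0 vN]; apply: n0; apply/eigenvalueP.
  pose w := lsubmx v; pose c := rsubmx v; pose a := lsubmx w; pose b := rsubmx w.
  have Ev : v = row_mx (row_mx a b) c by rewrite !hsubmxK.
  move: vN; rewrite Ev mul_row_block mul_row_block mul_mx_row mul_row_col.
  rewrite !mulmx0 !mulmxN !mulmx1 add_row_mx !addr0 add0r.
  rewrite -[0 in X in X -> _]row_mx0 => /eq_row_mx[].
  rewrite -[X in _ = X -> _]row_mx0 => /eq_row_mx[Ea Eb] Ec.
  have {}Eb : b = a *m B by apply/eqP; rewrite eq_sym -subr_eq0 Eb.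
  have {}Ec : c = b *m K by apply/eqP; rewrite eq_sym -subr_eq0 Ec.
  have aM : a *m (A + B *m K *m C) = 0 by rewrite mulmxDr !mulmxA -Eb -Ec.
  exists (map_mx f a); first by rewrite -map_mxM aM map_mx0 scale0r.
  rewrite map_mx_eq0; apply: contraNneq v0 => a0.
  by rewrite Ev Ec Eb a0 !mul0mx !row_mx0.
have [s hs] := det_neq0_perm dN.
pose t i := vertex_of_index (s (index_of_vertex i)).
have tinj : injective t.
  by apply: inj_comp (can_inj vertex_of_indexK) (inj_comp (@perm_inj _ s) (can_inj index_of_vertexK)).
have ht v : g (t v) v || (t v == v) && ~~ is_state v.
  have := hs (index_of_vertex v); rewrite -[s _]vertex_of_indexK -/(t v).
  case: v => [[i|i]|i]; case: (t _) => [[j|j]|j]; rewrite /index_of_vertex /N /=.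
  all: rewrite ?(block_mxEul, block_mxEur, block_mxEdl, block_mxEdr, col_mxEu, col_mxEd, row_mxEl, row_mxEr) ?mxE ?eqxx //.
  - by move=> Aij; rewrite /closed_digraph /= ?andbF ?orbF; apply: contraNT Aij => /pA ->.
  - by move=> Bij0; rewrite /closed_digraph /= ?andbF ?orbF; apply: contraNT Bij0 => /pB ->.
  - by rewrite /closed_digraph /=; case: (i =P j) => [->|_]; rewrite ?eqxx ?oppr0 ?eqxx.
  - by move=> Kij; rewrite /closed_digraph /= ?andbF ?orbF; apply: contraNT Kij => /pK ->.
  - by move=> Cij; rewrite /closed_digraph /= ?andbF ?orbF; apply: contraNT Cij => /pC ->.
  - by rewrite /closed_digraph /=; case: (i =P j) => [->|_]; rewrite ?eqxx ?oppr0 ?eqxx.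
exists (perm tinj)^-1%g => v.
have := ht ((perm tinj)^-1 v)%g.
have -> : t ((perm tinj)^-1 v)%g = v by rewrite -[t _](permE tinj) permKV.
by case/orP => [->//|/andP[/eqP <-]]; rewrite eqxx => ->; rewrite orbT.
Qed.

(** T gathers what lies strictly upstream of the block U.  Were M - l
    invertible, it would map the row vectors supported on T onto themselves; it
    sends w into this space, so w would already be supported on T. *)
Lemma block_left_eigenvalue (F : fieldType) (U T : pred 'I_n) (M : 'M[F]_n) (l : F)
    (w : 'rV[F]_n) :
  (forall i, U i -> ~~ T i) ->
  (forall i j, M i j != 0 -> T i -> T j) ->
  (forall i j, M i j != 0 -> U i -> U j || T j) ->
  w != 0 -> w *m selector F U = w -> w *m M *m selector F U = l *: w ->
  eigenvalue M l.
Proof.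
move=> UT TT UU w0 wU wM; apply: contrapT => /negP nl.
pose N := M - l%:M.
have uN : row_free N.
  rewrite row_free_unit unitmxE unitfE; apply: contraNneq nl => dN.
  have /eqP/det0P[v v0 vN] := dN; apply/eigenvalueP; exists v => //.
  by apply/eqP; rewrite -subr_eq0 -mul_mx_scalar -mulmxBr vN.
pose P := selector F T.
have PM : P *m M = P *m M *m P.
  apply/matrixP => i j; rewrite mul_selector selector_mul.
  have [->|Mij] := eqVneq (M i j) 0; first by rewrite mulr0 mul0r.
  case Ti : (T i); last by rewrite !mul0r.
  by rewrite (TT _ _ Mij Ti) mulr1.
have PN : P *m N = P *m N *m P.
  by rewrite /N mulmxBr mulmxBl -PM mul_mx_scalar -scalemxAl selector_idem.
have wN : w *m N = w *m N *m P.
  rewrite /N mulmxBr mul_mx_scalar mulmxBl -scalemxAl.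
  have -> : w *m P = 0.
    apply/rowP => j; rewrite -wU mul_selector mul_selector mxE.
    by case Uj : (U j); rewrite ?mulr0 ?mul0r // (negbTE (UT _ Uj)) mulr0.
  rewrite scaler0 subr0; apply/rowP => j; rewrite mul_selector.
  have wj : (w *m M *m selector F U) 0 j = l * w 0 j by rewrite wM mxE.
  rewrite mul_selector in wj.
  have wj' : w 0 j = w 0 j * (U j)%:R by rewrite -mul_selector wU.
  have -> : (w *m M - l *: w) 0 j = (w *m M) 0 j - l * w 0 j by rewrite !mxE.
  rewrite -wj.
  case Uj : (U j) in wj' *.
    by rewrite mulr1 subrr (negbTE (UT _ Uj)) mulr0.
  rewrite mulr0 subr0; case Tj : (T j); first by rewrite mulr1.
  rewrite mulr0; apply/eqP/negPn/negP => /mulmx_neq0[i [wi Mij]].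
  have Ui : U i by apply: contraNT wi => /negbTE Ui; rewrite -wU mul_selector Ui mulr0.
  by have := UU _ _ Mij Ui; rewrite Uj Tj.
have sub : (P <= P *m N)%MS.
  have le : (P *m N <= P)%MS by rewrite PN submxMl.
  by rewrite -(geq_leqif (mxrank_leqif_sup le)) mxrankMfree.
have [y Ey] : exists y, w *m N = y *m (P *m N).
  by apply/submxP; apply: submx_trans sub; rewrite wN submxMl.
have wP : w = y *m P by apply: (row_free_inj uN); rewrite Ey mulmxA.
case/eqP: w0; rewrite -wU wP; apply/rowP => j; rewrite mul_selector mul_selector mxE.
by case Uj : (U j); rewrite ?mulr0 // (negbTE (UT _ Uj)) mulr0 mul0r.
Qed.

(** A non-zero entry of A + B K C is an edge between states or a passage
    through a feedback edge. *)
Lemma closed_loop_edge A B K C : pattern Ab A -> pattern Bb B -> pattern Kb K ->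
  pattern Cb C -> forall i j, (A + B *m K *m C : 'M[R]_n) i j != 0 ->
  A i j != 0 /\ g (stateV j) (stateV i) \/
  exists a b, [/\ Kb a b, connect g (stateV j) (outputV b) & connect g (inputV a) (stateV i)].
Proof.
move=> pA pB pK pC i j; rewrite mxE.
have [->|Aij] := eqVneq (A i j) 0; last first.
  move=> _; left; split => //; rewrite /closed_digraph /= orbF.
  by apply: contraNT Aij => /pA ->.
rewrite add0r => /mulmx_neq0[b [/mulmx_neq0[a [Bia Kab]] Cbj]]; right; exists a, b.
split; first by apply: contraNT Kab => /pK ->.
  apply: connect1; rewrite /closed_digraph /= orbF.
  by apply: contraNT Cbj => /pC ->.
apply: connect1; rewrite /closed_digraph /= orbF.
by apply: contraNT Bia => /pB ->.
Qed.

(** On a component without feedback edges the diagonal block of A + B K C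
    is that of A, for every K, and its eigenvalues are fixed. *)
Lemma no_SFM_fb_scc : ~ has_SFM R Ab Bb Kb Cb -> states_in_fb_scc Ab Bb Kb Cb.
Proof.
case/no_SFM_witness => A [B [C [pA pB pC h]]] k.
apply: contrapT => nk.
have nofb a b : Kb a b -> connect g (stateV k) (outputV b) ->
    connect g (inputV a) (stateV k) -> False.
  move=> Kab kb ak; apply: nk; exists a, b => /=.
  have ba : connect g (outputV b) (inputV a).
    by apply: connect1; rewrite /closed_digraph /= Kab.
  split => //; rewrite /same_scc ?kb ?ak ?andbT /=; [exact: connect_trans ba ak|exact: connect_trans kb ba].
(* U is the component of k and T the states strictly upstream of it. *)
pose U : pred 'I_n := fun i => same_scc g (stateV k) (stateV i).
pose T : pred 'I_n := fun i => connect g (stateV i) (stateV k) && ~~ U i.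
pose P := selector R[i] U.
have PP : P *m P = P by exact: selector_idem.
pose Q (_ : nat) (w : 'rV[R[i]]_n) := w *m P = w.
have hQ s w r : Q s.+1 w -> Q s (w *m (map_mx f A *m P) - r *: w).
  by rewrite /Q => hw; rewrite mulmxBl -scalemxAl hw -!mulmxA PP.
pose v : 'rV[R[i]]_n := delta_mx 0 k.
have v0 : v != 0.
  apply/eqP => /rowP/(_ k); rewrite !mxE !eqxx => /eqP; by rewrite oner_eq0.
have Qv : Q n v.
  apply/rowP => j; rewrite mul_selector !mxE /=; case: (j =P k) => [->|_]; last by rewrite mul0r.
  by rewrite /U scc_refl mulr1.
have [w [r [s [w0 wP wA]]]] := stable_eigenvector hQ v0 Qv.
have [K pK []] := h r; apply: (@block_left_eigenvalue _ U T _ _ w) => //.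
- by move=> i Ui; rewrite /T Ui andbF.
- move=> i j; rewrite mxE fmorph_eq0 => Mij /andP[ik nUi].
  have ji : connect g (stateV j) (stateV i).
    have [[_ /connect1 //]|[a [b [Kab jb ai]]]] := closed_loop_edge pA pB pK pC Mij.
    apply: connect_trans jb (connect_trans (connect1 _) ai).
    by rewrite /closed_digraph /= Kab.
  rewrite /T (connect_trans ji ik) /=; apply: contra nUi => /andP[kj _].
  by rewrite /U /same_scc ik (connect_trans kj ji).
- move=> i j; rewrite mxE fmorph_eq0 => Mij /andP[ki ik].
  have ji : connect g (stateV j) (stateV i).
    have [[_ /connect1 //]|[a [b [Kab jb ai]]]] := closed_loop_edge pA pB pK pC Mij.
    apply: connect_trans jb (connect_trans (connect1 _) ai).
    by rewrite /closed_digraph /= Kab.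
  by rewrite /T (connect_trans ji ik) andTb orbN.
- rewrite -wA mulmxA; apply/rowP => j; rewrite !mul_selector.
  case Uj : (U j); last by rewrite !mulr0.
  congr (_ * _); rewrite [LHS]mxE [RHS]mxE; apply: eq_bigr => i _.
  have [->|wi] := eqVneq (w 0 i) 0; first by rewrite !mul0r.
  have Ui : U i by apply: contraNT wi => /negbTE Ui; rewrite -wP mul_selector Ui mulr0.
  congr (_ * _); rewrite [LHS]mxE [RHS]mxE; congr (f _).
  rewrite [LHS]mxE -[RHS]addr0; congr (_ + _).
  apply/eqP/negPn/negP => /mulmx_neq0[b [/mulmx_neq0[a [Bia Kab]] Cbj]].
  have kb : Kb a b by apply: contraNT Kab => /pK ->.
  case/andP: Ui => ki ik; case/andP: Uj => kj jk.
  apply: (nofb _ _ kb).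
    apply: connect_trans kj (connect1 _); rewrite /closed_digraph /= orbF.
    by apply: contraNT Cbj => /pC ->.
  apply: connect_trans (connect1 _) ik; rewrite /closed_digraph /= orbF.
  by apply: contraNT Bia => /pB ->.
Qed.

End Necessity.

Lemma char_poly_trmx (F : comNzRingType) n (A : 'M[F]_n) : char_poly A^T = char_poly A.
Proof.
rewrite /char_poly -[RHS]det_tr; congr (\det _).
by rewrite /char_poly_mx linearB /= tr_scalar_mx map_trmx.
Qed.

Lemma has_SFM_tr (R : realType) n (Ab Bb Kb Cb : 'M[bool]_n) :
  has_SFM R Ab Bb Kb Cb -> has_SFM R Ab^T Cb^T Kb^T Bb^T.
Proof.
have tr (Mb : 'M[bool]_n) (M : 'M[R]_n) : pattern Mb^T M -> pattern Mb M^T.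
  by move=> h i j Mij; rewrite mxE; apply: h; rewrite mxE.
move=> h A B C /tr pA /tr pB /tr pC; have [l hl] := h _ _ _ pA pC pB.
exists l => K /tr pK; have := hl _ pK.
rewrite /spectrum /= !eigenvalue_root_char.
rewrite -[char_poly (map_mx _ (A + _))]char_poly_trmx map_trmx.
by rewrite linearD /= !trmx_mul !mulmxA.
Qed.

Local Close Scope ring_scope.
Local Open Scope nat_scope.

(** * Matchings and the term rank *)

Section Matching.
Variable T : finType.
Implicit Types M N : {set T * T}.

Definition matching M := {in M &, injective fst} /\ {in M &, injective snd}.
Definition sources M : {set T} := [set e.1 | e in M]%SET.
Definition targets M : {set T} := [set e.2 | e in M]%SET.

(** The argument of Cantor, Schroeder and Bernstein: X collects the sources
    that alternating paths reach from sources of M2 not covered by M1; edges of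
    M2 are used on X and edges of M1 elsewhere. *)
Lemma mendelsohn_dulmage M1 M2 : matching M1 -> matching M2 ->
  exists M, [/\ matching M, M \subset M1 :|: M2, targets M1 \subset targets M
               & sources M2 \subset sources M].
Proof.
case=> f1 s1 [f2 s2].
pose r l l' := [exists w, ((l, w) \in M2) && ((l', w) \in M1)].
have [X XE] : exists X : {set T}, forall l, (l \in X) =
    [exists l0, [&& l0 \in sources M2, l0 \notin sources M1 & connect r l0 l]].
  exists [set l | [exists l0, [&& l0 \in sources M2, l0 \notin sources M1 & connect r l0 l]]]%SET.
  by move=> l; rewrite inE.
pose M := ([set e in M2 | e.1 \in X] :|: [set e in M1 | e.1 \notin X])%SET.
have Xr l l' : l \in X -> r l l' -> l' \in X.
  rewrite !XE => /existsP[l0 /and3P[a b c]] ll'; apply/existsP; exists l0.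
  by rewrite a b (connect_trans c) ?connect1.
exists M; split.
- split=> -[a b] [c d]; rewrite !inE /=; case/orP => /andP[h1 h2]; case/orP => /andP[h3 h4] E.
  + exact: f2 h1 h3 E.
  + by rewrite E (negbTE h4) in h2.
  + by rewrite -E (negbTE h2) in h4.
  + exact: f1 h1 h3 E.
  + exact: s2 h1 h3 E.
  + case/negP: h4; apply: Xr h2 _; apply/existsP; exists b; by rewrite h1 E h3.
  + case/negP: h2; apply: Xr h4 _; apply/existsP; exists b; by rewrite h1 E h3.
  + exact: s1 h1 h3 E.
- by apply/fintype.subsetP => e; rewrite !inE => /orP[]/andP[-> _]; rewrite ?orbT.
- apply/fintype.subsetP => _ /imsetP[[a b] e1 ->] /=.
  have [aX|aX] := boolP (a \in X); last first.
    by apply/imsetP; exists (a, b) => //; rewrite !inE e1 aX orbT.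
  have := aX; rewrite XE => /existsP[l0 /and3P[l02 l01 /connectP[p]]].
  case/lastP: p => [|p c] /=.
    by move=> _ E; case/negP: l01; rewrite -E; apply/imsetP; exists (a, b).
  rewrite rcons_path last_rcons => /andP[pp rc] E; rewrite -{}E in rc.
  case/existsP: (rc) => w /andP[lw2 aw1].
  have wb : w = b by have /(_ erefl)[] := f1 _ _ aw1 e1.
  apply/imsetP; exists (last l0 p, w); rewrite ?wb // !inE -wb lw2 /= XE.
  apply/orP; left; apply/existsP; exists l0; rewrite l02 l01 /=.
  by apply/connectP; exists p.
- apply/fintype.subsetP => _ /imsetP[[a b] e2 ->] /=.
  have [aX|aX] := boolP (a \in X).
    by apply/imsetP; exists (a, b) => //; rewrite !inE e2 aX.
  have : a \in sources M1.
    apply: contraNT aX => a1; rewrite XE; apply/existsP; exists a.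
    by rewrite a1 connect0 !andbT; apply/imsetP; exists (a, b).
  case/imsetP => -[a' c] e1 /= E; rewrite -{}E in e1.
  by apply/imsetP; exists (a, c) => //; rewrite !inE e1 aX orbT.
Qed.

(** A matching whose sources are also its targets is a permutation of these
    vertices; the others are left fixed. *)
Lemma matching_perm M : matching M -> sources M = targets M ->
  exists s : {perm T}, (forall e, e \in M -> s e.1 = e.2) /\
                       (forall v, v \notin sources M -> s v = v).
Proof.
case=> f1 s1 DC.
pose h v := if [pick w | (v, w) \in M] is Some w then w else v.
have hM e : e \in M -> h e.1 = e.2.
  case: e => a b e; rewrite /h /=; case: pickP => [w aw|/(_ b)]; last by rewrite e.
  by have /(_ erefl)[] := f1 _ _ aw e.
have hN v : v \notin sources M -> h v = v.
  move=> vM; rewrite /h; case: pickP => // w vw.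
  by case/negP: vM; apply/imsetP; exists (v, w).
have hin v : v \in sources M -> (v, h v) \in M.
  by case/imsetP => -[a b] e ->; rewrite (hM _ e).
have hinj : injective h.
  move=> v w; have [vM|vM] := boolP (v \in sources M); have [wM|wM] := boolP (w \in sources M).
  - by move=> E; have /(_ E)[] := s1 _ _ (hin _ vM) (hin _ wM).
  - rewrite (hN _ wM) => E; case/negP: wM; rewrite DC.
    by apply/imsetP; exists (v, h v); [exact: hin|].
  - rewrite (hN _ vM) => E; case/negP: vM; rewrite DC.
    by apply/imsetP; exists (w, h w); [exact: hin|].
  - by rewrite !hN.
by exists (perm hinj); split=> v vM; rewrite permE; [exact: hM|exact: hN].
Qed.

Lemma card_sources M : matching M -> #|sources M| = #|M|.
Proof. by case=> f1 _; exact: card_in_imset. Qed.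
Lemma card_targets M : matching M -> #|targets M| = #|M|.
Proof. by case=> _ s1; exact: card_in_imset. Qed.

Lemma sub_matching M N : N \subset M -> matching M -> matching N.
Proof.
by move=> /fintype.subsetP sub [f1 s1]; split=> e e' /sub h /sub h'; [exact: f1|exact: s1].
Qed.

End Matching.

Section Dual.
Variable n : nat.
Implicit Types (Ab Bb Kb Cb : 'M[bool]_n) (M : {set vertex n * vertex n}).

Lemma sys_dual Ab Bb Cb v w :
  sys_digraph Ab^T Cb^T Bb^T (dualV v) (dualV w) = sys_digraph Ab Bb Cb w v.
Proof. by case: v => [[i|i]|i]; case: w => [[j|j]|j]; rewrite //= mxE. Qed.

Definition dualE (e : vertex n * vertex n) := (dualV e.2, dualV e.1).
Lemma dualEK : involutive dualE.
Proof. by case=> v w; rewrite /dualE /= !dualVK. Qed.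

Definition dualM M : {set vertex n * vertex n} := [set dualE e | e in M]%SET.

Lemma in_dualM M e : (e \in dualM M) = (dualE e \in M).
Proof. by rewrite -{1}[e]dualEK mem_imset //; exact: can_inj dualEK. Qed.

Lemma dual_matching M : matching M -> matching (dualM M).
Proof.
case=> f1 s1; split=> e e'; rewrite !in_dualM => h h' E; apply: (can_inj dualEK).
  by apply: s1 => //; rewrite /= E.
by apply: f1 => //; rewrite /= E.
Qed.

Lemma sources_dualM M v : (v \in sources (dualM M)) = (dualV v \in targets M).
Proof.
apply/imsetP/imsetP => -[e he E].
  by exists (dualE e); rewrite -?in_dualM //= E.
by exists (dualE e); rewrite ?in_dualM ?dualEK //= -E dualVK.
Qed.

Lemma targets_dualM M v : (v \in targets (dualM M)) = (dualV v \in sources M).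
Proof.
apply/imsetP/imsetP => -[e he E].
  by exists (dualE e); rewrite -?in_dualM //= E.
by exists (dualE e); rewrite ?in_dualM ?dualEK //= -E dualVK.
Qed.

Lemma card_dualM M : #|dualM M| = #|M|.
Proof. exact: card_imset (can_inj dualEK). Qed.

End Dual.

Section TermRank.
Variable n : nat.
Implicit Types (Ab Bb Kb Cb : 'M[bool]_n) (M : {set vertex n * vertex n}).

Definition edges (g : rel (vertex n)) : {set vertex n * vertex n} := [set e | g e.1 e.2]%SET.

Definition state_edges Ab : {set vertex n * vertex n} :=
  [set e | is_state e.1 && is_state e.2 && sys_digraph Ab (no_mx n) (no_mx n) e.1 e.2]%SET.

(** The largest number of edges in a matching between states, which is the
    generic rank of the pattern. *)
Definition term_rank Ab : nat :=
  \max_(M : {set vertex n * vertex n} | `[< matching M /\ M \subset state_edges Ab >]) #|M|.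

Definition deficiency Ab : nat := n - term_rank Ab.

Lemma term_rank_max Ab M : matching M -> M \subset state_edges Ab -> #|M| <= term_rank Ab.
Proof. by move=> h1 h2; apply: (@leq_bigmax_cond _ _ (fun M => #|M|)); apply/asboolP. Qed.

Lemma term_rank_attained Ab : exists M, [/\ matching M, M \subset state_edges Ab & #|M| = term_rank Ab].
Proof.
have [|M /asboolP[h1 h2] E] := @eq_bigmax_cond _
  [pred M : {set vertex n * vertex n} | `[< matching M /\ M \subset state_edges Ab >]] (fun M => #|M|).
  apply/card_gt0P; exists finset.set0; rewrite inE /=; split; last exact: finset.sub0set.
  by split=> e; rewrite inE.
by exists M; split=> //; exact: esym E.
Qed.

Lemma term_rank_tr Ab : term_rank Ab^T = term_rank Ab.
Proof.
suff le A : term_rank A <= term_rank A^T by apply/eqP; rewrite eqn_leq -{2}[Ab]trmxK !le.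
have [M [mM sM <-]] := term_rank_attained A; rewrite -card_dualM; apply: term_rank_max.
  exact: dual_matching.
apply/fintype.subsetP => e; rewrite in_dualM => /(fintype.subsetP sM); rewrite !inE.
by case: e => [[[i|i]|i] [[j|j]|j]] //=; rewrite mxE.
Qed.

Lemma state_edges_sources Ab M v : M \subset state_edges Ab -> v \in sources M -> is_state v.
Proof. by move=> /fintype.subsetP h /imsetP[e /h]; rewrite inE => /andP[/andP[? _] _] ->. Qed.
Lemma state_edges_targets Ab M v : M \subset state_edges Ab -> v \in targets M -> is_state v.
Proof. by move=> /fintype.subsetP h /imsetP[e /h]; rewrite inE => /andP[/andP[_ ?] _] ->. Qed.

Definition states : {set vertex n} := [set stateV i | i : 'I_n]%SET.

Lemma in_states v : (v \in states) = is_state v.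
Proof.
apply/imsetP/idP => [[i _ ->] //|]; case: v => [[i|i]|i] // _; by exists i.
Qed.

Lemma card_states : #|states| = n.
Proof. by rewrite card_imset ?card_ord // => i j []. Qed.

Lemma term_rank_le Ab : term_rank Ab <= n.
Proof.
have [M [mM sM <-]] := term_rank_attained Ab; rewrite -(card_sources mM) -[X in _ <= X]card_states.
by apply/subset_leq_card/fintype.subsetP => v /(state_edges_sources sM); rewrite in_states.
Qed.

Definition input_part M : {set 'I_n} := [set j | [exists i, (inputV j, stateV i) \in M]]%SET.

Lemma input_part_sub Ab Bb Kb Cb M : M \subset edges (closed_digraph Ab Bb Kb Cb) ->
  input_part M \subset nonzero_cols Bb.
Proof.
move=> /fintype.subsetP h; apply/fintype.subsetP => j; rewrite !inE => /existsP[i /h].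
by rewrite inE /closed_digraph /= orbF => Bij; apply/existsP; exists i.
Qed.

(** Edges from states contribute at most the term rank to a matching that
    enters all states; the others come from inputs. *)
Lemma deficiency_le_inputs Ab Bb Kb Cb M : matching M ->
  M \subset edges (closed_digraph Ab Bb Kb Cb) ->
  states \subset targets M -> deficiency Ab <= #|input_part M|.
Proof.
move=> mM /fintype.subsetP sM /fintype.subsetP cM.
pose MA := [set e in M | is_state e.1 && is_state e.2]%SET.
have MA_rho : #|MA| <= term_rank Ab.
  apply: term_rank_max; first by apply: sub_matching mM; apply/fintype.subsetP => e; rewrite inE => /andP[].
  apply/fintype.subsetP => e; rewrite !inE => /andP[/sM]; rewrite inE.
  by case: e => [[[i|i]|i] [[j|j]|j]] //=; rewrite /closed_digraph /= orbF => ->.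
pose ME := [set e in M | ~~ is_state e.1 && is_state e.2]%SET.
have ME_in : #|ME| <= #|input_part M|.
  have iinj : injective (@inputV n) by move=> i j [].
  rewrite -(card_imset _ iinj).
  rewrite -card_sources; last by apply: sub_matching mM; apply/fintype.subsetP => e; rewrite inE => /andP[].
  apply/subset_leq_card/fintype.subsetP => _ /imsetP[e + ->]; rewrite inE => /andP[eM].
  have := sM _ eM; rewrite inE.
  case: e eM => [[[i|i]|i] [[j|j]|j]] //= eM _ _; apply/imsetP; exists i => //.
  by rewrite inE; apply/existsP; exists j.
have : n <= #|MA| + #|ME|.
  rewrite -[X in X <= _]card_states -cardsUI.
  apply: leq_trans (leq_addr _ _).
  rewrite -(card_targets (_ : matching (MA :|: ME)%SET)); last first.
    by apply: sub_matching mM; apply/fintype.subsetP => e; rewrite !inE => /orP[]/andP[].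
  apply/subset_leq_card/fintype.subsetP => v vS; have /imsetP[e eM E] := cM _ vS.
  apply/imsetP; exists e => //; rewrite !inE eM -E.
  have sv : is_state v by rewrite -in_states.
  rewrite sv.
  by rewrite !andbT orbN.
rewrite /deficiency leq_subLR => h.
by apply: leq_trans h (leq_add _ _).
Qed.

End TermRank.

(** * Input patterns with few columns *)

Section Reduce.
Variable n : nat.
Implicit Types (Ab Bb Kb Cb : 'M[bool]_n) (M : {set vertex n * vertex n}).

Lemma state_matchedP Ab Bb : state_matched Ab Bb <->
  exists M, [/\ matching M, M \subset edges (sys_digraph Ab Bb (no_mx n)) & states n \subset targets M].
Proof.
split=> [[f finj hf]|[M [[f1 s1] /fintype.subsetP sM /fintype.subsetP cM]]].
  pose src i : vertex n := match f i with inl j => stateV j | inr j => inputV j end.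
  have srcinj : injective src.
    move=> i j; rewrite /src => E; apply: finj; move: E.
    by case: (f i) => a; case: (f j) => b // [->].
  exists [set (src i, stateV i) | i in 'I_n]%SET; split.
  - split=> _ _ /imsetP[i _ ->] /imsetP[j _ ->] /=; first by move=> /srcinj ->.
    by case=> ->.
  - apply/fintype.subsetP => _ /imsetP[i _ ->]; rewrite inE /src /=.
    by have := hf i; case: (f i).
  - apply/fintype.subsetP => _ /imsetP[i _ ->]; apply/imsetP.
    by exists (src i, stateV i) => //; apply/imsetP; exists i.
have h i : exists a : 'I_n + 'I_n, (match a with inl j => stateV j | inr j => inputV j end, stateV i) \in M.
  have : stateV i \in states n by rewrite in_states.
  move=> /cM/imsetP[[v w] vw /= E]; rewrite -E in vw.
  have := sM _ vw; rewrite inE /=.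
  by case: v vw => [[j|j]|j] // vw _; [exists (inl j)|exists (inr j)].
have [f hf] := choice h; exists f => [i j E|i].
  by have := hf i; rewrite E => hi; have /(_ erefl)[] := f1 _ _ hi (hf j).
by have := sM _ (hf i); rewrite inE; case: (f i).
Qed.

Lemma connect_from_state Ab Bb i w :
  connect (sys_digraph Ab Bb (no_mx n)) (stateV i) w ->
  connect (sys_digraph Ab (no_mx n) (no_mx n)) (stateV i) w.
Proof.
case/connectP => p; elim: p i => [|a p IH] i /=; first by move=> _ ->; exact: connect0.
case/andP; case: a => [[j|j]|j] //=; last by rewrite mxE.
by move=> Aji pp lw; apply: connect_trans (connect1 _) (IH _ pp lw).
Qed.

Lemma input_reachableP Ab Bb : input_reachable Ab Bb <->
  forall k, exists i j, Bb i j /\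
    connect (sys_digraph Ab (no_mx n) (no_mx n)) (stateV i) (stateV k).
Proof.
split=> h k.
  have [j /connectP[p]] := h k; case: p => [|a p] //= /andP[]; case: a => [[i|i]|i] //= Bij0 pp lw.
  by exists i, j; split=> //; apply: (@connect_from_state Ab Bb); apply/connectP; exists p.
have [i [j [bij ik]]] := h k; exists j; apply: (@connect_trans _ _ (stateV i)); first exact: connect1.
by apply: (connect_sub _ ik) => -[[a|a]|a] [[b|b]|b] //=; rewrite ?mxE // => ab; apply: connect1.
Qed.

Lemma state_edges_sub_sys Ab Bb M : M \subset state_edges Ab ->
  M \subset edges (sys_digraph Ab Bb (no_mx n)).
Proof.
move=> /fintype.subsetP h; apply/fintype.subsetP => e /h; rewrite !inE.
by case: e => [[[i|i]|i] [[j|j]|j]].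
Qed.

Lemma sys_sub_closed Ab Bb Kb Cb M : M \subset edges (sys_digraph Ab Bb (no_mx n)) ->
  M \subset edges (closed_digraph Ab Bb Kb Cb).
Proof.
move=> /fintype.subsetP h; apply/fintype.subsetP => e /h; rewrite !inE.
by case: e => [[[i|i]|i] [[j|j]|j]] //=; rewrite ?mxE // /closed_digraph /= => ->.
Qed.

(** Merging the given matching with a largest matching of state edges keeps
    the sources of the latter, so only the deficiency is left for inputs. *)
Lemma few_inputs_matching Ab Bb : state_matched Ab Bb ->
  exists M, [/\ matching M, M \subset edges (sys_digraph Ab Bb (no_mx n)),
    states n \subset targets M & #|input_part M| <= deficiency Ab].
Proof.
case/state_matchedP => M1 [m1 s1 c1]; have [M2 [m2 s2 r2]] := term_rank_attained Ab.
have [M [mM sM c12 d21]] := mendelsohn_dulmage m1 m2.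
have sM' : M \subset edges (sys_digraph Ab Bb (no_mx n)).
  apply: fintype.subset_trans sM _; rewrite finset.subUset s1 /=.
  exact: state_edges_sub_sys.
have cM : states n \subset targets M by exact: fintype.subset_trans c1 c12.
exists M; split => //.
have cM' : targets M \subset states n.
  apply/fintype.subsetP => _ /imsetP[e /(fintype.subsetP sM') + ->].
  by rewrite inE in_states; case: e => [[[i|i]|i] [[j|j]|j]] //=; rewrite mxE.
have cardM : #|M| = n.
  by rewrite -(card_targets mM) -[RHS](card_states n); apply/eqP; rewrite eqn_leq !subset_leq_card.
have iinj : injective (@inputV n) by move=> i j [].
rewrite /deficiency -(card_imset _ iinj) -r2 -(card_sources m2) -[X in _ <= X - _]cardM -(card_sources mM).
have disj : [disjoint [set inputV x | x in input_part M] & sources M2]%SET.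
  apply/pred0P => v /=; apply/negP => /andP[/imsetP[j _ ->]] /(state_edges_sources s2).
  by [].
rewrite leq_subRL; last exact: subset_leq_card.
rewrite addnC -cardsUI (_ : _ :&: _ = finset.set0)%SET; last first.
  by apply/eqP; rewrite setI_eq0.
rewrite cards0 addn0; apply: subset_leq_card; rewrite finset.subUset d21 andbT.
apply/fintype.subsetP => _ /imsetP[j + ->]; rewrite inE => /existsP[i ji].
by apply/imsetP; exists (inputV j, stateV i).
Qed.

(** Each driven state keeps a single entry: in its own column if the matching
    drives it, otherwise in a column that is in use anyway.  Reachability depends
    only on which states are driven. *)
Lemma reduce_cols Ab Bb : 0 < n -> input_reachable Ab Bb -> state_matched Ab Bb ->
  exists Bb', [/\ input_reachable Ab Bb', state_matched Ab Bb', nnz Bb' <= nnz Bb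
    & #|nonzero_cols Bb'| <= maxn (deficiency Ab) 1].
Proof.
move=> n0 hr /few_inputs_matching[M [[f1 s1] sM cM iM]].
(* If the matching uses inputs at all, j0 is one of them, so that collecting
   the remaining entries in column j0 creates no new effective input. *)
pose j0 := odflt (Ordinal n0) [pick j in input_part M].
pose c i := odflt j0 [pick j | (inputV j, stateV i) \in M].
pose Bb' : 'M[bool]_n := (\matrix_(i, j) ([exists k, Bb i k] && (j == c i)))%R.
have row_iff i : (exists j, Bb' i j) <-> (exists j, Bb i j).
  split=> [[j]|[k Bik]]; first by rewrite mxE => /andP[/existsP].
  by exists (c i); rewrite mxE eqxx andbT; apply/existsP; exists k.
have cE i j : (inputV j, stateV i) \in M -> c i = j.
  move=> ji; rewrite /c; case: pickP => [k ki|/(_ j)]; last by rewrite ji.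
  by have /(_ erefl)[] := s1 _ _ ki ji.
exists Bb'; split.
- apply/input_reachableP => k; have [i [j [bij ik]]] := (input_reachableP Ab Bb).1 hr k.
  by have [j' b'] := (row_iff i).2 (ex_intro _ j bij); exists i, j'.
- apply/state_matchedP; exists M; split => //.
  apply/fintype.subsetP => -[v w] vw; have := fintype.subsetP sM _ vw; rewrite !inE.
  case: v vw => [[i|j]|j] vw; case: w vw => [[i'|j']|j'] vw //= bij.
  by rewrite mxE (cE _ _ vw) eqxx andbT; apply/existsP; exists j.
- rewrite /nnz; pose p i : 'I_n * 'I_n := (i, odflt j0 [pick k | Bb i k]).
  have pinj : injective p by move=> i j [].
  pose q (e : 'I_n * 'I_n) := p e.1.
  have : {in [set e | Bb' e.1 e.2]%SET &, injective q}.
    move=> [i j] [i' j']; rewrite !inE !mxE /= => /andP[_ /eqP ->] /andP[_ /eqP ->].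
    by move/pinj => /= ->.
  move=> qinj; rewrite -(card_in_imset qinj); apply: subset_leq_card.
  apply/fintype.subsetP => _ /imsetP[[i j] + ->]; rewrite !inE mxE /= => /andP[/existsP[k bik] _].
  by case: pickP => [//|/(_ k)]; rewrite bik.
- have sub : nonzero_cols Bb' \subset j0 |: input_part M.
    apply/fintype.subsetP => j; rewrite inE; case/existsP => i; rewrite mxE => /andP[_ /eqP ->].
    rewrite in_setU1 /c; case: pickP => [k ki|_]; last by rewrite eqxx.
    by rewrite inE orbC /=; apply/orP; left; apply/existsP; exists i.
  apply: leq_trans (subset_leq_card sub) _; rewrite cardsU1.
  have [/set0Pn[j jM]|] := boolP (input_part M != finset.set0).
    have -> : j0 \in input_part M.
      by rewrite /j0; case: pickP => [//|/(_ j)]; rewrite jM.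
    by rewrite /= add0n leq_max iM.
  by move=> /negPn/eqP ->; rewrite cards0 addn0 leq_max; case: (_ \notin _); rewrite orbT.
Qed.

Lemma deficiency_le_cols Ab Bb : state_matched Ab Bb -> deficiency Ab <= #|nonzero_cols Bb|.
Proof.
case/state_matchedP => M [mM sM cM].
have sM' := sys_sub_closed (no_mx n) (no_mx n) sM.
apply: leq_trans (deficiency_le_inputs mM sM' cM) _.
exact: subset_leq_card (input_part_sub sM').
Qed.

(** The number m' of ports on each side: the deficiency, but at least 1 as
    soon as there is a state to drive. *)
Definition min_ports Ab := maxn (deficiency Ab) (0 < n).

Lemma min_ports_le_cols Ab Bb : input_reachable Ab Bb -> state_matched Ab Bb ->
  min_ports Ab <= #|nonzero_cols Bb|.
Proof.
move=> hr hm; rewrite geq_max deficiency_le_cols //=.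
case: (boolP (0 < n)) => // n0.
have [i [j [bij _]]] := (input_reachableP Ab Bb).1 hr (Ordinal n0).
by apply/card_gt0P; exists j; rewrite inE; apply/existsP; exists i.
Qed.

Lemma min_ports_tr Ab : min_ports Ab^T = min_ports Ab.
Proof. by rewrite /min_ports /deficiency term_rank_tr. Qed.

Lemma nnz_tr (Mb : 'M[bool]_n) : nnz Mb^T = nnz Mb.
Proof.
suff le (X : 'M[bool]_n) : nnz X <= nnz X^T by apply/eqP; rewrite eqn_leq -{2}[Mb]trmxK !le.
pose t (e : 'I_n * 'I_n) := (e.2, e.1).
have tinj : injective t by move=> [a b] [c d] [-> ->].
rewrite /nnz -(card_imset _ tinj); apply: subset_leq_card.
by apply/fintype.subsetP => _ /imsetP[e + ->]; rewrite !inE mxE.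
Qed.

Lemma nonzero_cols_tr (Mb : 'M[bool]_n) : nonzero_cols Mb^T = nonzero_rows Mb.
Proof.
by apply/setP => i; rewrite !inE; apply/existsP/existsP => -[j]; rewrite ?mxE => h; exists j; rewrite ?mxE.
Qed.

Lemma nnz_fb (Kb : 'M[bool]_n) : nnz Kb = #|fb_edges Kb|.
Proof.
rewrite -nnz_tr /nnz /fb_edges; apply: eq_card => e; by rewrite !inE mxE.
Qed.

End Reduce.

(** * Cycle covers and matchings of inputs with outputs *)

Section Covers.
Variables (n : nat) (Ab Bb Cb : 'M[bool]_n).
Implicit Types (Kb : 'M[bool]_n) (M : {set vertex n * vertex n}).
Local Notation sys := (sys_digraph Ab Bb Cb).
Local Notation closed Kb := (closed_digraph Ab Bb Kb Cb).

(** Feedback is a bijection from effective outputs to effective inputs. *)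
Definition perfect_fb Kb : Prop :=
  [/\ matching (fb_edges Kb), sources (fb_edges Kb) = nonzero_rows Cb
    & targets (fb_edges Kb) = nonzero_cols Bb].

Definition output_part M := input_part (dualM M).

Lemma sources_input M j : M \subset edges sys ->
  (inputV j \in sources M) = (j \in input_part M).
Proof.
move=> /fintype.subsetP sM; rewrite inE; apply/imsetP/existsP => [[[v w] vw /= E]|[i ji]].
  rewrite -E in vw; have := sM _ vw; rewrite inE /=.
  by case: w {E} vw => [[i|i]|i] // vw _; exists i.
by exists (inputV j, stateV i).
Qed.

Lemma dual_edges M : M \subset edges sys ->
  dualM M \subset edges (sys_digraph Ab^T Cb^T Bb^T).
Proof.
move=> /fintype.subsetP sM; apply/fintype.subsetP => e; rewrite in_dualM => /sM.
by rewrite !inE /= -sys_dual !dualVK.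
Qed.

Lemma sys_edges_closed Kb M : M \subset edges sys -> M \subset edges (closed Kb).
Proof.
move=> /fintype.subsetP sM; apply/fintype.subsetP => e /sM; rewrite !inE /closed_digraph /=.
by move=> ->.
Qed.

Definition cover_edges (g : rel (vertex n)) (s : {perm vertex n}) :=
  [set e in edges g | e.2 == s e.1]%SET.

Lemma cover_edges_matching (g : rel (vertex n)) s : cycle_cover g s ->
  [/\ matching (cover_edges g s), cover_edges g s \subset edges g
    & states n \subset targets (cover_edges g s)].
Proof.
move=> cov; split.
- split=> -[a b] [c d]; rewrite !inE /= => /andP[_ /eqP ->] /andP[_ /eqP ->]; first by move=> ->.
  by move=> /perm_inj ->.
- by apply/fintype.subsetP => e; rewrite inE => /andP[].
- apply/fintype.subsetP => v; rewrite in_states => sv; apply/imsetP.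
  exists ((s^-1)%g v, v) => //; rewrite !inE /= permKV eqxx andbT.
  have := cov ((s^-1)%g v); rewrite permKV => /orP[//|/andP[/eqP <-]].
  by rewrite sv.
Qed.

End Covers.

Section CoverConstruction.
Variables (n : nat) (Ab Bb Cb : 'M[bool]_n).
Implicit Types (Kb : 'M[bool]_n) (M : {set vertex n * vertex n}).
Local Notation sys := (sys_digraph Ab Bb Cb).
Local Notation closed Kb := (closed_digraph Ab Bb Kb Cb).

Lemma targets_output M i : M \subset edges sys ->
  (outputV i \in targets M) = (i \in output_part M).
Proof.
by move=> sM; rewrite -(sources_input _ (dual_edges sM)) sources_dualM.
Qed.

Lemma sys_source M v : M \subset edges sys -> v \in sources M ->
  if v is inr _ then false else true.
Proof.
move=> /fintype.subsetP sM /imsetP[[a b] /sM + /= E]; rewrite inE /= -E.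
by case: v E.
Qed.

Lemma sys_target M v : M \subset edges sys -> v \in targets M ->
  if v is inl (inr _) then false else true.
Proof.
move=> /fintype.subsetP sM /imsetP[[a b] /sM + /= E]; rewrite inE /= -E.
by case: v E => [[i|i]|i] //; case: a => [[]|].
Qed.

Lemma min_ports_deficiency : deficiency Ab != 0 -> min_ports Ab = deficiency Ab.
Proof. by rewrite /min_ports; case: (0 < n) => /=; lia. Qed.

(** Deficiency zero: cycles of state edges alone cover the states. *)
Lemma full_matching : deficiency Ab = 0 -> exists M,
  [/\ matching M, M \subset state_edges Ab, sources M = states n & targets M = states n].
Proof.
have [M [mM sM rM]] := term_rank_attained Ab; rewrite /deficiency => d0.
have cM : #|M| = n by apply/eqP; rewrite eqn_leq {1}rM term_rank_le rM -subn_eq0 d0.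
exists M; split => //; apply/eqP; rewrite eqEcard card_states ?card_sources ?card_targets // cM leqnn andbT.
  by apply/fintype.subsetP => v /(state_edges_sources sM); rewrite in_states.
by apply/fintype.subsetP => v /(state_edges_targets sM); rewrite in_states.
Qed.

(** A matching that enters all states and one that leaves all states merge
    into one that does both. *)
Lemma double_cover : state_matched Ab Bb -> state_matched Ab^T Cb^T ->
  exists M, [/\ matching M, M \subset edges sys, states n \subset sources M
    & states n \subset targets M].
Proof.
case/state_matchedP => M1 [m1 s1 c1] /state_matchedP[M2 [m2 s2 c2]].
have [M [mM sM h1 h2]] := mendelsohn_dulmage m1 (dual_matching m2).
exists M; split => //; last exact: fintype.subset_trans c1 h1.
- apply: fintype.subset_trans sM _; rewrite finset.subUset; apply/andP; split.
    apply: fintype.subset_trans s1 _; apply/fintype.subsetP => e; rewrite !inE.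
    by case: e => [[[i|i]|i] [[j|j]|j]] //=; rewrite mxE.
  apply/fintype.subsetP => e; rewrite in_dualM => /(fintype.subsetP s2); rewrite !inE.
  by case: e => [[[i|i]|i] [[j|j]|j]] //=; rewrite !mxE.
- apply: fintype.subset_trans h2; apply/fintype.subsetP => v vs.
  rewrite sources_dualM; apply: (fintype.subsetP c2); move: vs; rewrite !in_states.
  by case: v => [[]|].
Qed.

(** In a matching of system edges that enters and leaves every state, the
    number of used inputs is at least the deficiency, so all effective inputs
    are used, and likewise all effective outputs.  The feedback edges then close
    the paths into cycles. *)
Lemma cover_of_perfect_fb Kb : state_matched Ab Bb -> state_matched Ab^T Cb^T ->
  #|nonzero_cols Bb| <= min_ports Ab -> #|nonzero_rows Cb| <= min_ports Ab ->
  perfect_fb Bb Cb Kb -> exists s, cycle_cover (closed Kb) s.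
Proof.
move=> mB mC leB leC [mF sF tF].
(* Cycles avoiding the ports suffice when the deficiency is 0; then the
   matching of state edges need not meet the ports. *)
have [d0|d0] := eqVneq (deficiency Ab) 0.
  have [M [mM sM dM cM]] := full_matching d0.
  have [|s [s1 s2]] := matching_perm mM; first by rewrite dM cM.
  exists s => v; have [vM|vM] := boolP (v \in sources M).
    have /imsetP[e eM ->] := vM; rewrite (s1 _ eM); apply/orP; left.
    have := fintype.subsetP sM _ eM; rewrite inE; case: e {eM} => [[[i|i]|i] [[j|j]|j]] //=.
    by rewrite /closed_digraph /= => ->.
  by rewrite s2 // eqxx -in_states -dM vM orbT.
rewrite min_ports_deficiency // in leB leC.
have [M [mM sM dM cM]] := double_cover mB mC.
have sMc := sys_edges_closed Kb sM.
have EX : input_part M = nonzero_cols Bb.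
  apply/eqP; rewrite eqEcard (input_part_sub sMc) /=.
  exact: leq_trans leB (deficiency_le_inputs mM sMc cM).
have EY : output_part M = nonzero_rows Cb.
  have sMd := sys_edges_closed Kb (dual_edges sM).
  apply/eqP; rewrite eqEcard -nonzero_cols_tr (input_part_sub sMd) /= nonzero_cols_tr.
  rewrite -[deficiency Ab](_ : deficiency Ab^T = _) in leC; last by rewrite /deficiency term_rank_tr.
  apply: leq_trans leC (deficiency_le_inputs (dual_matching mM) sMd _).
  apply/fintype.subsetP => v vs; rewrite targets_dualM; apply: (fintype.subsetP dM).
  by move: vs; rewrite !in_states; case: v => [[]|].
pose F := [set fb_edge f | f in fb_edges Kb]%SET.
have inF e : reflect (exists2 f, f \in fb_edges Kb & e = fb_edge f) (e \in F) by apply: imsetP.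
(* System edges never leave an output nor enter an input, feedback edges do
   only that, so the union is again a matching. *)
pose N := (M :|: F)%SET.
have mN : matching N.
  case: mM => f1 s1; case: mF => f2 s2.
  split=> e e'; rewrite !finset.in_setU => /orP[h|/inF[f hf ->]] /orP[h'|/inF[f' hf' ->]] /=.
  - exact: f1.
  - move=> E; have : e.1 \in sources M by apply: imset_f.
    by rewrite E => /(sys_source sM).
  - move=> E; have : e'.1 \in sources M by apply: imset_f.
    by rewrite -E => /(sys_source sM).
  - by case=> /(f2 _ _ hf hf') ->.
  - exact: s1.
  - move=> E; have : e.2 \in targets M by apply: imset_f.
    by rewrite E => /(sys_target sM).
  - move=> E; have : e'.2 \in targets M by apply: imset_f.
    by rewrite -E => /(sys_target sM).
  - by case=> /(s2 _ _ hf hf') ->.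
have sourcesN v : (v \in sources N) = (v \in sources M) || (v \in sources F).
  by rewrite /sources imsetU finset.in_setU.
have targetsN v : (v \in targets N) = (v \in targets M) || (v \in targets F).
  by rewrite /targets imsetU finset.in_setU.
have sF_out j : (outputV j \in sources F) = (j \in nonzero_rows Cb).
  rewrite -sF; apply/imsetP/imsetP => [[_ /inF[f hf ->] [->]]|[f hf ->]]; first by exists f.
  by exists (fb_edge f) => //; apply/inF; exists f.
have tF_in j : (inputV j \in targets F) = (j \in nonzero_cols Bb).
  rewrite -tF; apply/imsetP/imsetP => [[_ /inF[f hf ->] [->]]|[f hf ->]]; first by exists f.
  by exists (fb_edge f) => //; apply/inF; exists f.
have sF_no v : (if v is inr _ then false else true) -> (v \in sources F) = false.
  by move=> h; apply/negP => /imsetP[_ /inF[f _ ->] E]; rewrite E in h.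
have tF_no v : (if v is inl (inr _) then false else true) -> (v \in targets F) = false.
  by move=> h; apply/negP => /imsetP[_ /inF[f _ ->] E]; rewrite E in h.
have EN : sources N = targets N.
  apply/setP => v; rewrite sourcesN targetsN; case: v => [[i|i]|i].
  - have hs : inl (inl i) \in states n by rewrite in_states.
    by rewrite (fintype.subsetP dM _ hs) (fintype.subsetP cM _ hs).
  - rewrite -/(inputV i) sF_no // orbF (sources_input _ sM) EX tF_in.
    have -> : (inputV i \in targets M) = false by apply/negP => /(sys_target sM).
    by [].
  - rewrite -/(outputV i) tF_no // orbF targets_output // EY sF_out.
    have -> : (outputV i \in sources M) = false by apply/negP => /(sys_source sM).
    by [].
have [s [s1 s2]] := matching_perm mN EN.
exists s => v; have [vN|vN] := boolP (v \in sources N).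
  have /imsetP[e eN ->] := vN; rewrite (s1 _ eN); apply/orP; left.
  move: eN; rewrite finset.in_setU => /orP[/(fintype.subsetP sMc)|/inF[f hf ->]]; first by rewrite inE.
  by move: hf; rewrite inE /closed_digraph /=.
rewrite s2 // eqxx; apply/orP; right; apply: contraNN vN => sv.
by rewrite sourcesN (fintype.subsetP dM) // in_states.
Qed.

Definition is_output (v : vertex n) := if v is inr _ then true else false.

(** Following the cycle from a covered input until the first output gives a
    path without feedback edge.  Two inputs cannot lead to the same output: going
    backwards from it, the nearest input comes right after an output. *)
Lemma cover_io_matching Kb s : cycle_cover (closed Kb) s ->
  exists L : {set 'I_n * 'I_n}, is_matching (io_edges Ab Bb Cb) L /\ deficiency Ab <= #|L|.
Proof.
move=> cov; have [mMs sMs cMs] := cover_edges_matching cov.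
set Ms := cover_edges _ _ in mMs sMs cMs.
have le := deficiency_le_inputs mMs sMs cMs.
set X := input_part Ms in le.
have Xedge j : j \in X -> closed Kb (inputV j) (s (inputV j)).
  by rewrite inE; case/existsP => i; rewrite !inE /= => /andP[h /eqP <-].
have exit j : exists ki : nat * 'I_n, j \in X ->
    (s ^+ ki.1)%g (inputV j) = outputV ki.2 /\
    (forall k, k < ki.1 -> ~~ is_output ((s ^+ k)%g (inputV j))).
  have [jX|] := boolP (j \in X); last by exists (0, j).
  have ex : exists k, is_output ((s ^+ k)%g (inputV j)).
    have : (s^-1)%g (inputV j) \in porbit s (inputV j).
      by rewrite -porbitV -{1}[(s^-1)%g]expg1 mem_porbit.
    case/porbitP => k E; exists k; rewrite -{}E.
    have := cov ((s^-1)%g (inputV j)); rewrite permKV => /orP[|/andP[/eqP E _]].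
      by case: ((s^-1)%g _) => [[i|i]|i].
    have := Xedge _ jX; rewrite {2}E permKV.
    by rewrite /closed_digraph.
  have [k hk mk] := ex_minnP ex.
  case E : ((s ^+ k)%g (inputV j)) hk => [|i] // _.
  by exists (k, i) => _; split=> // k' lt; apply/negP => /mk; rewrite leqNgt lt.
have [t ht] := choice exit.
have path_ j k : j \in X -> k <= (t j).1 -> connect sys (inputV j) ((s ^+ k)%g (inputV j)).
  move=> jX; elim: k => [|k IH] lt; first by rewrite expg0 perm1 connect0.
  apply: connect_trans (IH (ltnW lt)) _.
  have no := (ht _ jX).2 _ lt; rewrite expgSr permM.
  case/orP: (cov ((s ^+ k)%g (inputV j))) => [|/andP[/eqP -> _]]; last exact: connect0.
  move: no; case: (s _) => [[a|a]|a]; case: ((s ^+ k)%g _) => [[b|b]|b] //= _;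
    by rewrite /closed_digraph /= ?orbF // => h; apply: connect1.
have tpos j : j \in X -> 0 < (t j).1.
  by move=> jX; have := (ht _ jX).1; case: (t j).1 => // ; rewrite expg0 perm1.
have trow j : j \in X -> (t j).2 \in nonzero_rows Cb.
  move=> jX; have [E no] := ht _ jX; have p := tpos _ jX.
  have lt : (t j).1.-1 < (t j).1 by rewrite prednK.
  have := no _ lt; move: E; rewrite -(prednK p) expgSr permM /=.
  have := cov ((s ^+ (t j).1.-1)%g (inputV j)).
  case/orP => [+ E|/andP[/eqP E _] E']; last by rewrite -E E'.
  rewrite E inE; case: ((s ^+ _)%g _) => [[a|a]|a] //=.
  by rewrite /closed_digraph /= orbF => h _; apply/existsP; exists a.
pose M := [set (j, (t j).2) | j in X]%SET.
have tinj j j' : j \in X -> j' \in X -> (t j).2 = (t j').2 -> (t j).1 <= (t j').1 -> j = j'.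
  move=> jX jX' E le'; have [E1 _] := ht _ jX; have [E2 no] := ht _ jX'.
  have : (s ^+ (t j).1)%g (inputV j) = (s ^+ (t j).1)%g ((s ^+ ((t j').1 - (t j).1))%g (inputV j')).
    by rewrite -permM -expgD subnK // E1 E2 E.
  move/perm_inj; case D : ((t j').1 - (t j).1) => [|d].
    by rewrite expg0 perm1 => -[].
  rewrite expgSr permM => Ej.
  have lt : d < (t j').1 by have := tpos _ jX; lia.
  have := no _ lt; set w := (s ^+ d)%g _ in Ej *.
  case/orP: (cov w) => [|/andP[/eqP E' _] _].
    by rewrite -Ej; case: w {Ej} => [[a|a]|a].
  have Ew : w = inputV j by rewrite -E' -Ej.
  by have := Xedge _ jX; rewrite -Ew E' Ew.
exists M; split; last first.
  by rewrite card_imset // => j j' [].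
split.
- apply/fintype.subsetP => _ /imsetP[j jX ->]; rewrite inE /= trow //.
  rewrite (fintype.subsetP (input_part_sub sMs)) //= -(ht _ jX).1.
  exact: path_.
- by move=> _ _ /imsetP[j _ ->] /imsetP[j' _ ->] /= ->.
- move=> _ _ /imsetP[j jX ->] /imsetP[j' jX' ->] /= E.
  by case: (leqP (t j).1 (t j').1) => [|/ltnW] le'; [rewrite (tinj j j')|rewrite (tinj j' j)].
Qed.

End CoverConstruction.

(** * Feedback configurations *)

Section Pairings.
Variables (n : nat).
Implicit Types (Ab Bb Kb Cb : 'M[bool]_n) (M F : {set 'I_n * 'I_n}).

Lemma sysA_sub Ab Bb Cb v w : connect (sys_digraph Ab (no_mx n) (no_mx n)) v w ->
  connect (sys_digraph Ab Bb Cb) v w.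
Proof.
apply: connect_sub => -[[a|a]|a] [[b|b]|b] //=; rewrite ?mxE // => ab; exact: connect1.
Qed.

(** The input found is effective because a path leaves it. *)
Lemma reach_input Ab Bb Cb : input_reachable Ab Bb -> forall k, exists2 j,
  j \in nonzero_cols Bb & connect (sys_digraph Ab Bb Cb) (inputV j) (stateV k).
Proof.
move=> /input_reachableP h k; have [i [j [bij ik]]] := h k; exists j.
  by rewrite inE; apply/existsP; exists i.
by apply: connect_trans (sysA_sub _ _ ik); apply: connect1.
Qed.

Lemma reach_output Ab Bb Cb : input_reachable Ab^T Cb^T -> forall k, exists2 i,
  i \in nonzero_rows Cb & connect (sys_digraph Ab Bb Cb) (stateV k) (outputV i).
Proof.
move=> h k; have [j + jk] := reach_input Bb^T h k; rewrite nonzero_cols_tr => jC.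
exists j => //.
have := @hom_connect _ _ _ (fun v w => sys_digraph Ab Bb Cb w v) (@dualV n) _ _ _ jk.
rewrite (connect_rev (sys_digraph Ab Bb Cb)) /=; apply => a b.
by rewrite -(sys_dual Ab Bb Cb) !dualVK.
Qed.

Lemma perfect_fb_exists Bb Cb : #|nonzero_cols Bb| = #|nonzero_rows Cb| ->
  exists Kb, perfect_fb Bb Cb Kb.
Proof.
set U := nonzero_cols Bb; set Y := nonzero_rows Cb => E.
pose Kb : 'M[bool]_n := (\matrix_(i, j) [&& i \in U, j \in Y & index i (enum U) == index j (enum Y)])%R.
have FE f : (f \in fb_edges Kb) = [&& f.2 \in U, f.1 \in Y & index f.2 (enum U) == index f.1 (enum Y)].
  by rewrite inE mxE.
have ieq (X : {set 'I_n}) i j : i \in X -> j \in X -> index i (enum X) = index j (enum X) -> i = j.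
  move=> iX jX e; rewrite -(nth_index i (_ : i \in enum X)) ?mem_enum // e nth_index //.
  by rewrite mem_enum.
have sz : size (enum U) = size (enum Y) by rewrite -!cardE.
exists Kb; split; first split.
- move=> [a b] [c d]; rewrite !FE /= => /and3P[bU aY /eqP e1] /and3P[dU cY /eqP e2] ac.
  by rewrite ac in e1 *; congr (_, _); apply: (ieq U) => //; rewrite e1 e2.
- move=> [a b] [c d]; rewrite !FE /= => /and3P[bU aY /eqP e1] /and3P[dU cY /eqP e2] ac.
  by rewrite ac in e1 *; congr (_, _); apply: (ieq Y) => //; rewrite -e1 -e2.
- apply/setP => j; apply/imsetP/idP => [[f + ->]|jY]; first by rewrite FE => /and3P[].
  have lt : index j (enum Y) < size (enum U) by rewrite sz index_mem mem_enum.
  exists (j, nth j (enum U) (index j (enum Y))) => //; rewrite FE /= jY index_uniq ?enum_uniq //.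
  by rewrite eqxx !andbT -mem_enum mem_nth.
- apply/setP => j; apply/imsetP/idP => [[f + ->]|jY]; first by rewrite FE => /and3P[].
  have lt : index j (enum U) < size (enum Y) by rewrite -sz index_mem mem_enum.
  exists (nth j (enum Y) (index j (enum U)), j) => //; rewrite FE /= jY index_uniq ?enum_uniq //.
  by rewrite eqxx !andbT -mem_enum mem_nth.
Qed.

(** When the deficiency is positive, any bijection between the ports serves
    as feedback for producing a cycle cover, from which the matching is read off. *)
Lemma io_matching_exists Ab Bb Cb :
  input_reachable Ab Bb -> state_matched Ab Bb ->
  input_reachable Ab^T Cb^T -> state_matched Ab^T Cb^T ->
  #|nonzero_cols Bb| <= min_ports Ab -> #|nonzero_rows Cb| <= min_ports Ab ->
  exists M, is_matching (io_edges Ab Bb Cb) M /\ min_ports Ab <= #|M|.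
Proof.
move=> rB mB rC mC leB leC.
have geB := min_ports_le_cols rB mB; have := min_ports_le_cols rC mC.
rewrite min_ports_tr nonzero_cols_tr => geC.
have [d0|d0] := eqVneq (deficiency Ab) 0; last first.
  have [|Kb pK] := @perfect_fb_exists Bb Cb.
    by apply/eqP; rewrite eqn_leq (leq_trans leB geC) (leq_trans leC geB).
  have [s cov] := cover_of_perfect_fb mB mC leB leC pK.
  by rewrite min_ports_deficiency //; exact: cover_io_matching cov.
rewrite /min_ports d0 max0n; case: (boolP (0 < n)) => [n0|_]; last first.
  by exists finset.set0; split=> //; split; rewrite ?finset.sub0set // => e e'; rewrite inE.
have [j jB jk] := reach_input Cb rB (Ordinal n0).
have [i iC ki] := reach_output Bb rC (Ordinal n0).
exists [set (j, i)]%SET; split; last by rewrite cards1.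
split=> [|e e'|e e']; first by rewrite finset.sub1set inE /= jB iC (connect_trans jk ki).
  by rewrite !finset.in_set1 => /eqP -> /eqP ->.
by rewrite !finset.in_set1 => /eqP -> /eqP ->.
Qed.

Lemma io_matching_card Ab Bb Cb M : is_matching (io_edges Ab Bb Cb) M ->
  [/\ #|M| <= #|nonzero_cols Bb|, sources M \subset nonzero_cols Bb & targets M \subset nonzero_rows Cb].
Proof.
case=> /fintype.subsetP sM f1 s1.
have h1 : sources M \subset nonzero_cols Bb.
  by apply/fintype.subsetP => _ /imsetP[e /sM + ->]; rewrite inE => /and3P[].
split => //; first by rewrite -(card_sources (conj f1 s1)) subset_leq_card.
by apply/fintype.subsetP => _ /imsetP[e /sM + ->]; rewrite inE => /and3P[].
Qed.

Lemma io_matching_perfect Ab Bb Cb M : is_matching (io_edges Ab Bb Cb) M ->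
  #|nonzero_cols Bb| <= #|M| -> #|nonzero_rows Cb| <= #|M| ->
  [/\ matching M, sources M = nonzero_cols Bb & targets M = nonzero_rows Cb].
Proof.
move=> mM leB leC; have [_ h1 h2] := io_matching_card mM.
have mm : matching M by case: mM.
by split => //; apply/eqP; rewrite eqEcard ?h1 ?h2 /= ?card_sources ?card_targets.
Qed.

(** Feeding the output of each pair to the input of the next pair puts all
    ports on one closed walk. *)
Lemma cyclic_fb Ab Bb Cb M : is_matching (io_edges Ab Bb Cb) M ->
  sources M = nonzero_cols Bb -> targets M = nonzero_rows Cb ->
  exists Kb, perfect_fb Bb Cb Kb /\
    forall i j, i \in nonzero_rows Cb -> j \in nonzero_cols Bb ->
      connect (closed_digraph Ab Bb Kb Cb) (outputV i) (inputV j).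
Proof.
rewrite /perfect_fb; case=> sM f1 s1 <- <-.
(* The pairs are arranged cyclically in the order of their enumeration. *)
pose s := enum M; have us : uniq s by exact: enum_uniq.
have ms e : (e \in s) = (e \in M) by exact: mem_enum.
pose nx := next s.
have nxM e : (nx e \in M) = (e \in M) by rewrite -!ms mem_next.
have pvM e : (prev s e \in M) = (e \in M) by rewrite -!ms mem_prev.
pose Kb : 'M[bool]_n := (\matrix_(i, j) [exists e in M, (e.2 == j) && ((nx e).1 == i)])%R.
have FE f : reflect (exists2 e, e \in M & f = (e.2, (nx e).1)) (f \in fb_edges Kb).
  rewrite inE mxE; apply: (iffP existsP) => [[e /and3P[eM /eqP e2 /eqP e1]]|[e eM ->]].
    by exists e => //; rewrite e1 e2; case: f {e1 e2}.
  by exists e; rewrite eM !eqxx.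
exists Kb; split; first split; first split.
- by move=> _ _ /FE[e eM ->] /FE[e' eM' ->] /= /(s1 _ _ eM eM') ->.
- move=> _ _ /FE[e eM ->] /FE[e' eM' ->] /= E.
  have {}E : nx e = nx e' by apply: f1; rewrite ?nxM.
  by rewrite (can_inj (prev_next us) E).
- apply/setP => j; apply/imsetP/imsetP => [[_ /FE[e eM ->] ->]|[e eM ->]]; first by exists e.
  by exists (e.2, (nx e).1) => //; apply/FE; exists e.
- apply/setP => j; apply/imsetP/imsetP => [[_ /FE[e eM ->] ->]|[e eM ->]].
    by exists (nx e); rewrite ?nxM.
  exists ((prev s e).2, (nx (prev s e)).1) => /=; last by rewrite /nx next_prev.
  by apply/FE; exists (prev s e); rewrite ?pvM.
move=> _ _ /imsetP[e eM ->] /imsetP[e' eM' ->].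
set g := closed_digraph _ _ _ _.
have fbc x : x \in M -> connect g (outputV x.2) (inputV (nx x).1).
  move=> xM; apply: connect1; rewrite /g /closed_digraph /=.
  have : (x.2, (nx x).1) \in fb_edges Kb by apply/FE; exists x.
  by rewrite inE.
have step x : x \in M -> connect g (inputV x.1) (inputV (nx x).1).
  move=> xM; apply: connect_trans (fbc _ xM).
  have := fintype.subsetP sM _ xM; rewrite inE => /and3P[_ _].
  by apply: connect_sub => a b ab; apply: connect1; rewrite /g /closed_digraph /= ab.
apply: connect_trans (fbc _ eM) _.
have : fconnect nx (nx e) e'.
  have := @fconnect_cycle _ nx s (cycle_next us) (nx e) _ e'.
  by rewrite !ms nxM eM' => ->.
have : nx e \in M by rewrite nxM.
move: (nx e) => x xM /connectP[p]; elim: p x xM => [|y p IH] x xM /=; first by move=> _ ->.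
case/andP => /eqP <- pp lp; apply: connect_trans (step _ xM) (IH _ _ pp lp).
by rewrite nxM.
Qed.

Lemma cyclic_fb_scc Ab Bb Cb Kb : input_reachable Ab Bb -> input_reachable Ab^T Cb^T ->
  perfect_fb Bb Cb Kb ->
  (forall i j, i \in nonzero_rows Cb -> j \in nonzero_cols Bb ->
      connect (closed_digraph Ab Bb Kb Cb) (outputV i) (inputV j)) ->
  states_in_fb_scc Ab Bb Kb Cb.
Proof.
move=> rB rC [_ sF tF] loop k.
have sub v w : connect (sys_digraph Ab Bb Cb) v w -> connect (closed_digraph Ab Bb Kb Cb) v w.
  by apply: connect_sub => a b ab; apply: connect1; rewrite /closed_digraph /= ab.
have [j jB /sub jk] := reach_input Cb rB k; have [i iC /sub ki] := reach_output Bb rC k.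
have /imsetP[f fF Ef] : i \in sources (fb_edges Kb) by rewrite sF.
have f2 : f.2 \in nonzero_cols Bb by rewrite -tF; apply/imsetP; exists f.
exists f.2, i => /=; split; first by move: fF; rewrite inE -Ef.
  by rewrite /same_scc ki (connect_trans (loop _ _ iC jB) jk).
rewrite /same_scc (connect_trans ki (loop _ _ iC f2)) /=.
have [i' [k' [bk kk]]] := (input_reachableP Ab Bb).1 rB k.
have : exists2 m, Bb m f.2 & true by move: f2; rewrite inE => /existsP[m]; exists m.
case=> m bm _.
have [i2 i2C /sub mi2] := reach_output Bb rC m.
apply: connect_trans (connect_trans (loop _ _ i2C jB) jk).
by apply: connect_trans mi2; apply: connect1; rewrite /closed_digraph /= bm.
Qed.

Local Notation flat es fs :=
  (flatten [seq [:: io_edge p.1; fb_edge p.2] | p <- zip es fs]).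

(** Reading off the vertices of the alternating cycle: each feedback edge
    starts where the previous pair ends and ends where the next one starts. *)
Lemma flat_path (es fs : seq ('I_n * 'I_n)) f e0 : size fs = size es ->
  path (fun e f => e.2 == f.1) (fb_edge f) (rcons (flat es fs) (io_edge e0)) ->
  map fst fs = map snd es /\ f.2 :: map snd fs = rcons (map fst es) e0.1.
Proof.
elim: es fs f => [|e es IH] [|f' fs] f //=; first by rewrite andbT => _ /eqP[->].
move=> [sz] /and3P[/eqP[Ef] /eqP[Ee] pp]; have [-> ->] := IH _ _ sz pp.
by rewrite Ef Ee.
Qed.

Lemma uniq_map_inj (T1 T2 : eqType) (h : T1 -> T2) (s : seq T1) :
  uniq (map h s) -> {in s &, injective h}.
Proof.
elim: s => // x s IH /= /andP[xs us] a b; rewrite !in_cons.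
case/orP => [/eqP ->|ha]; case/orP => [/eqP ->|hb] // E.
- by case/negP: xs; rewrite E map_f.
- by case/negP: xs; rewrite -E map_f.
- exact: IH.
Qed.

Lemma fb_family_perfect S F : matching S -> fb_family S F ->
  [/\ matching F, sources F = targets S & targets F = sources S].
Proof.
move=> [f1 s1] [[ES EF]|[es [fs [ues sz ES EF]]]].
  rewrite EF ES; split; first by split=> e; rewrite inE.
    by rewrite /sources /targets !imset0.
  by rewrite /sources /targets !imset0.
case/and3P => _ cyc _.
have [E1 E2] : map fst fs = map snd es /\ perm_eq (map snd fs) (map fst es).
  case: es fs sz cyc {ues ES EF} => [|e es] [|f fs] //= [sz] /andP[/eqP[Ee] pp].
  have [-> E] := flat_path sz pp; rewrite Ee; split => //.
  by rewrite E perm_rcons.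
have in1 : {in es &, injective fst}.
  by move=> a b aS bS; apply: f1; rewrite ES inE.
have in2 : {in es &, injective snd}.
  by move=> a b aS bS; apply: s1; rewrite ES inE.
have u1 : uniq (map fst fs) by rewrite E1 map_inj_in_uniq.
have u2 : uniq (map snd fs) by rewrite (perm_uniq E2) map_inj_in_uniq.
split; first split.
- by move=> a b; rewrite EF !inE; apply: uniq_map_inj.
- by move=> a b; rewrite EF !inE; apply: uniq_map_inj.
- apply/setP => j; apply/imsetP/imsetP => -[e]; rewrite ?EF ?ES inE => he ->.
    have : e.1 \in map snd es by rewrite -E1 map_f.
    by case/mapP => e' he' E'; exists e' => //; rewrite ?ES inE.
  have : e.2 \in map fst fs by rewrite E1 map_f.
  by case/mapP => e' he' E'; exists e' => //; rewrite ?EF inE.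
- apply/setP => j; apply/imsetP/imsetP => -[e]; rewrite ?EF ?ES inE => he ->.
    have : e.2 \in map fst es by rewrite -(perm_mem E2) map_f.
    by case/mapP => e' he' E'; exists e' => //; rewrite ?ES inE.
  have : e.1 \in map snd fs by rewrite (perm_mem E2) map_f.
  by case/mapP => e' he' E'; exists e' => //; rewrite ?EF inE.
Qed.

(** Within each class the feedback edges permute the ports of its pairs, and
    the classes partition a perfect matching. *)
Lemma configuration_perfect Bb Cb Kb M (S : 'I_#|M| -> {set 'I_n * 'I_n}) :
  matching M -> sources M = nonzero_cols Bb -> targets M = nonzero_rows Cb ->
  (forall i j, i != j -> [disjoint S i & S j]) -> (\bigcup_(i < #|M|) S i)%SET = M ->
  fb_configuration S Kb -> perfect_fb Bb Cb Kb.
Proof.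
move=> mM sM tM dS uS [E [hE uE]]; rewrite /perfect_fb -sM -tM uE.
have SM i : S i \subset M by rewrite -uS; apply: (finset.bigcup_sup i).
have fam i := fb_family_perfect (sub_matching (SM i) mM) (hE i).
have [f1 s1] := mM.
have same i j (e e' : 'I_n * 'I_n) : e \in S i -> e' \in S j -> e = e' -> i = j.
  move=> ei ej Ee; apply/eqP; apply: contraTT ei => ij.
  have /pred0P/(_ e) /= := dS _ _ ij; rewrite Ee ej andbT => ->; by [].
have Sin i e : e \in S i -> e \in M by apply: (fintype.subsetP (SM i)).
split; first split.
- move=> a b /bigcupP[i _ ai] /bigcupP[j _ bj] ab; have [[fi _] si _] := fam i.
  have [[_ _] sj _] := fam j.
  have : a.1 \in sources (E i) by apply: imset_f.
  rewrite si => /imsetP[e ei Ee].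
  have : b.1 \in sources (E j) by apply: imset_f.
  rewrite sj => /imsetP[e' ej Ee'].
  have ee : e = e' by apply: s1 (Sin _ _ ei) (Sin _ _ ej) _; rewrite -Ee -Ee'.
  by have ij := same _ _ _ _ ei ej ee; rewrite -ij in bj; apply: fi ai bj ab.
- move=> a b /bigcupP[i _ ai] /bigcupP[j _ bj] ab; have [[_ fi] _ si] := fam i.
  have [[_ _] _ sj] := fam j.
  have : a.2 \in targets (E i) by apply: imset_f.
  rewrite si => /imsetP[e ei Ee].
  have : b.2 \in targets (E j) by apply: imset_f.
  rewrite sj => /imsetP[e' ej Ee'].
  have ee : e = e' by apply: f1 (Sin _ _ ei) (Sin _ _ ej) _; rewrite -Ee -Ee'.
  by have ij := same _ _ _ _ ei ej ee; rewrite -ij in bj; apply: fi ai bj ab.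
- apply/setP => v; apply/imsetP/imsetP => [[e /bigcupP[i _ ei] ->]|[e]].
    have [_ si _] := fam i; have : e.1 \in sources (E i) by apply: imset_f.
    by rewrite si => /imsetP[e' /Sin e'M Ee]; exists e'.
  rewrite -{1}uS => /bigcupP[i _ ei] ->; have [_ si _] := fam i.
  have : e.2 \in targets (S i) by apply: imset_f.
  by rewrite -si => /imsetP[e' e'i Ee]; exists e' => //; apply/bigcupP; exists i.
- apply/setP => v; apply/imsetP/imsetP => [[e /bigcupP[i _ ei] ->]|[e]].
    have [_ _ si] := fam i; have : e.2 \in targets (E i) by apply: imset_f.
    by rewrite si => /imsetP[e' /Sin e'M Ee]; exists e'.
  rewrite -{1}uS => /bigcupP[i _ ei] ->; have [_ _ si] := fam i.
  have : e.1 \in sources (S i) by apply: imset_f.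
  by rewrite -si => /imsetP[e' e'i Ee]; exists e' => //; apply/bigcupP; exists i.
Qed.

Lemma flat_cycle (h : 'I_n * 'I_n -> 'I_n * 'I_n) es e e0 :
  fpath h e (rcons es e0) ->
  path (fun a b => a.2 == b.1) (fb_edge (e.2, (h e).1))
     (rcons (flat es [seq (x.2, (h x).1) | x <- es]) (io_edge e0)).
Proof.
elim: es e => [|e1 es IH] e /=; first by rewrite !andbT => /eqP ->.
by case/andP => /eqP -> pp; rewrite !eqxx /=; apply: IH.
Qed.

Lemma flat_uniq (h : 'I_n * 'I_n -> 'I_n * 'I_n) es :
  uniq (map fst es) -> uniq (map snd es) ->
  uniq (map fst (flat es [seq (x.2, (h x).1) | x <- es])).
Proof.
have mem (l : seq ('I_n * 'I_n)) v : (v \in map fst (flat l [seq (x.2, (h x).1) | x <- l])) ->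
  (exists2 e, e \in l & v = inputV e.1) \/ (exists2 e, e \in l & v = outputV e.2).
  elim: l => // e l IH /=; rewrite !in_cons => /or3P[/eqP ->|/eqP ->|/IH].
  - by left; exists e; rewrite ?mem_head.
  - by right; exists e; rewrite ?mem_head.
  - by case=> -[e' he' ->]; [left|right]; exists e'; rewrite ?in_cons ?he' ?orbT.
elim: es => //= e es IH /andP[n1 u1] /andP[n2 u2]; rewrite IH // andbT in_cons /=.
apply/andP; split; apply/negP => /mem[] [e' he'] //.
  by case=> E; case/negP: n1; rewrite E map_f.
by case=> E; case/negP: n2; rewrite E map_f.
Qed.

(** Going through a pair and then through feedback permutes the pairs; the
    classes are the orbits of this permutation. *)
Lemma perfect_configuration Bb Cb Kb M :
  matching M -> sources M = nonzero_cols Bb -> targets M = nonzero_rows Cb ->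
  perfect_fb Bb Cb Kb -> exists S : 'I_#|M| -> {set 'I_n * 'I_n},
  [/\ forall i j, i != j -> [disjoint S i & S j], (\bigcup_(i < #|M|) S i)%SET = M
    & fb_configuration S Kb].
Proof.
move=> [f1 s1] sM tM [[g1 t1] sF tF].
pose h e := odflt e [pick e' | [&& e \in M, e' \in M & Kb e'.1 e.2]].
have hM e : e \in M -> h e \in M /\ (e.2, (h e).1) \in fb_edges Kb.
  move=> eM; rewrite /h; case: pickP => [e' /and3P[_ e'M k]|no] /=; first by rewrite inE.
  have : e.2 \in sources (fb_edges Kb) by rewrite sF -tM; apply: imset_f.
  case/imsetP => f fF Ef.
  have : f.2 \in sources M by rewrite sM -tF; apply: imset_f.
  case/imsetP => e' e'M Ef'; have := no e'; rewrite eM e'M Ef -Ef'.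
  by move: fF; rewrite inE => ->.
have hN e : e \notin M -> h e = e.
  by move=> eM; rewrite /h; case: pickP => // e' /and3P[]; rewrite (negbTE eM).
have hinj : injective h.
  move=> a b; have [aM|aM] := boolP (a \in M); have [bM|bM] := boolP (b \in M) => E.
  - have [_ Fa] := hM _ aM; have [_ Fb] := hM _ bM; rewrite -E in Fb.
    by have [/(s1 _ _ aM bM)] := t1 _ _ Fa Fb erefl.
  - by have [] := hM _ aM; rewrite E hN // (negbTE bM).
  - by have [] := hM _ bM; rewrite -E hN // (negbTE aM).
  - by rewrite -(hN _ aM) E hN.
have orbM e x : e \in M -> fconnect h e x -> x \in M.
  move=> eM /connectP[p]; elim: p e eM => [|y p IH] e eM /=; first by move=> _ ->.
  by case/andP => /eqP <- pp lp; apply: IH pp lp; case: (hM _ eM).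
have csym := fconnect_sym hinj.
(* An orbit is indexed by the position of its canonical representative; the
   other positions get the empty class. *)
pose rt (i : 'I_#|M|) := froot h (enum_val i) == enum_val i.
pose S i : {set 'I_n * 'I_n} := if rt i then [set x in fingraph.orbit h (enum_val i)]%SET else finset.set0.
pose psi (e : 'I_n * 'I_n) := (e.2, (h e).1).
pose E i : {set 'I_n * 'I_n} := if rt i then [set x in map psi (fingraph.orbit h (enum_val i))]%SET else finset.set0.
have cover_ e : e \in M -> exists2 i, rt i & e \in fingraph.orbit h (enum_val i).
  move=> eM; have rM : froot h e \in M by apply: (orbM _ _ eM); exact: connect_root.
  exists (enum_rank_in rM (froot h e)); rewrite /rt enum_rankK_in //.
    exact: roots_root csym _.
  by rewrite -fconnect_orbit csym connect_root.
exists S; split.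
- move=> i j ij; rewrite /S; case: ifP => [ri|_]; last by apply/pred0P => x; rewrite /= inE.
  case: ifP => [rj|_]; last by apply/pred0P => x; rewrite /= !inE andbF.
  apply/pred0P => x /=; rewrite !inE -!fconnect_orbit; apply/negP => /andP[ix jx].
  case/eqP: ij; apply: enum_val_inj; rewrite -(eqP ri) -(eqP rj).
  by apply/eqP; rewrite (root_connect csym) (connect_trans ix) // csym.
- apply/setP => e; apply/bigcupP/idP => [[i _]|/cover_[i ri ei]].
    rewrite /S; case: ifP => _; rewrite inE // -fconnect_orbit.
    by apply: orbM; exact: enum_valP.
  by exists i => //; rewrite /S ri inE.
- exists E; split.
  + move=> i; rewrite /S /E; case: ifP => ri; last by left.
    right; exists (fingraph.orbit h (enum_val i)), (map psi (fingraph.orbit h (enum_val i))).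
    have sub : {subset fingraph.orbit h (enum_val i) <= M}.
      by move=> x; rewrite -fconnect_orbit; apply: orbM; exact: enum_valP.
    split; rewrite ?fingraph.orbit_uniq ?size_map //; apply/and3P; split.
    * by rewrite /fingraph.orbit; have := fingraph.order_gt0 h (enum_val i); case: (fingraph.order _ _).
    * have := fingraph.cycle_orbit hinj (enum_val i); case: (fingraph.orbit _ _) => // e es /= pp.
      by rewrite eqxx /=; apply: flat_cycle.
    * apply: flat_uniq; rewrite map_inj_in_uniq ?fingraph.orbit_uniq // => a b /sub aM /sub bM.
        exact: f1.
      exact: s1.
  + apply/setP => f; apply/idP/bigcupP => [fF|[i _]].
      have : f.1 \in targets M by rewrite tM -sF; apply: imset_f.
      case/imsetP => e eM Ef; have [_ eF] := hM _ eM.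
      have [i ri ei] := cover_ _ eM; exists i => //; rewrite /E ri inE.
      have -> : f = psi e by apply: g1.
      exact: map_f.
    rewrite /E; case: ifP => _; rewrite inE // => /mapP[e ei ->].
    have eM : e \in M by apply: orbM (enum_valP i) _; rewrite fconnect_orbit.
    by case: (hM _ eM).
Qed.

End Pairings.

(** * Optimal triples *)

Section Optimality.
Variables (R : realType) (n : nat).
Implicit Types (Ab Bb Kb Cb : 'M[bool]_n).
Local Notation sc := (struct_controllable R).

Lemma no_SFM_tr Ab Bb Kb Cb :
  ~ has_SFM R Ab Bb Kb Cb -> ~ has_SFM R Ab^T Cb^T Kb^T Bb^T.
Proof. by move=> h /has_SFM_tr; rewrite !trmxK. Qed.

(** Every input on a cycle of the cover is entered by a feedback edge, and
    there are at least as many such inputs as the deficiency. *)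
Lemma min_ports_le_nnz_fb Ab Bb Kb Cb : ~ has_SFM R Ab Bb Kb Cb ->
  min_ports Ab <= nnz Kb.
Proof.
move=> ns; have [s cov] := no_SFM_cover ns; have fb := no_SFM_fb_scc ns.
rewrite nnz_fb geq_max; apply/andP; split; last first.
  case: (boolP (0 < n)) => // n0; have [i [j [/= Kij _ _]]] := fb (Ordinal n0).
  by apply/card_gt0P; exists (j, i); rewrite inE.
set g := closed_digraph Ab Bb Kb Cb in cov.
have [mMs sMs cMs] := cover_edges_matching cov.
set Ms := cover_edges _ _ in mMs sMs cMs.
apply: leq_trans (deficiency_le_inputs mMs sMs cMs) _.
have sub : input_part Ms \subset targets (fb_edges Kb).
  apply/fintype.subsetP => j; rewrite inE; case/existsP => i; rewrite !inE /= => /andP[gji /eqP E].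
  have := cov ((s^-1)%g (inputV j)); rewrite permKV => /orP[|/andP[/eqP E' _]].
    case E' : ((s^-1)%g _) => [[a|a]|a] //=; rewrite /g /closed_digraph /= => Kja.
    by apply/imsetP; exists (a, j); rewrite ?inE.
  by move: gji; rewrite E {2}E' permKV /g /closed_digraph.
apply: leq_trans (subset_leq_card sub) _; exact: leq_imset_card.
Qed.

Lemma nnz_minimizer (P : 'M[bool]_n -> Prop) Bb : P Bb ->
  exists2 B0, P B0 & forall B', P B' -> nnz B0 <= nnz B'.
Proof.
move=> PB; pose p := [pred X : 'M[bool]_n | `[< P X >]].
have pB : p Bb by apply/asboolP.
case: (@arg_minnP _ Bb p (fun X => nnz X) pB) => B0 /asboolP PB0 m.
by exists B0 => // B' PB'; apply: m; apply/asboolP.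
Qed.

(** Rearranging a cheapest input pattern costs nothing. *)
Lemma few_columns_minimizer Ab Bb : sc Ab Bb -> exists B1 : 'M[bool]_n,
  [/\ sc Ab B1, forall B' : 'M[bool]_n, sc Ab B' -> nnz B1 <= nnz B'
    & #|nonzero_cols B1| <= min_ports Ab].
Proof.
move=> sB; have [B0 sB0 m0] := nnz_minimizer sB.
case: (boolP (0 < n)) => n0; last first.
  exists B0; split => //; apply: leq_trans (max_card _) _.
  by apply: leq_trans (leq0n _); rewrite card_ord leqNgt.
have [r0 mm0] := struct_controllable_necessary sB0.
have [B1 [r1 mm1 le1 c1]] := reduce_cols n0 r0 mm0.
exists B1; split.
- exact: struct_controllable_sufficient.
- by move=> B' /m0; apply: leq_trans.
- by rewrite /min_ports n0.
Qed.

(** An input without incoming feedback does not act on the closed loop. *)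
Lemma drop_column Ab Bb Kb Cb j : (forall i, ~~ Kb j i) ->
  has_SFM R Ab (\matrix_(a, b) (Bb a b && (b != j)))%R Kb Cb -> has_SFM R Ab Bb Kb Cb.
Proof.
move=> Kj h A B C pA pB pC.
have [|l hl] := h A (\matrix_(a, b) (if b == j then 0 else B a b))%R C pA _ pC.
  move=> a b; rewrite !mxE negb_and negbK; case: eqP => //= _; rewrite orbF; exact: pB.
exists l => K pK; have := hl _ pK; rewrite (_ : _ *m K = B *m K)%R //.
apply/matrixP => a b; rewrite !mxE; apply: eq_bigr => k _; rewrite mxE.
by case: eqP => // ->; rewrite pK // !(mulr0, mul0r).
Qed.

(** The three lower bounds are attained simultaneously. *)
Lemma feasible_bound Ab Bb Kb Cb : ~ has_SFM R Ab Bb Kb Cb -> exists B1 K1 C1 : 'M[bool]_n,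
  [/\ ~ has_SFM R Ab B1 K1 C1,
      forall B' : 'M[bool]_n, sc Ab B' -> nnz B1 <= nnz B',
      forall C' : 'M[bool]_n, sc Ab^T C'^T -> nnz C1 <= nnz C' & nnz K1 <= min_ports Ab].
Proof.
move=> ns; have sB := no_SFM_struct_controllable ns.
have sC := no_SFM_struct_controllable (no_SFM_tr ns).
have [B1 [sB1 mB cB]] := few_columns_minimizer sB.
have [D1 [sD1 mD cD]] := few_columns_minimizer sC.
pose C1 := (D1^T)%R; have ED : D1 = (C1^T)%R by rewrite /C1 trmxK.
rewrite ED in sD1 cD mD; rewrite min_ports_tr nonzero_cols_tr in cD.
have [rB mmB] := struct_controllable_necessary sB1.
have [rC mmC] := struct_controllable_necessary sD1.
have [M [mM leM]] := io_matching_exists rB mmB rC mmC cB cD.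
have [mm sM tM] := io_matching_perfect mM (leq_trans cB leM) (leq_trans cD leM).
have [K1 [pK loop]] := cyclic_fb mM sM tM.
have [s cov] := cover_of_perfect_fb mmB mmC cB cD pK.
exists B1, K1, C1; split => //.
- have fb := cyclic_fb_scc rB rC pK loop. exact: (no_SFM_sufficient fb cov).
- by move=> C' /mD; rewrite !nnz_tr.
- have [mF sF tF] := pK; by rewrite nnz_fb -(card_targets mF) tF.
Qed.

(** Optimality forces equality in the three lower bounds; an effective
    input that no feedback edge enters could be removed at a gain. *)
Lemma P2_structure Ab Bb Kb Cb : P2_solution R Ab Bb Kb Cb ->
  [/\ min_input R Ab Bb, nnz Kb = min_ports Ab
    & nonzero_cols Bb \subset targets (fb_edges Kb)].
Proof.
case=> ns opt; have [B1 [K1 [C1 [ns1 mB mC leK]]]] := feasible_bound ns.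
have sB := no_SFM_struct_controllable ns.
have sC := no_SFM_struct_controllable (no_SFM_tr ns).
have h1 := opt _ _ _ ns1; have h2 := mB _ sB; have h3 := mC _ sC.
have h4 := min_ports_le_nnz_fb ns.
split; first by split=> // B' /mB; lia.
  by lia.
apply/fintype.subsetP => j jB; apply/negPn/negP => jF.
have Kj i : ~~ Kb j i.
  by apply: contra jF => Kji; apply/imsetP; exists (i, j); rewrite ?inE.
have := opt _ _ _ (fun h => ns (drop_column Kj h)).
rewrite -addnA -[X in _ <= X]addnA leq_add2r leqNgt => /negP; apply.
apply: proper_card; apply/properP; split.
  by apply/fintype.subsetP => e; rewrite !inE mxE => /andP[].
move: jB; rewrite inE => /existsP[i bij]; exists (i, j); rewrite !inE ?mxE //=.
by rewrite eqxx andbF.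
Qed.

Lemma P2_solution_tr Ab Bb Kb Cb : P2_solution R Ab Bb Kb Cb ->
  P2_solution R Ab^T Cb^T Kb^T Bb^T.
Proof.
case=> ns opt; split=> [|B' K' C' ns']; first exact: no_SFM_tr.
have ns'' := no_SFM_tr ns'; rewrite trmxK in ns''.
by have := opt _ _ _ ns''; rewrite !nnz_tr; lia.
Qed.

Lemma min_output_tr Ab Cb : min_input R Ab^T Cb^T -> min_output R Ab Cb.
Proof. by case=> s m; split=> // C' s'; have := m _ s'; rewrite !nnz_tr. Qed.

(** There are m' feedback edges, they enter all of the at least m' effective
    inputs and, by duality, leave all of the at least m' effective outputs. *)
Lemma P2_perfect_fb Ab Bb Kb Cb : P2_solution R Ab Bb Kb Cb ->
  perfect_fb Bb Cb Kb.
Proof.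
move=> sol; have [mB nK sub] := P2_structure sol.
have [mC _ sub'] := P2_structure (P2_solution_tr sol).
have [rB mmB] := struct_controllable_necessary (proj1 mB).
have [rC mmC] := struct_controllable_necessary (proj1 mC).
have geB := min_ports_le_cols rB mmB; have := min_ports_le_cols rC mmC.
rewrite min_ports_tr nonzero_cols_tr => geC.
have EF : targets (fb_edges Kb^T%R) = sources (fb_edges Kb).
  apply/setP => j; apply/imsetP/imsetP => -[[a b] + ->] /=; rewrite inE /= ?mxE => k.
    by exists (b, a); rewrite ?inE.
  by exists (b, a); rewrite ?inE ?mxE.
rewrite EF nonzero_cols_tr in sub'.
rewrite nnz_fb in nK.
have leT : #|targets (fb_edges Kb)| <= #|fb_edges Kb| by exact: leq_imset_card.
have leS : #|sources (fb_edges Kb)| <= #|fb_edges Kb| by exact: leq_imset_card.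
have ET : nonzero_cols Bb = targets (fb_edges Kb).
  by apply/eqP; rewrite eqEcard sub (leq_trans leT) // nK.
have ES : nonzero_rows Cb = sources (fb_edges Kb).
  by apply/eqP; rewrite eqEcard sub' (leq_trans leS) // nK.
split=> //; split; apply/imset_injP; rewrite eqn_leq leq_imset_card /=.
  by rewrite -/(sources _) -ES nK.
by rewrite -/(targets _) -ET nK.
Qed.

Lemma P2_solution_P1_mix Ab Bb Kb Cb : P2_solution R Ab Bb Kb Cb ->
  P1_minimal_solution R Ab Bb Cb /\ mix_pairing Ab Bb Cb Kb.
Proof.
move=> sol; have pK := P2_perfect_fb sol; have [ns _] := sol.
have [mB nK _] := P2_structure sol.
have [mC nK' _] := P2_structure (P2_solution_tr sol).
rewrite nnz_fb in nK; have [mF sF tF] := pK.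
have cB : #|nonzero_cols Bb| = min_ports Ab by rewrite -tF (card_targets mF).
have cC : #|nonzero_rows Cb| = min_ports Ab by rewrite -sF (card_sources mF).
have [rB mmB] := struct_controllable_necessary (proj1 mB).
have [rC mmC] := struct_controllable_necessary (proj1 mC).
split.
  split; first by split => //; exact: min_output_tr.
    move=> B' [/struct_controllable_necessary[r' m'] _].
    by rewrite cB; exact: min_ports_le_cols.
  move=> C' [/struct_controllable_necessary[r' m'] _].
  by rewrite cC -min_ports_tr -nonzero_cols_tr; exact: min_ports_le_cols.
split; last exact: no_SFM_fb_scc ns.
have [||M [mM leM]] := io_matching_exists rB mmB rC mmC; rewrite ?cB ?cC //.
have [||mm sM tM] := io_matching_perfect mM; rewrite ?cB ?cC //.
have [S [dS uS cS]] := perfect_configuration mm sM tM pK.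
exists M, S; split => //; split => // M' /io_matching_card[le _ _].
by apply: leq_trans le _; rewrite cB.
Qed.

Lemma P1_mix_P2_solution Ab Bb Kb Cb :
  P1_minimal_solution R Ab Bb Cb -> mix_pairing Ab Bb Cb Kb ->
  P2_solution R Ab Bb Kb Cb.
Proof.
case=> -[[sB mB] [sC mC]] tB tC [[M [S [[mM maxM] dS uS cS]]] fb].
have cB : #|nonzero_cols Bb| <= min_ports Ab.
  have [B1 [sB1 m1 c1]] := few_columns_minimizer sB.
  by apply: leq_trans (tB _ _) c1.
have cC : #|nonzero_rows Cb| <= min_ports Ab.
  have [D1 [sD1 m1 c1]] := few_columns_minimizer sC.
  rewrite -(trmxK D1) nonzero_cols_tr min_ports_tr in c1.
  apply: leq_trans (tC _ _) c1; split; first by rewrite /struct_observable trmxK.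
  by move=> C' /m1; rewrite !nnz_tr.
have [rB mmB] := struct_controllable_necessary sB.
have [rC mmC] := struct_controllable_necessary sC.
have [M0 [mM0 leM0]] := io_matching_exists rB mmB rC mmC cB cC.
have leM := leq_trans leM0 (maxM _ mM0).
have [mm sM tM] := io_matching_perfect mM (leq_trans cB leM) (leq_trans cC leM).
have pK := configuration_perfect mm sM tM dS uS cS.
have [s cov] := cover_of_perfect_fb mmB mmC cB cC pK.
split; first exact: (no_SFM_sufficient fb cov).
move=> B' K' C' ns'.
have leB := mB _ (no_SFM_struct_controllable ns').
have leC := mC _ (no_SFM_struct_controllable (no_SFM_tr ns')).
have leK : nnz Kb <= nnz K'.
  apply: leq_trans (min_ports_le_nnz_fb ns'); have [mF _ tF] := pK.
  by rewrite nnz_fb -(card_targets mF) tF.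
by rewrite !leq_add.
Qed.

End Optimality.

Theorem theorem10 (R : realType) (n : nat) (Ab Bb Kb Cb : 'M[bool]_n) :
  P2_solution R Ab Bb Kb Cb <->
  P1_minimal_solution R Ab Bb Cb /\ mix_pairing Ab Bb Cb Kb.
Proof.
split; first exact: P2_solution_P1_mix.
by case=> h1 h2; exact: P1_mix_P2_solution.
Qed.
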